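(* Let $k$ be an algebraically closed field of characteristic $0$, let $p,q$ be prime numbers with $p^4<q$, and let $H$ be a semisimple Hopf algebra over $k$ of dimension $p^2q^2$. Then $|G(H^* )|\neq q$.
   Context: $G(H^* )$ is the group of group-like elements of the dual Hopf algebra $H^*$. *)

(* Defs.v *)
From HB Require Import structures.
From mathcomp Require Import all_boot all_order all_algebra all_field.

Set Implicit Arguments.
Unset Strict Implicit.
Unset Printing Implicit Defensive.

Import GRing.Theory.
Local Open Scope ring_scope.

Section Tensor.
Variable k : fieldType.
Implicit Types U V W X : vectType k.

(* A finite-dimensional tensor product: t i j is the coefficient of
   e_i (x) e_j, where (e_i) and (e_j) are the fixed bases of U and V. *)
Definition tensor U V := 'M[k]_(\dim {:U}, \dim {:V}).

Definition bvec U (i : 'I_(\dim {:U})) : U := (vbasis {:U})`_i.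

Definition tens U V (u : U) (v : V) : tensor U V :=
  \matrix_(i, j) (coord (vbasis {:U}) i u * coord (vbasis {:V}) j v).

(* The linear map with tlift f (tens u v) = f u v, for f bilinear
   (tlift_tens below). *)
Definition tlift U V W (f : U -> V -> W) (t : tensor U V) : W :=
  \sum_i \sum_j t i j *: f (bvec i) (bvec j).

Definition tmap U V U' V' (f : U -> U') (g : V -> V') :
    tensor U V -> tensor U' V' :=
  tlift (fun u v => tens (f u) (g v)).

Definition tassoc U V W : tensor (tensor U V) W -> tensor U (tensor V W) :=
  tlift (fun uv w => tlift (fun u v => tens u (tens v w)) uv).

Definition bilin U V W (f : U -> V -> W) :=
  (forall v, linear (fun u => f u v)) /\ (forall u, linear (f u)).

Lemma lin_id V : linear (@id V). Proof. by []. Qed.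

Lemma lin_hom U V (f : 'Hom(U, V)) : linear f.
Proof. exact: linearP. Qed.

Lemma lin_comp U V W (g : V -> W) (f : U -> V) :
  linear g -> linear f -> linear (fun u => g (f u)).
Proof. by move=> lg lf a u v; rewrite lf lg. Qed.

Lemma bilin_l U V W X (f : U -> V -> W) (g : X -> U) v :
  bilin f -> linear g -> linear (fun x => f (g x) v).
Proof. by move=> [bf _] lg a x y; rewrite lg bf. Qed.

Lemma bilin_r U V W X (f : U -> V -> W) (g : X -> V) u :
  bilin f -> linear g -> linear (fun x => f u (g x)).
Proof. by move=> [_ bf] lg a x y; rewrite lg bf. Qed.

Lemma bilin_tens U V : bilin (@tens U V).
Proof.
split=> [v a u u'|u a v v']; apply/matrixP=> i j; rewrite !mxE linearP.
  by rewrite mulrDl; congr (_ + _); rewrite -[LHS]mulrA.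
by rewrite mulrDr; congr (_ + _); rewrite [LHS]mulrCA.
Qed.

Lemma bilin_scale V : bilin (fun (a : k^o) (v : V) => a *: v).
Proof.
split=> [v a b c|b a u v]; first by rewrite scalerDl scalerA.
by rewrite scalerDr !scalerA mulrC.
Qed.

Lemma lin_scl V (a : k) : linear (fun v : V => a *: v).
Proof. exact: (@bilin_scale V).2 a. Qed.

Lemma bilin_mul (A : falgType k) : bilin (fun a b : A => a * b).
Proof.
by split=> c a u v; rewrite ?mulrDl ?mulrDr -?scalerAl -?scalerAr.
Qed.

Lemma bilin_mulk : bilin (fun a b : k^o => a * b).
Proof.
split=> c a u v; first by rewrite mulrDl -scalerAl.
by rewrite mulrDr; congr (_ + _); apply: mulrCA.
Qed.

Lemma lin_tlift U V W (f : U -> V -> W) : linear (tlift f).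
Proof.
move=> a s t; rewrite /tlift scaler_sumr -big_split; apply: eq_bigr => i _ /=.
rewrite scaler_sumr -big_split; apply: eq_bigr => j _ /=.
by rewrite !mxE scalerDl scalerA.
Qed.

Lemma lin_tlift_arg U V W X (f : X -> U -> V -> W) t :
  (forall u v, linear (fun x => f x u v)) -> linear (fun x => tlift (f x) t).
Proof.
move=> lf a x y; rewrite /tlift scaler_sumr -big_split.
apply: eq_bigr => i _ /=; rewrite scaler_sumr -big_split.
apply: eq_bigr => j _ /=.
by rewrite lf scalerDr !scalerA mulrC.
Qed.

Lemma lin_sum (I : Type) U V (r : seq I) (f : U -> V) (F : I -> U) :
  linear f -> f (\sum_(i <- r) F i) = \sum_(i <- r) f (F i).
Proof.
move=> lf; have f0 : f 0 = 0.
  by have := lf (-1) 0 0; rewrite scaler0 addr0 scaleN1r addNr.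
elim: r => [|i r IH]; first by rewrite !big_nil.
by rewrite !big_cons -[F i]scale1r lf IH !scale1r.
Qed.

Lemma lin_scale U V (f : U -> V) a u : linear f -> f (a *: u) = a *: f u.
Proof.
move=> lf; have f0 : f 0 = 0.
  by have := lf (-1) 0 0; rewrite scaler0 addr0 scaleN1r addNr.
by have := lf a u 0; rewrite addr0 f0 addr0.
Qed.

Lemma bvecE U (u : U) : u = \sum_i coord (vbasis {:U}) i u *: bvec i.
Proof. by rewrite [LHS](coord_vbasis (memvf u)). Qed.

Lemma tlift_tens U V W (f : U -> V -> W) u v :
  bilin f -> tlift f (tens u v) = f u v.
Proof.
move=> [fl fr]; rewrite [in RHS](bvecE u) (lin_sum _ _ (fl v)).
apply: eq_bigr => i _; rewrite (lin_scale _ _ (fl v)) [in RHS](bvecE v).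
rewrite (lin_sum _ _ (fr _)) scaler_sumr; apply: eq_bigr => j _.
by rewrite (lin_scale _ _ (fr _)) scalerA mxE.
Qed.

Lemma coord_bvec U i j : coord (vbasis {:U}) i (bvec j) = (i == j)%:R.
Proof. by rewrite /bvec coord_free ?(basis_free (vbasisP _)) // eq_sym. Qed.

Lemma tensE U V (t : tensor U V) :
  t = \sum_i \sum_j t i j *: tens (bvec i) (bvec j).
Proof.
apply/matrixP=> a b; rewrite summxE (bigD1 a) //= summxE (bigD1 b) //=.
rewrite !mxE !coord_bvec !eqxx !mulr1 !big1 ?addr0 // => [i ia|j jb].
  rewrite summxE big1 // => j _; rewrite !mxE !coord_bvec eq_sym.
  by rewrite (negPf ia) mul0r mulr0.
by rewrite !mxE !coord_bvec [b == j]eq_sym (negPf jb) !mulr0.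
Qed.

Lemma tensor_ext U V W (f g : tensor U V -> W) : linear f -> linear g ->
  (forall u v, f (tens u v) = g (tens u v)) -> forall t, f t = g t.
Proof.
move=> lf lg fg t; rewrite (tensE t) (lin_sum _ _ lf) (lin_sum _ _ lg).
apply: eq_bigr => i _; rewrite (lin_sum _ _ lf) (lin_sum _ _ lg).
by apply: eq_bigr => j _; rewrite (lin_scale _ _ lf) (lin_scale _ _ lg) fg.
Qed.

Lemma eq_tlift U V W (f g : U -> V -> W) t :
  (forall u v, f u v = g u v) -> tlift f t = tlift g t.
Proof.
by move=> fg; apply: eq_bigr => i _; apply: eq_bigr => j _; rewrite fg.
Qed.

Lemma lin_tliftE U V W X (f : U -> V -> W) (g : W -> X) t :
  linear g -> g (tlift f t) = tlift (fun u v => g (f u v)) t.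
Proof.
move=> lg; rewrite (lin_sum _ _ lg); apply: eq_bigr => i _.
rewrite (lin_sum _ _ lg); apply: eq_bigr => j _.
by rewrite (lin_scale _ _ lg).
Qed.

Lemma tlift_tmap U V U' V' W (f : U' -> V' -> W) (g : U -> U') (h : V -> V') t :
  bilin f -> tlift f (tmap g h t) = tlift (fun a b => f (g a) (h b)) t.
Proof.
move=> bf; rewrite /tmap lin_tliftE; last exact: lin_tlift.
by apply: eq_tlift => u v; rewrite tlift_tens.
Qed.

Lemma linfunP U V (f : U -> V) : linear f -> linfun f =1 f.
Proof.
move=> lf u.
pose g : {linear U -> V} := HB.pack f (GRing.isLinear.Build k U V *:%R f lf).
exact: (lfunE g).
Qed.

End Tensor.

Ltac lin_tac :=
  first
  [ exact: lin_id
  | exact: lin_hom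
  | exact: lin_tlift
  | by []
  | apply: lin_tlift_arg; intros; lin_tac
  | apply: (bilin_l _ (@bilin_tens _ _ _)); lin_tac
  | apply: (bilin_r _ (@bilin_tens _ _ _)); lin_tac
  | apply: (bilin_l _ (@bilin_mul _ _)); lin_tac
  | apply: (bilin_r _ (@bilin_mul _ _)); lin_tac
  | apply: (bilin_l _ (@bilin_mulk _)); lin_tac
  | apply: (bilin_r _ (@bilin_mulk _)); lin_tac
  | apply: (bilin_l _ (@bilin_scale _ _)); lin_tac
  | apply: (bilin_r _ (@bilin_scale _ _)); lin_tac
  | apply: (lin_comp (@lin_hom _ _ _ _)); lin_tac
  | apply: (lin_comp (@lin_tlift _ _ _ _ _)); lin_tac
  ].

Ltac bilin_tac := by split; intros; lin_tac.

Section TensorAlgebra.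
Variables (k : fieldType) (A : falgType k).

(* The product of A (x) A: (a (x) b)(c (x) d) = ac (x) bd. *)
Definition tmul (s t : tensor A A) : tensor A A :=
  tlift (fun a b => tlift (fun c d => tens (a * c) (b * d)) t) s.

Lemma lin_tmul_l t : linear (tmul^~ t).
Proof. exact: lin_tlift. Qed.

Lemma lin_tmul_r s : linear (tmul s).
Proof. by apply: lin_tlift_arg => a b; lin_tac. Qed.

Lemma tmul_tens a b c d : tmul (tens a b) (tens c d) = tens (a * c) (b * d).
Proof.
rewrite /tmul tlift_tens; last bilin_tac.
by rewrite tlift_tens //; bilin_tac.
Qed.

Lemma tlift_tmul (W : vectType k) (F : A -> A -> W) s t : bilin F ->
  tlift F (tmul s t) =
  tlift (fun a b => tlift (fun c d => F (a * c) (b * d)) t) s.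
Proof.
move=> bF; rewrite /tmul lin_tliftE; last exact: lin_tlift.
apply: eq_tlift => a b; rewrite lin_tliftE; last exact: lin_tlift.
by apply: eq_tlift => c d; rewrite tlift_tens.
Qed.

(* An algebra is semisimple when its left regular module, whose submodules are
   the left ideals, is a direct sum of simple modules. *)
Definition left_ideal (I : {vspace A}) : Prop := ({:A} * I <= I)%VS.

Definition simple_left_ideal (I : {vspace A}) : Prop :=
  [/\ left_ideal I, I != 0%VS
    & forall J : {vspace A}, left_ideal J -> (J <= I)%VS -> J = 0%VS \/ J = I].

Definition semisimple_alg : Prop :=
  exists (n : nat) (I : 'I_n -> {vspace A}),
    [/\ forall i, simple_left_ideal (I i),
        directv (\sum_i I i) & (\sum_i I i)%VS = {:A}%VS].

End TensorAlgebra.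

HB.mixin Record Falgebra_isHopf (k : fieldType) H of Falgebra k H := {
  comul : 'Hom(H, tensor H H);
  counit : 'Hom(H, k^o);
  antipode : 'Hom(H, H);
  comulA : forall x : H,
    tassoc (tmap comul id (comul x)) = tmap id comul (comul x);
  counitl : forall x : H, tlift (fun a b => counit a *: b) (comul x) = x;
  counitr : forall x : H, tlift (fun a b => counit b *: a) (comul x) = x;
  comul1 : comul 1 = tens 1 1;
  comulM : forall x y : H, comul (x * y) = tmul (comul x) (comul y);
  counit1 : counit 1 = 1;
  counitM : forall x y : H, counit (x * y) = counit x * counit y;
  antipodel : forall x : H,
    tlift (fun a b => antipode a * b) (comul x) = counit x *: 1;
  antipoder : forall x : H,
    tlift (fun a b => a * antipode b) (comul x) = counit x *: 1
}.

#[short(type="hopfAlgType")]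
HB.structure Definition HopfAlgebra (k : fieldType) :=
  {H of Falgebra k H & Falgebra_isHopf k H}.

Section DualAlgebra.
Variables (k : fieldType) (H : hopfAlgType k).

Definition dual := 'Hom(H, k^o).

HB.instance Definition _ := Vector.copy dual 'Hom(H, k^o).

(* Convolution: (f g)(x) = sum f(x_1) g(x_2). *)
Definition dual_mul (f g : dual) : dual :=
  linfun (fun x => tlift (fun a b => f a * g b : k^o) (comul x)).

Definition dual_one : dual := counit.

Lemma dual_mulE f g x :
  dual_mul f g x = tlift (fun a b => f a * g b : k^o) (comul x).
Proof. by rewrite linfunP //; lin_tac. Qed.

Lemma dual_mulA : associative dual_mul.
Proof.
move=> f g h; apply/lfunP => x; rewrite !dual_mulE.
pose F3 := tlift (fun a bc => f a * tlift (fun b c => g b * h c : k^o) bc : k^o).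
pose F3' := tlift (fun ab c => tlift (fun a b => f a * g b : k^o) ab * h c : k^o).
transitivity (F3 (tmap id comul (comul x))).
  rewrite /F3 tlift_tmap; last bilin_tac.
  by apply: eq_tlift => a b; rewrite dual_mulE.
transitivity (F3' (tmap comul id (comul x))); last first.
  rewrite /F3' tlift_tmap; last bilin_tac.
  by apply: eq_tlift => a b; rewrite dual_mulE.
rewrite -comulA; move: (tmap _ _ _).
apply: tensor_ext => [||ab c]; [lin_tac | lin_tac |].
rewrite /F3 /F3' /tassoc tlift_tens; last bilin_tac.
rewrite tlift_tens; last bilin_tac.
move: ab; apply: tensor_ext => [||a b]; [lin_tac | lin_tac |].
by rewrite !tlift_tens ?mulrA //; bilin_tac.
Qed.

Lemma dual_mul1 : left_id dual_one dual_mul.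
Proof.
move=> f; apply/lfunP => x; rewrite dual_mulE -[in RHS](counitl x).
by rewrite (lin_tliftE _ _ (lin_hom f)); apply: eq_tlift => a b; rewrite linearZ.
Qed.

Lemma dual_mulr1 : right_id dual_one dual_mul.
Proof.
move=> f; apply/lfunP => x; rewrite dual_mulE -[in RHS](counitr x).
rewrite (lin_tliftE _ _ (lin_hom f)); apply: eq_tlift => a b.
by rewrite linearZ; apply: mulrC.
Qed.

Lemma dual_mulDl : left_distributive dual_mul +%R.
Proof.
move=> f g h; apply/lfunP => x; rewrite lfunE /= !dual_mulE /tlift -big_split.
apply: eq_bigr => i _; rewrite -big_split; apply: eq_bigr => j _ /=.
by rewrite -scalerDr lfunE /= mulrDl.
Qed.

Lemma dual_mulDr : right_distributive dual_mul +%R.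
Proof.
move=> f g h; apply/lfunP => x; rewrite lfunE /= !dual_mulE /tlift -big_split.
apply: eq_bigr => i _; rewrite -big_split; apply: eq_bigr => j _ /=.
by rewrite -scalerDr lfunE /= mulrDr.
Qed.

Lemma dual_one_neq0 : dual_one != 0.
Proof.
apply/eqP => /lfunP/(_ 1); rewrite counit1 lfunE /=.
by apply/eqP; exact: oner_neq0.
Qed.

HB.instance Definition _ := GRing.Zmodule_isNzRing.Build dual
  dual_mulA dual_mul1 dual_mulr1 dual_mulDl dual_mulDr dual_one_neq0.

Lemma dual_scaleAl (a : k) (f g : dual) : a *: (f * g) = (a *: f) * g.
Proof.
apply/lfunP => x; rewrite lfunE /= !dual_mulE (lin_tliftE _ _ (lin_scl a)).
by apply: eq_tlift => u v; rewrite lfunE /= scalerAl.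
Qed.

HB.instance Definition _ := GRing.Lmodule_isLalgebra.Build k dual dual_scaleAl.

Lemma dual_scaleAr (a : k) (f g : dual) : a *: (f * g) = f * (a *: g).
Proof.
apply/lfunP => x; rewrite lfunE /= !dual_mulE (lin_tliftE _ _ (lin_scl a)).
by apply: eq_tlift => u v; rewrite lfunE /= scalerAr.
Qed.

HB.instance Definition _ := GRing.Lalgebra_isAlgebra.Build k dual dual_scaleAr.
HB.instance Definition _ := Algebra_isFalgebra.Build k dual.

Lemma dmulE (f g : dual) x :
  (f * g) x = tlift (fun a b => f a * g b : k^o) (comul x).
Proof. exact: dual_mulE. Qed.

Lemma done_E x : (1 : dual) x = counit x. Proof. by []. Qed.

Definition dvec (i : 'I_(\dim {:H})) : dual :=
  linfun (coord (vbasis {:H}) i : H -> k^o).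

Lemma dvecE (f : dual) : f = \sum_i f (bvec i) *: dvec i.
Proof.
apply/lfunP => x; rewrite sum_lfunE [in LHS](bvecE x) linear_sum.
apply: eq_bigr => i _; rewrite linearZ lfunE /= linfunP; last exact: linearP.
exact: mulrC.
Qed.

(* The transpose H^* -> (H (x) H)^* = H^* (x) H^* of the product of H;
   see dual_comulP. *)
Definition dual_comul : 'Hom(dual, tensor dual dual) :=
  linfun (fun f : dual =>
    \sum_i \sum_j f (bvec i * bvec j) *: tens (dvec i) (dvec j)).

Definition dual_counit : 'Hom(dual, k^o) := linfun (fun f : dual => f 1 : k^o).

Definition dual_antipode : 'Hom(dual, dual) :=
  linfun (fun f : dual => (f \o antipode)%VF : dual).

Lemma lin_ev x : linear (fun f : dual => f x : k^o).
Proof. by move=> a f g; rewrite !lfunE /= lfunE. Qed.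

Definition contract (V : vectType k) (a : H) : tensor dual V -> V :=
  tlift (fun (f : dual) v => f a *: v).

Lemma bilin_ev (V : vectType k) a : bilin (fun (f : dual) (v : V) => f a *: v).
Proof.
split=> [v|f]; last exact: lin_scl.
by move=> c f g; rewrite !lfunE /= lfunE /= scalerDl scalerA.
Qed.

Lemma contract_tens (V : vectType k) a f (v : V) :
  contract a (tens f v) = f a *: v.
Proof. by rewrite /contract tlift_tens //; exact: bilin_ev. Qed.

Lemma lin_contract (V : vectType k) a : linear (@contract V a).
Proof. exact: lin_tlift. Qed.

Lemma lin_bigsum (I : Type) (U V : vectType k) (r : seq I) (F : I -> U -> V) :
  (forall i, linear (F i)) -> linear (fun u => \sum_(i <- r) F i u).
Proof.
move=> lF a u v; rewrite scaler_sumr -big_split.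
by apply: eq_bigr => i _; rewrite lF.
Qed.

Lemma contractE (V : vectType k) (s : tensor dual V) :
  s = \sum_i tens (dvec i) (contract (bvec i) s).
Proof.
move: s; apply: tensor_ext; first exact: lin_id.
  by apply: lin_bigsum => i; apply: (bilin_r _ (bilin_tens _ _));
    exact: lin_contract.
move=> f v; rewrite [in LHS](dvecE f).
rewrite (lin_sum _ _ ((bilin_tens _ _).1 v)); apply: eq_bigr => i _.
rewrite contract_tens (lin_scale _ _ ((bilin_tens _ _).1 v)).
by rewrite (lin_scale _ _ ((bilin_tens _ _).2 _)).
Qed.

Lemma contract_inj (V : vectType k) (s t : tensor dual V) :
  (forall a, contract a s = contract a t) -> s = t.
Proof.
by move=> st; rewrite (contractE s) (contractE t);
  apply: eq_bigr => i _; rewrite st.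
Qed.

Lemma dual_comulE (f : dual) : dual_comul f =
  \sum_i \sum_j f (bvec i * bvec j) *: tens (dvec i) (dvec j).
Proof.
rewrite linfunP //; apply: lin_bigsum => i; apply: lin_bigsum => j.
exact: (bilin_ev _ _).1.
Qed.

Lemma dvec_coord i x : dvec i x = coord (vbasis {:H}) i x.
Proof. by rewrite linfunP //; exact: linearP. Qed.

(* Evaluating the coproduct of f at a (x) b gives f (a b). *)
Lemma dual_comulP (f : dual) a b : contract a (dual_comul f) b = f (a * b).
Proof.
rewrite dual_comulE (lin_sum _ _ (@lin_contract _ a)) sum_lfunE.
rewrite [a in RHS]bvecE mulr_suml linear_sum; apply: eq_bigr => i _.
rewrite (lin_sum _ _ (@lin_contract _ a)) sum_lfunE.
rewrite [b in RHS]bvecE mulr_sumr linear_sum; apply: eq_bigr => j _.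
rewrite (lin_scale _ _ (@lin_contract _ a)) contract_tens.
rewrite 2!scale_lfunE !dvec_coord -scalerAl -scalerAr !linearZ /=.
by congr (_ *: _); exact: mulrC.
Qed.

Lemma dual_counitE (f : dual) : dual_counit f = f 1.
Proof. by rewrite linfunP //; exact: lin_ev. Qed.

Lemma dual_antipodeE (f : dual) x : dual_antipode f x = f (antipode x).
Proof.
rewrite linfunP ?comp_lfunE // => a g h; apply/lfunP => y.
by rewrite !(comp_lfunE, add_lfunE, scale_lfunE).
Qed.

Lemma dual_comulA (f : dual) :
  tassoc (tmap dual_comul id (dual_comul f)) =
  tmap id dual_comul (dual_comul f).
Proof.
apply: contract_inj => a; apply: contract_inj => b; apply/lfunP => c.
have L t : contract b (contract a (tassoc (tmap dual_comul id t))) =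
           contract (a * b) t :> dual.
  move: t; apply: tensor_ext; [| exact: lin_contract |].
    do 2![apply: (lin_comp (@lin_contract _ _))].
    by apply: (lin_comp (@lin_tlift _ _ _ _ _)); exact: lin_tlift.
  move=> g h; rewrite contract_tens /tmap tlift_tens; last bilin_tac.
  rewrite /tassoc tlift_tens; last bilin_tac.
  rewrite (lin_tliftE _ _ (@lin_contract _ a)).
  rewrite (lin_tliftE _ _ (@lin_contract _ b)) -dual_comulP [in RHS]/contract.
  rewrite (lin_tliftE _ _ (lin_ev b)).
  rewrite (lin_tliftE _ _ ((@bilin_scale _ _).1 h)).
  apply: eq_tlift => u v; rewrite contract_tens.
  rewrite (lin_scale _ _ (@lin_contract _ b)) contract_tens scalerA.
  by rewrite scale_lfunE.
have R t : contract b (contract a (tmap id dual_comul t)) c =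
           contract a t (b * c) :> k^o.
  move: t; apply: tensor_ext; [| |].
  - apply: (lin_comp (lin_ev c)); do 2![apply: (lin_comp (@lin_contract _ _))].
    exact: lin_tlift.
  - by apply: (lin_comp (lin_ev _)); exact: lin_contract.
  move=> g h; rewrite contract_tens /tmap tlift_tens; last bilin_tac.
  rewrite contract_tens (lin_scale _ _ (@lin_contract _ b)) !scale_lfunE.
  by rewrite dual_comulP.
by rewrite L R !dual_comulP mulrA.
Qed.

Lemma dual_counitl (f : dual) :
  tlift (fun a b => dual_counit a *: b) (dual_comul f) = f.
Proof.
rewrite (@eq_tlift _ _ _ _ _ (fun (a : dual) b => a 1 *: b)); last first.
  by move=> u v; rewrite dual_counitE.
by apply/lfunP => x; rewrite dual_comulP mul1r.
Qed.

Lemma tlift_evr t x :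
  tlift (fun a b : dual => dual_counit b *: a) t x =
  contract x t 1 :> k^o.
Proof.
rewrite (lin_tliftE _ _ (lin_ev x)) (lin_tliftE _ _ (lin_ev 1)).
apply: eq_tlift => u v; rewrite !scale_lfunE dual_counitE; exact: mulrC.
Qed.

Lemma dual_counitr (f : dual) :
  tlift (fun a b => dual_counit b *: a) (dual_comul f) = f.
Proof. by apply/lfunP => x; rewrite tlift_evr dual_comulP mulr1. Qed.

Lemma dual_comul1 : dual_comul 1 = tens 1 1.
Proof.
apply: contract_inj => a; apply/lfunP => b.
by rewrite dual_comulP contract_tens scale_lfunE; exact: counitM.
Qed.

Lemma contract_tmul (s t : tensor dual dual) a b :
  contract a (tmul s t) b =
  tlift (fun a1 a2 => tlift (fun b1 b2 =>
    contract a1 s b1 * contract a2 t b2 : k^o) (comul b)) (comul a) :> k^o.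
Proof.
have lc x y : linear (fun t : tensor dual dual => contract x t y : k^o).
  by apply: (lin_comp (lin_ev y)); exact: lin_contract.
move: s; apply: tensor_ext.
- by apply: (lin_comp (lc a b)); exact: lin_tmul_l.
- apply: lin_tlift_arg => a1 a2; apply: lin_tlift_arg => b1 b2.
  by apply: (bilin_l _ (@bilin_mulk k)); exact: lc.
move=> f1 f2; move: t; apply: tensor_ext.
- by apply: (lin_comp (lc a b)); exact: lin_tmul_r.
- apply: lin_tlift_arg => a1 a2; apply: lin_tlift_arg => b1 b2.
  by apply: (bilin_r _ (@bilin_mulk k)); exact: lc.
move=> g1 g2; rewrite tmul_tens contract_tens scale_lfunE !dmulE.
rewrite [LHS](lin_tliftE _ _ ((@bilin_mulk k).1 _)); apply: eq_tlift => a1 a2.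
rewrite [LHS](lin_tliftE _ _ ((@bilin_mulk k).2 _)); apply: eq_tlift => b1 b2.
rewrite !contract_tens !scale_lfunE; exact: mulrACA.
Qed.

Lemma dual_comulM (f g : dual) :
  dual_comul (f * g) = tmul (dual_comul f) (dual_comul g).
Proof.
apply: contract_inj => a; apply/lfunP => b.
rewrite contract_tmul dual_comulP dmulE comulM tlift_tmul; last bilin_tac.
apply: eq_tlift => a1 a2; apply: eq_tlift => b1 b2.
by rewrite !dual_comulP.
Qed.

Lemma dual_counit1 : dual_counit 1 = 1.
Proof. by rewrite dual_counitE; exact: counit1. Qed.

Lemma dual_counitM (f g : dual) :
  dual_counit (f * g) = dual_counit f * dual_counit g.
Proof.
by rewrite !dual_counitE dmulE comul1 tlift_tens //; bilin_tac.
Qed.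

Lemma dual_antipodel (f : dual) :
  tlift (fun a b => dual_antipode a * b) (dual_comul f) = dual_counit f *: 1.
Proof.
apply/lfunP => x; rewrite (lin_tliftE _ _ (lin_ev x)) dual_counitE scale_lfunE.
have L t : tlift (fun a b : dual => (dual_antipode a * b) x : k^o) t =
    tlift (fun u v => contract (antipode u) t v : k^o) (comul x).
  move: t; apply: tensor_ext; first exact: lin_tlift.
    apply: lin_tlift_arg => u v; apply: (lin_comp (lin_ev v)).
    exact: lin_contract.
  move=> g h; rewrite tlift_tens; last first.
    by split=> ?; apply: (lin_comp (lin_ev x)); lin_tac.
  rewrite dmulE; apply: eq_tlift => u v.
  by rewrite contract_tens scale_lfunE dual_antipodeE.
rewrite L; under eq_tlift => u v do rewrite dual_comulP.
rewrite -(lin_tliftE _ _ (lin_hom f)) antipodel linearZ; exact: mulrC.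
Qed.

Lemma dual_antipoder (f : dual) :
  tlift (fun a b => a * dual_antipode b) (dual_comul f) = dual_counit f *: 1.
Proof.
apply/lfunP => x; rewrite (lin_tliftE _ _ (lin_ev x)) dual_counitE scale_lfunE.
have L t : tlift (fun a b : dual => (a * dual_antipode b) x : k^o) t =
    tlift (fun u v => contract u t (antipode v) : k^o) (comul x).
  move: t; apply: tensor_ext; first exact: lin_tlift.
    apply: lin_tlift_arg => u v; apply: (lin_comp (lin_ev _)).
    exact: lin_contract.
  move=> g h; rewrite tlift_tens; last first.
    by split=> ?; apply: (lin_comp (lin_ev x)); lin_tac.
  rewrite dmulE; apply: eq_tlift => u v.
  by rewrite contract_tens scale_lfunE dual_antipodeE.
rewrite L; under eq_tlift => u v do rewrite dual_comulP.
rewrite -(lin_tliftE _ _ (lin_hom f)) antipoder linearZ; exact: mulrC.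
Qed.

HB.instance Definition _ := Falgebra_isHopf.Build k dual
  dual_comulA dual_counitl dual_counitr dual_comul1 dual_comulM
  dual_counit1 dual_counitM dual_antipodel dual_antipoder.

End DualAlgebra.

Section GroupLike.
Variables (k : fieldType) (H : hopfAlgType k).

(* The condition counit g = 1 is equivalent to g != 0 when
   comul g = tens g g. *)
Definition grouplike : {pred H} :=
  [pred g | (comul g == tens g g) && (counit g == 1)].

(* The group G(H). *)
Record grouplikes := Grouplike {gval : H; gvalP : gval \in grouplike}.

HB.instance Definition _ := [isSub for gval].
HB.instance Definition _ := [Choice of grouplikes by <:].

Lemma grouplikeP (g : grouplikes) :
  comul (gval g) = tens (gval g) (gval g) /\ counit (gval g) = 1.
Proof. by have /andP[/eqP ? /eqP ?] := gvalP g. Qed.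

Lemma grouplike1 : 1 \in grouplike.
Proof. by rewrite inE comul1 counit1 !eqxx. Qed.

Lemma grouplikeM (g h : grouplikes) : gval g * gval h \in grouplike.
Proof.
have [[cg eg] [ch eh]] := (grouplikeP g, grouplikeP h).
by rewrite inE comulM cg ch tmul_tens counitM eg eh mulr1 !eqxx.
Qed.

Lemma antipode_mull (g : grouplikes) : antipode (gval g) * gval g = 1.
Proof.
have [cg eg] := grouplikeP g; have := antipodel (gval g).
by rewrite cg eg scale1r tlift_tens //; bilin_tac.
Qed.

Lemma antipode_mulr (g : grouplikes) : gval g * antipode (gval g) = 1.
Proof.
have [cg eg] := grouplikeP g; have := antipoder (gval g).
by rewrite cg eg scale1r tlift_tens //; bilin_tac.
Qed.

Lemma grouplikeV (g : grouplikes) : antipode (gval g) \in grouplike.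
Proof.
have [cg eg] := grouplikeP g; set x := gval g in cg eg *; set y := antipode x.
have yx : y * x = 1 := antipode_mull g.
have xy : x * y = 1 := antipode_mulr g.
have ey : counit y = 1 by have := counitM y x; rewrite yx counit1 eg mulr1.
rewrite inE ey eqxx andbT; apply/eqP.
have T (s : tensor H H) : tmul (tmul s (tens x x)) (tens y y) = s.
  move: s; apply: tensor_ext; [| exact: lin_id |].
    by apply: (lin_comp (@lin_tmul_l _ _ _)); exact: lin_tmul_l.
  by move=> u v; rewrite !tmul_tens -!mulrA xy !mulr1.
by rewrite -[LHS]T -cg -comulM yx comul1 tmul_tens !mul1r.
Qed.

Definition grouplike_one := Grouplike grouplike1.
Definition grouplike_mul g h := Grouplike (grouplikeM g h).
Definition grouplike_inv g := Grouplike (grouplikeV g).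

Fact grouplike_mulA : associative grouplike_mul.
Proof. by move=> g h l; apply: val_inj; rewrite /= mulrA. Qed.

Fact grouplike_mul1 : left_id grouplike_one grouplike_mul.
Proof. by move=> g; apply: val_inj; rewrite /= mul1r. Qed.

Fact grouplike_mulr1 : right_id grouplike_one grouplike_mul.
Proof. by move=> g; apply: val_inj; rewrite /= mulr1. Qed.

Fact grouplike_mulV : left_inverse grouplike_one grouplike_inv grouplike_mul.
Proof. by move=> g; apply: val_inj; rewrite /= antipode_mull. Qed.

Fact grouplike_mulrV : right_inverse grouplike_one grouplike_inv grouplike_mul.
Proof. by move=> g; apply: val_inj; rewrite /= antipode_mulr. Qed.

HB.instance Definition _ := isGroup.Build grouplikes
  grouplike_mulA grouplike_mul1 grouplike_mulr1 grouplike_mulV grouplike_mulrV.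

End GroupLike.

(* Main.v *)
(* Let [N = dim H].  Semisimplicity gives a normalised integral, hence, by Larson
   and Radford, an involutive antipode.  The simple Yetter-Drinfeld submodules of
   [H] (left coideals stable under the adjoint action) have dimension dividing
   [N].  If [N] divides [p^2 q^b], those of dimension less than [q] have dimension
   dividing [p^2]; a product of two of them has dimension at most [p^4 < q], so
   their sum [Y] is a subalgebra, and [q | N] implies [q | dim Y].

   A Yetter-Drinfeld subalgebra [Y] has a central idempotent [c] such that [cH] is
   a quotient Hopf algebra of dimension [N / dim Y], and [G((cH)^* )] is a subgroup
   of [G(H^* )].  This allows an induction showing that [|G(H^* )|] is [1] or [q]
   only if it is equal to [N].  The one-dimensional simple submodules are the lines
   of the central group-likes and the other ones in [Y] have dimension divisible by
   [p], so a count gives a central group-like [z] of order [p] or [q].  The quotient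
   by [z] has dimension [1], and then [H] is commutative, or [q].  In the latter
   case let [chi] be an irreducible character vanishing on [c]: [chi chi^*] is the
   sum of the elements of [G(H^* )] fixing [chi], so that [chi(1)^2] divides [q] and
   [chi] lies in [G(H^* )], whose elements do not vanish on [c]. *)
Require Import Defs.
From HB Require Import structures.
From mathcomp Require Import all_boot all_order all_algebra all_fingroup all_solvable all_field.
From mathcomp Require Import boolp classical_sets cardinality zify ring.

Set Implicit Arguments.
Unset Strict Implicit.
Unset Printing Implicit Defensive.

Import GRing.Theory.
Local Open Scope ring_scope.

(** Three obstacles shape the proof. The field [k] carries no complex conjugation, so the one
    positivity argument, behind [lam1_neq0], is moved to [algC] through cyclotomic polynomials.
    Simple modules enter only through primitive idempotents: an [idem_system] holds one for each
    simple module, characters are traces, and [trf_sandwich] does the work of the Wedderburn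
    decomposition. Yetter-Drinfeld submodules are studied without the Drinfeld double: an operator
    of [H] commuting with the coaction and the adjoint action is [hit e] for a tracial functional
    [e], so submodules become idempotents of the character ring.

    The induction has to treat the orders 1 and [q] together, because Lagrange's theorem only says
    that the group of the quotient has order dividing [q]. It runs over all divisors of
    [p ^ 2 * q ^ b] because the dimensions of the quotients range over such divisors. *)

Section LinearCombinators.
Variable k : fieldType.
Implicit Types (U V W X : vectType k) (A : falgType k).

(** * Closure rules for linear maps *)

Lemma lin_mull A X (g : X -> A) c : linear g -> linear (fun x => g x * c).
Proof. by move=> lg a u v; rewrite lg mulrDl -scalerAl. Qed.

Lemma lin_mulr A X (g : X -> A) c : linear g -> linear (fun x => c * g x).
Proof. by move=> lg a u v; rewrite lg mulrDr -scalerAr. Qed.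

Lemma lin_scalel V X (g : X -> k^o) (v : V) :
  linear g -> linear (fun x => g x *: v).
Proof. by move=> lg a x y; rewrite lg scalerDl scalerA. Qed.

Lemma lin_scaler V X (g : X -> V) (c : k) :
  linear g -> linear (fun x => c *: g x).
Proof. by move=> lg; apply: (lin_comp (@lin_scl _ _ c)). Qed.

Lemma lin_tensl U V X (g : X -> U) (v : V) :
  linear g -> linear (fun x => tens (g x) v).
Proof. exact: (bilin_l _ (@bilin_tens _ _ _)). Qed.

Lemma lin_tensr U V X (g : X -> V) (u : U) :
  linear g -> linear (fun x => tens u (g x)).
Proof. exact: (bilin_r _ (@bilin_tens _ _ _)). Qed.

Lemma lin_add V X (f g : X -> V) :
  linear f -> linear g -> linear (fun x => f x + g x).
Proof. by move=> lf lg a u v; rewrite lf lg scalerDr addrACA. Qed.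

Lemma lin_opp V X (f : X -> V) : linear f -> linear (fun x => - f x).
Proof. by move=> lf a u v; rewrite lf opprD scalerN. Qed.

Lemma lin_zero V X : linear (fun _ : X => 0 : V).
Proof. by move=> a u v; rewrite scaler0 addr0. Qed.

Lemma lin_homf U V X (f : 'Hom(U, V)) (g : X -> U) :
  linear g -> linear (fun x => f (g x)).
Proof. exact: (lin_comp (@lin_hom _ _ _ f)). Qed.

Lemma lin_homev U V X (f : X -> 'Hom(U, V)) u :
  linear f -> linear (fun x => f x u).
Proof. by move=> lf a x y; rewrite lf add_lfunE scale_lfunE. Qed.

(* Unification does not find [k^o] by itself: the scalar-valued instances. *)
Lemma lin_cstk U X (f : U -> k^o) (g : X -> U) :
  linear f -> linear g -> linear (fun x => f (g x)).
Proof. exact: lin_comp. Qed.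

Lemma lin_mulrk X (g : X -> k^o) (c : k) :
  linear g -> linear (fun x => c * g x : k^o).
Proof. exact: (@lin_mulr k^o). Qed.

Lemma lin_mullk X (g : X -> k^o) (c : k) :
  linear g -> linear (fun x => (g x : k) * c : k^o).
Proof. exact: (@lin_mull k^o). Qed.

Lemma lin_bigop (I : Type) V X (r : seq I) (P : pred I) (F : I -> X -> V) :
  (forall i, linear (F i)) -> linear (fun u => \sum_(i <- r | P i) F i u).
Proof.
move=> lF a u v; rewrite scaler_sumr -big_split.
by apply: eq_bigr => i _; rewrite lF.
Qed.

Lemma lin_coord V X n (b : n.-tuple V) i (g : X -> V) :
  linear g -> linear (fun x => coord b i (g x) : k^o).
Proof. by apply: lin_comp => a u v; rewrite linearP. Qed.

Lemma lin_tliftc U V W X (f : U -> V -> W) (g : X -> tensor U V) :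
  linear g -> linear (fun x => tlift f (g x)).
Proof. exact: (lin_comp (@lin_tlift _ _ _ _ f)). Qed.

Lemma lin_map0 V W (f : V -> W) : linear f -> f 0 = 0.
Proof. by move=> lf; rewrite -(scale0r (0 : V)) (lin_scale _ _ lf) scale0r. Qed.

Lemma lin_mapD V W (f : V -> W) u v : linear f -> f (u + v) = f u + f v.
Proof. by move=> lf; rewrite -[u]scale1r lf !scale1r. Qed.

Lemma lin_mapN V W (f : V -> W) u : linear f -> f (- u) = - f u.
Proof. by move=> lf; rewrite -scaleN1r (lin_scale _ _ lf) scaleN1r. Qed.

Lemma lin_mapB V W (f : V -> W) u v : linear f -> f (u - v) = f u - f v.
Proof. by move=> lf; rewrite lin_mapD // lin_mapN. Qed.

End LinearCombinators.

(** * Sweedler calculus *)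

Section Sweedler.
Variables (k : fieldType) (H : hopfAlgType k).

(* Sweedler notation: [\sum f(x_1, x_2)]. *)
Definition sw (W : vectType k) (f : H -> H -> W) (x : H) : W :=
  tlift f (comul x).

Lemma lin_sw (W : vectType k) (f : H -> H -> W) : linear (sw f).
Proof. by rewrite /sw => a u v; rewrite linearP; apply: lin_tlift. Qed.

End Sweedler.

Notation eps := (@counit _ _).
Notation ap := (@antipode _ _).

(** The rule is chosen by the head symbol of the body and applied with its functions given
    explicitly, instead of leaving the decomposition to higher-order unification. Products are tried
    in the algebra first and in [k^o] afterwards. *)
Ltac lin_step := idtac; cbv beta;
  lazymatch goal with
  | |- bilin _ => split; intros
  | |- @GRing.linear_for _ _ _ _ ?f =>
    first
    [ assumption
    | match goal with h : forall _, _ |- _ => solve [apply: h] end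
    | match f with
      | (fun z_ => z_) => exact: lin_id
      | @tlift _ _ _ _ _ => exact: lin_tlift
      | @sw _ _ _ _ => exact: lin_sw
      | (fun z_ => @sw _ _ _ ?h z_) => exact: lin_sw
      | (fun z_ => @GRing.mul _ (@?g z_) ?c) => apply: (@lin_mull _ _ _ g c)
      | (fun z_ => @GRing.mul _ ?c (@?g z_)) => apply: (@lin_mulr _ _ _ g c)
      | (fun z_ => @GRing.mul _ (@?g z_) ?c) => apply: (@lin_mullk _ _ g c)
      | (fun z_ => @GRing.mul _ ?c (@?g z_)) => apply: (@lin_mulrk _ _ g c)
      | (fun z_ => @GRing.scale _ _ ?c (@?g z_)) => apply: (@lin_scaler _ _ _ g c)
      | (fun z_ => @GRing.scale _ _ (@?g z_) ?v) => apply: (@lin_scalel _ _ _ g v)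
      | (fun z_ => @GRing.add _ (@?g z_) (@?h z_)) => apply: (@lin_add _ _ _ g h)
      | (fun z_ => @GRing.opp _ (@?h z_)) => apply: (@lin_opp _ _ _ h)
      | (fun z_ => @GRing.zero _) => exact: lin_zero
      | (fun z_ => @tens _ _ _ ?c (@?g z_)) => apply: (@lin_tensr _ _ _ _ g c)
      | (fun z_ => @tens _ _ _ (@?g z_) ?c) => apply: (@lin_tensl _ _ _ _ g c)
      | (fun z_ => @tlift _ _ _ _ ?h (@?g z_)) => apply: (@lin_tliftc _ _ _ _ _ h g)
      | (fun z_ => @tlift _ _ _ _ (@?h z_) ?t) => apply: (@lin_tlift_arg _ _ _ _ _ h t); intros
      | (fun z_ => @sw _ _ _ ?h (@?g z_)) => apply: (@lin_comp _ _ _ _ _ _ (@lin_sw _ _ _ h))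
      | (fun z_ => @sw _ _ _ (@?h z_) ?t) => apply: (@lin_tlift_arg _ _ _ _ _ h); intros
      | (fun z_ => @fun_of_lfun _ _ _ ?h (@?g z_)) => apply: (@lin_homf _ _ _ _ h g)
      | (fun z_ => @fun_of_lfun _ _ _ (@?h z_) ?u) => apply: (@lin_homev _ _ _ _ h u)
      | (fun z_ => @bigop _ _ _ _ (fun i_ => @BigBody _ _ i_ _ _ (@?F z_ i_))) =>
         apply: lin_bigop; intros
      | (fun z_ => ?h (@?g z_)) =>
         first [ apply: (@lin_comp _ _ _ _ h g); [assumption|]
               | apply: (@lin_cstk _ _ _ h g); [assumption|]
               | apply: (@lin_comp _ _ _ _ h g); [by move=> ? ? ?; rewrite linearP|] ]
      | _ => first [ by move=> ? ? ?; rewrite linearP | by [] ]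
      end
    | match goal with h : bilin ?F |- _ => match f with
        | (fun z_ => F (@?g z_) ?c) => apply: (@bilin_l _ _ _ _ _ F g c h)
        | (fun z_ => F ?c (@?g z_)) => apply: (@bilin_r _ _ _ _ _ F g c h)
        | F ?c => exact: h.2
        end end
    | match goal with h : context [GRing.linear_for] |- _ => apply: h end
    ]
  end.

Ltac lin := solve [intros; repeat lin_step].

Section SweedlerTheory.
Variables (k : fieldType) (H : hopfAlgType k).
Local Notation "a *: v" := (@GRing.scale k _ a v) : ring_scope.
Implicit Types (W : vectType k) (x y : H).

Lemma eq_sw W (f g : H -> H -> W) x :
  (forall a b, f a b = g a b) -> sw f x = sw g x.
Proof. exact: eq_tlift. Qed.

Lemma lin_swE W (X : vectType k) (f : H -> H -> W) (g : W -> X) x :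
  linear g -> g (sw f x) = sw (fun a b => g (f a b)) x.
Proof. exact: lin_tliftE. Qed.

Lemma sw_scale W (f : H -> H -> W) (c : k) x :
  c *: sw f x = sw (fun a b => c *: f a b) x.
Proof. exact: (lin_swE _ _ (lin_scl c)). Qed.

Lemma sw_scalel W (f : H -> H -> k^o) (v : W) x :
  sw f x *: v = sw (fun a b => f a b *: v) x.
Proof. exact: (lin_swE _ _ (@lin_scalel _ _ _ id v (@lin_id _ _))). Qed.

Lemma sw_mulr (A : falgType k) (f : H -> H -> A) c x :
  c * sw f x = sw (fun a b => c * f a b) x.
Proof. exact: (lin_swE _ _ (lin_mulr c (@lin_id _ _))). Qed.

Lemma sw_mull (A : falgType k) (f : H -> H -> A) c x :
  sw f x * c = sw (fun a b => f a b * c) x.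
Proof. exact: (lin_swE _ _ (lin_mull c (@lin_id _ _))). Qed.

Lemma swC W (F : H -> H -> H -> H -> W) x y :
  sw (fun a b => sw (F a b) y) x = sw (fun c d => sw (fun a b => F a b c d) x) y.
Proof.
rewrite /sw /tlift; set d := \dim _.
under eq_bigr => i _ do under eq_bigr => j _ do
  rewrite scaler_sumr; under eq_bigr => i _ do rewrite exchange_big.
rewrite exchange_big; apply: eq_bigr => i' _.
under eq_bigr => i _ do under eq_bigr => j _ do rewrite scaler_sumr.
under eq_bigr => i _ do rewrite exchange_big.
rewrite exchange_big; apply: eq_bigr => j' _.
rewrite scaler_sumr; apply: eq_bigr => i _.
rewrite scaler_sumr; apply: eq_bigr => j _.
by rewrite !scalerA mulrC.
Qed.

(** A trilinear [F] factors through the triple tensor product, where coassociativity lives; this is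
    the form in which all later proofs use it. *)
Lemma swA W (F : H -> H -> H -> W) x :
  (forall b c, linear (fun a => F a b c)) ->
  (forall a c, linear (fun b => F a b c)) ->
  (forall a b, linear (F a b)) ->
  sw (fun a b => sw (fun a1 a2 => F a1 a2 b) a) x =
  sw (fun a b => sw (F a) b) x.
Proof.
move=> F1 F2 F3.
pose G (a : H) : tensor H H -> W := tlift (F a).
have lG : bilin G by split; intros; rewrite /G; lin.
have := congr1 (tlift G) (@comulA _ H x).
rewrite (@tlift_tmap _ _ _ _ _ _ G) // => E; apply: etrans E; symmetry.
rewrite /tassoc lin_tliftE; last by lin.
rewrite /tmap lin_tliftE; last by lin.
apply: eq_tlift => a b; rewrite tlift_tens; last by lin.
rewrite lin_tliftE; last by lin.
apply: eq_tlift => a1 a2; rewrite tlift_tens /G ?tlift_tens //; lin.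
Qed.

Lemma sw_epsl W (f : H -> W) x :
  linear f -> sw (fun a b => eps a *: f b) x = f x.
Proof.
move=> lf; rewrite -[in RHS](counitl x) lin_tliftE //.
by apply: eq_tlift => a b; rewrite lin_scale.
Qed.

Lemma sw_epsr W (f : H -> W) x :
  linear f -> sw (fun a b => eps b *: f a) x = f x.
Proof.
move=> lf; rewrite -[in RHS](counitr x) lin_tliftE //.
by apply: eq_tlift => a b; rewrite lin_scale.
Qed.

Lemma sw_mul W (f : H -> H -> W) x y : bilin f ->
  sw f (x * y) = sw (fun a b => sw (fun c d => f (a * c) (b * d)) y) x.
Proof. by move=> bf; rewrite /sw comulM tlift_tmul. Qed.

Lemma sw_one W (f : H -> H -> W) : bilin f -> sw f 1 = f 1 1.
Proof. by move=> bf; rewrite /sw comul1 tlift_tens. Qed.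

Lemma sw_apl W (f : H -> W) x :
  linear f -> sw (fun a b => f (ap a * b)) x = eps x *: f 1.
Proof. by move=> lf; rewrite -lin_swE // -(lin_scale _ _ lf) -antipodel. Qed.

Lemma sw_apr W (f : H -> W) x :
  linear f -> sw (fun a b => f (a * ap b)) x = eps x *: f 1.
Proof. by move=> lf; rewrite -lin_swE // -(lin_scale _ _ lf) -antipoder. Qed.

Lemma antipode1 : ap (1 : H) = 1.
Proof.
have := antipodel (1 : H); rewrite comul1 tlift_tens; last by lin.
by rewrite mulr1 counit1 scale1r.
Qed.

End SweedlerTheory.

(** * The antipode reverses products *)

Section AntipodeTheory.
Variables (k : fieldType) (H : hopfAlgType k).
Local Notation "a *: v" := (@GRing.scale k _ a v) : ring_scope.
Implicit Types (W : vectType k) (x y : H).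

(** Both sides are convolution inverses of the multiplication, as maps on pairs: the expression [ap
    y_1 * ap x_1 * x_2 * y_2 * ap (x_3 * y_3)] collapses to either of them. *)
Lemma antipodeM x y : ap (x * y) = ap y * ap x :> H.
Proof.
have l3 (b : H) : linear (fun a => a * ap b) by lin.
have E1 : sw (fun x1 x' => sw (fun y1 y' =>
    ap y1 * ap x1 * sw (fun u v => u * ap v) (x' * y')) y) x = ap y * ap x.
  under eq_sw => a b do under eq_sw => c d do rewrite (sw_apr (f := id)) // counitM
    -scalerAr mulr1 mulrC -scalerA.
  under eq_sw => a b do (rewrite (sw_epsr (f := fun c => eps b *: (ap c * ap a))); last lin).
  by rewrite (sw_epsr (f := fun a => ap y * ap a)) //; lin.
rewrite -{}E1.
have -> : ap (x * y) = sw (fun x1 x' => sw (fun y1 y' =>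
     eps x1 *: (eps y1 *: ap (x' * y'))) y) x.
  under eq_sw => a b.
    rewrite -sw_scale.
    rewrite (sw_epsl (f := fun d => ap (b * d))); last lin.
    over.
  by rewrite (sw_epsl (f := fun b => ap (b * y))); last lin.
transitivity (sw (fun a x3 => sw (fun x1 x2 => sw (fun c y3 => sw (fun y1 y2 =>
   ap y1 * (ap x1 * x2) * y2 * ap (x3 * y3)) c) y) a) x).
  apply: eq_sw => a b; rewrite swC.
  under [RHS]eq_sw => c d.
    rewrite swC; under eq_sw => y1 y2 do
      (rewrite (sw_apl (f := fun z => ap y1 * z * y2 * ap (b * d))); last lin).
    under eq_sw => y1 y2 do rewrite mulr1.
    over.
  symmetry; apply: eq_sw => c d; rewrite -sw_scale.
  by rewrite (sw_apl (f := fun z => z * ap (b * d))) ?mul1r //; lin.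
rewrite (swA (F := fun x1 x2 x3 => sw (fun c y3 => sw (fun y1 y2 =>
   ap y1 * (ap x1 * x2) * y2 * ap (x3 * y3)) c) y)); try lin.
apply: eq_sw => a b; symmetry; transitivity (sw (fun c d => sw (fun x2 x3 =>
    sw (fun y2 y3 => ap c * ap a * ((x2 * y2) * ap (x3 * y3))) d) b) y).
  apply: eq_sw => c d; rewrite sw_mul; last by lin.
  rewrite sw_mulr; apply: eq_sw => x2 x3.
  by rewrite sw_mulr.
rewrite swC; apply: eq_sw => x2 x3.
rewrite (swA (F := fun y1 y2 y3 => ap y1 * (ap a * x2) * y2 * ap (x3 * y3))); try lin.
by apply: eq_sw => c d; apply: eq_sw => y2 y3; rewrite !mulrA.
Qed.

Lemma counit_ap x : eps (ap x) = eps x :> k.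
Proof.
have E : sw (fun a b => eps (ap a * b)) x = eps x * 1.
  by rewrite (sw_apl (f := fun a => eps a)) ?counit1 //; lin.
rewrite mulr1 in E; rewrite -E.
under eq_sw => a b do rewrite counitM mulrC.
by rewrite (sw_epsr (f := fun a => eps (ap a))) //; lin.
Qed.

End AntipodeTheory.

(** * Traces of operators and of tensor products of operators *)

Section Trace.
Variable k : fieldType.
Implicit Types (U V W : vectType k).

Definition trf V (f : V -> V) : k^o :=
  \sum_i coord (vbasis {:V}) i (f (bvec i)).

Lemma eq_trf V (f g : V -> V) : (forall x, f x = g x) -> trf f = trf g.
Proof. by move=> fg; apply: eq_bigr => i _; rewrite fg. Qed.

Lemma trf_comp U V (f : U -> V) (g : V -> U) : linear f -> linear g ->
  trf (fun x => g (f x)) = trf (fun y => f (g y)).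
Proof.
move=> lf lg; rewrite /trf.
transitivity (\sum_i \sum_j coord (vbasis {:V}) j (f (bvec i)) *
                coord (vbasis {:U}) i (g (bvec j))).
  apply: eq_bigr => i _; rewrite [in LHS](bvecE (f _)) (lin_sum _ _ lg) linear_sum.
  by apply: eq_bigr => j _; rewrite (lin_scale _ _ lg) linearZ.
rewrite exchange_big; apply: eq_bigr => j _.
rewrite [in RHS](bvecE (g _)) (lin_sum _ _ lf) linear_sum.
by apply: eq_bigr => i _; rewrite (lin_scale _ _ lf) linearZ mulrC.
Qed.

Lemma lin_trf V W (F : W -> V -> V) :
  (forall v, linear (fun w => F w v)) -> linear (fun w => trf (F w)).
Proof.
move=> lF; apply: lin_bigop => i; apply: lin_coord; exact: lF.
Qed.

Lemma trfD V (f g : V -> V) : trf (fun x => f x + g x) = trf f + trf g.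
Proof. by rewrite -big_split; apply: eq_bigr => i _; rewrite linearD. Qed.

Lemma trfZ V (f : V -> V) (c : k) : trf (fun x => c *: f x) = c * trf f.
Proof. by rewrite mulr_sumr; apply: eq_bigr => i _; rewrite linearZ. Qed.

Lemma trf_sum V (I : Type) (r : seq I) (P : pred I) (F : I -> V -> V) :
  trf (fun x => \sum_(i <- r | P i) F i x) = \sum_(i <- r | P i) trf (F i).
Proof.
rewrite /trf; under eq_bigr => i _ do rewrite linear_sum.
exact: exchange_big.
Qed.

Lemma trf_rank1 V (f : V -> k^o) (v : V) : linear f -> trf (fun x => f x *: v) = f v.
Proof.
move=> lf; rewrite /trf [in RHS](bvecE v) (lin_sum _ _ lf).
by apply: eq_bigr => i _; rewrite linearZ (lin_scale _ _ lf) [LHS]mulrC.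
Qed.

(** The identity is a sum of operators of rank one, and each of them has an explicit trace. In
    [trf_lam] the family is indexed by pairs, and its vectors repeat. *)
Lemma trf_basis V (I : finType) (v : I -> V) (phi : I -> V -> k^o) (f : V -> V) :
  (forall i, linear (phi i)) -> (forall x, x = \sum_i phi i x *: v i) ->
  linear f -> trf f = \sum_i phi i (f (v i)).
Proof.
move=> lphi E lf.
under [LHS]eq_trf => x do rewrite [in f x](E x) (lin_sum _ _ lf).
rewrite trf_sum. apply: eq_bigr => i _.
by under eq_trf => x do rewrite (lin_scale _ _ lf); rewrite trf_rank1.
Qed.

Lemma trf_id V : trf (fun x : V => x) = (\dim {:V})%:R.
Proof.
rewrite /trf; under eq_bigr => i _ do rewrite coord_bvec eqxx.
by rewrite sumr_const card_ord.
Qed.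

(* The operator factors through [X] as the identity of [X]. *)
Lemma trf_proj V (f : V -> V) (X : {vspace V}) : linear f ->
  (forall x, f x \in X) -> (forall x, x \in X -> f x = x) -> trf f = (\dim X)%:R.
Proof.
move=> lf fX fid.
transitivity (trf (fun x => vsval (vsproj X (f x)))).
  by apply: eq_trf => x; rewrite vsprojK.
have lv : linear (@vsval _ _ X) by move=> a u v; rewrite linearP.
have lp : linear (fun x => vsproj X (f x)) by move=> a u v; rewrite lf linearP.
rewrite (trf_comp lp lv) (eq_trf (g := id)); last first.
  by move=> x; rewrite fid ?vsvalK // subvsP.
by rewrite trf_id dimvf.
Qed.

(** All natural number values of characters come from here. *)
Lemma trf_idem V (f : V -> V) : linear f -> (forall x, f (f x) = f x) ->
  exists n : nat, trf f = n%:R.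
Proof.
move=> lf ff; exists (\dim (limg (linfun f))); apply: trf_proj => // [x|x].
  by rewrite -(linfunP lf) memv_img ?memvf.
by case/memv_imgP => y _ ->; rewrite linfunP.
Qed.

Lemma lin_entry U V i j : linear (fun s : tensor U V => s i j : k^o).
Proof. by move=> a s t; rewrite !mxE. Qed.

Lemma entryE U V (s : tensor U V) i j : s i j =
  coord (vbasis {:U}) i (tlift (fun a b => coord (vbasis {:V}) j b *: a) s).
Proof.
move: s; apply: (tensor_ext (W := k^o)); first exact: lin_entry.
  by apply: lin_coord; exact: lin_tlift.
move=> u v; rewrite mxE tlift_tens ?linearZ 1?[LHS]mulrC //.
by split=> w; [exact: lin_scl | apply: lin_scalel => a x y; rewrite linearP].
Qed.

Lemma trf_tensor U V (f : tensor U V -> tensor U V) : linear f ->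
  trf f = \sum_i \sum_j f (tens (bvec i) (bvec j)) i j.
Proof.
move=> lf; rewrite pair_big.
apply: (trf_basis (v := fun p => tens (bvec p.1) (bvec p.2))
  (phi := fun p s => s p.1 p.2)) => // [p|s]; first exact: lin_entry.
by rewrite {1}(tensE s) pair_big.
Qed.

Lemma trf_tens U V (f : U -> U) (g : V -> V) : linear f -> linear g ->
  trf (tmap f g) = trf f * trf g.
Proof.
move=> lf lg; rewrite trf_tensor; last exact: lin_tlift.
rewrite mulr_suml; apply: eq_bigr => i _; rewrite mulr_sumr; apply: eq_bigr => j _.
rewrite /tmap tlift_tens; first by rewrite mxE.
by split=> w; [apply: lin_tensl | apply: lin_tensr].
Qed.

(** Products of coordinate functionals read off the entries. This lets identities in the tensor
    square of [H] be checked in the algebra [dual H]. *)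
Lemma tensor_sep U V (s t : tensor U V) :
  (forall (f : 'Hom(U, k^o)) (g : 'Hom(V, k^o)),
     tlift (fun a b => f a * g b : k^o) s = tlift (fun a b => f a * g b : k^o) t) ->
  s = t.
Proof.
move=> st; apply/matrixP => i j.
have lc W (n : 'I_(\dim {:W})) : linear (coord (vbasis {:W}) n : W -> k^o).
  by move=> a u v; rewrite linearP.
have E (s' : tensor U V) : s' i j = tlift (fun a b =>
    linfun (coord (vbasis {:U}) i : U -> k^o) a *
    linfun (coord (vbasis {:V}) j : V -> k^o) b : k^o) s'.
  rewrite entryE.
  rewrite (@lin_tliftE _ _ _ _ _ _ (fun x => coord (vbasis {:U}) i x : k^o));
    last exact: lc.
  apply: eq_bigr => a _; apply: eq_bigr => b _; rewrite linearZ !linfunP //.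
  congr (_ * _).
  exact: mulrC.
by rewrite !E st.
Qed.

End Trace.

(** * Coproducts of antipodes and traces of Sweedler sums *)

Section HopfTrace.
Variables (k : fieldType) (H : hopfAlgType k).
Implicit Types (W : vectType k) (x y : H).

(** The antipode reverses coproducts because the antipode of [dual H] reverses products. *)
Lemma sw_ap W (f : H -> H -> W) x :
  bilin f -> sw f (ap x) = sw (fun a b => f (ap b) (ap a)) x.
Proof.
move=> bf; have -> : sw (fun a b => f (ap b) (ap a)) x =
    tlift f (sw (fun a b => tens (ap b) (ap a)) x).
  by rewrite [RHS]lin_swE; [apply: eq_sw => a b; rewrite tlift_tens | lin].
congr tlift; apply: tensor_sep => f1 g1.
have := congr1 (fun h : dual H => h x) (antipodeM (f1 : dual H) (g1 : dual H)).
rewrite dual_antipodeE !dmulE => ->.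
rewrite [RHS]lin_swE; last by lin.
apply: eq_sw => a b; rewrite tlift_tens; last by lin.
by rewrite [X in X * _]dual_antipodeE [X in _ * X]dual_antipodeE mulrC.
Qed.

(** [sw F] is [tlift F] after [comul]. Cyclicity moves the trace to the tensor square, where it
    splits into a trace over the first factor and a sum over the second. *)
Lemma trf_sw_cyc (F : H -> H -> H) : bilin F -> trf (sw F) =
  trf (fun a => \sum_j sw (fun u v => coord (vbasis {:H}) j v *: u)
                          (F a (bvec j))).
Proof.
move=> bF; rewrite /sw.
rewrite (@trf_comp _ _ _ (fun x => comul x) (tlift F)); try lin.
rewrite trf_tensor; last by lin.
apply: eq_bigr => i _; rewrite linear_sum; apply: eq_bigr => j _.
by rewrite tlift_tens // entryE.
Qed.

End HopfTrace.

(** Von Neumann regularity: the elementwise form of semisimplicity for finite-dimensional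
    algebras. *)
Definition vn_regular (A : pzRingType) := forall z : A, exists y, z * y * z = z.

Definition norm_integral (k : fieldType) (H : hopfAlgType k) (L : H) :=
  (forall h, h * L = @GRing.scale k _ (eps h) L) /\ eps L = 1.

(** * Integrals, averaging and semisimplicity *)

Section Integrals.
Variables (k : fieldType) (H : hopfAlgType k).
Local Notation "a *: v" := (@GRing.scale k _ a v) : ring_scope.
Implicit Types (W : vectType k) (x y h : H).

Lemma memv_sw W (X : {vspace W}) (f : H -> H -> W) x :
  (forall a b, f a b \in X) -> sw f x \in X.
Proof.
by move=> fX; apply: memv_suml => i _; apply: memv_suml => j _; exact: memvZ.
Qed.

(** Some simple left ideal is not contained in the kernel of the counit. By simplicity it meets this
    kernel trivially, so [H] acts on it through the counit. *)
Lemma semisimple_integral :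
  semisimple_alg H -> exists L : H, norm_integral L.
Proof.
case=> n [I [simI _ sumI]].
have [i nI] : exists i, ~~ (I i <= lker eps)%VS.
  apply/existsP; rewrite -[X in is_true X]negbK negb_exists; apply/negP=> /forallP sI.
  have : (1 : H) \in (\sum_i I i)%VS by rewrite sumI memvf.
  have sK : (\sum_i I i <= lker eps)%VS.
    by apply/subv_sumP => i _; have := sI i; rewrite negbK.
  by move/(subvP sK); rewrite memv_ker counit1 oner_eq0.
have [lI I0 Isimp] := simI i.
have mI x y : y \in I i -> x * y \in I i.
  by move=> yI; apply: (subvP lI); apply: memv_mul; rewrite ?memvf.
have K0 : (I i :&: lker eps)%VS = 0%VS.
  case: (Isimp (I i :&: lker eps)%VS) => //; rewrite ?capvSl //.
    apply/prodvP => u v _; rewrite !memv_cap !memv_ker => /andP[vI /eqP ev].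
    by rewrite mI //= counitM ev mulr0.
  by move/capv_idPl => sIK; rewrite sIK in nI.
have [x xI ex] : exists2 x, x \in I i & eps x != 0.
  by move/subvPn: nI => [x xI]; rewrite memv_ker; exists x.
exists ((eps x)^-1 *: x); split; last by rewrite linearZ; apply: mulVf.
move=> h; rewrite -scalerAr scalerA mulrC -scalerA; congr (_ *: _).
apply/eqP; rewrite -subr_eq0 -memv0 -K0 memv_cap memv_ker.
rewrite rpredB ?mI ?rpredZ //= linearB linearZ /= counitM subr_eq0.
exact/eqP.
Qed.

Variables (L : H) (intL : norm_integral L).

Let lintL h : h * L = eps h *: L. Proof. exact: intL.1. Qed.
Let epsL : eps L = 1. Proof. exact: intL.2. Qed.

Lemma sw_lint W (f : H -> H -> W) h : bilin f ->
  sw (fun a b => sw (fun c d => f (a * c) (b * d)) L) h = eps h *: sw f L.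
Proof. by move=> bf; rewrite -sw_mul // lintL (lin_scale _ _ (lin_sw f)). Qed.

(** The sum of the [L_1 (x) ap L_2] is a Casimir element, which is why averaging with it produces
    linear maps. Both sides are obtained by expanding [h] into three legs, of which [h_1 (x) h_2] is
    absorbed by [L] or [h_2 (x) h_3] cancels. *)
Lemma casimir W (f : H -> H -> W) h : bilin f ->
  sw (fun a b => f (h * a) (ap b)) L = sw (fun a b => f a (ap b * h)) L.
Proof.
move=> bf; have [fl fr] := bf.
transitivity (sw (fun h1 h3 => sw (fun u v => sw (fun a b =>
    f (u * a) (ap (v * b) * h3)) L) h1) h); last first.
  under eq_sw => h1 h3 do
    (rewrite (sw_lint (f := fun a b => f a (ap b * h3))); last lin).
  by rewrite (sw_epsl (f := fun h3 => sw (fun a b => f a (ap b * h3)) L)); last lin.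
rewrite (swA (F := fun u v h3 => sw (fun a b => f (u * a) (ap (v * b) * h3)) L)); try lin.
rewrite -(sw_epsr (f := fun h => sw (fun a b => f (h * a) (ap b)) L)); last lin.
apply: eq_sw => u b'; rewrite swC.
under [RHS]eq_sw => a b.
  under eq_sw => v h3 do rewrite antipodeM -mulrA.
  rewrite (sw_apl (f := fun z => f (u * a) (ap b * z))); last lin.
  rewrite mulr1; over.
by rewrite sw_scale.
Qed.

(* A projection onto the left ideal [X] averages to a left linear one. *)
Lemma left_ideal_idem (X : {vspace H}) : (forall a u, u \in X -> a * u \in X) ->
  exists2 e, e \in X & forall x, x \in X -> x * e = x.
Proof.
move=> Xl; pose P x := sw (fun a b => a * projv X (ap b * x)) L.
have PM h x : h * P x = P (h * x).
  rewrite /P sw_mulr; under eq_sw => a b do rewrite mulrA.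
  rewrite (casimir (f := fun a b => a * projv X (b * x))); last lin.
  by apply: eq_sw => a b; rewrite mulrA.
exists (P 1) => [|x xX]; first by apply: memv_sw => a b; apply: Xl; exact: memv_proj.
rewrite PM mulr1 /P; under eq_sw => a b do rewrite projv_id ?Xl // mulrA.
by rewrite (sw_apr (f := fun a => a * x)) ?epsL ?scale1r ?mul1r //; lin.
Qed.

(** The left ideal of [z] is generated by an idempotent [e = y * z], and [z * e = z]. *)
Lemma integral_vn_regular : vn_regular H.
Proof.
move=> z; pose X := limg (amulr z).
have Xl a u : u \in X -> a * u \in X.
  case/memv_imgP => v _ ->; rewrite lfunE /= mulrA; apply/memv_imgP.
  by exists (a * v); rewrite ?memvf // lfunE.
have [e eX eid] := left_ideal_idem Xl.
have zX : z \in X by apply/memv_imgP; exists 1; rewrite ?memvf // lfunE /= mul1r.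
case/memv_imgP: eX => y _; rewrite lfunE /= => eE; exists y.
by rewrite -mulrA -eE eid.
Qed.

(** The difference [y] of two integrals with the same counit has counit zero, and
    [y = y * v * y = eps (y * v) *: y] then kills it. *)
Lemma left_integralE x : (forall h, h * x = eps h *: x) -> x = eps x *: L.
Proof.
have main y : (forall h, h * y = eps h *: y) -> eps y = 0 -> y = 0.
  move=> ly ey; have [v <-] := integral_vn_regular y.
  by rewrite ly counitM ey mul0r scale0r.
move=> lx; apply/eqP; rewrite -subr_eq0; apply/eqP; apply: main => [h|].
  rewrite mulrBr lx -scalerAr lintL scalerBr !scalerA.
  by congr (_ - _ *: _); exact: mulrC.
by rewrite linearB linearZ /= epsL [X in _ - X]mulr1 subrr.
Qed.

Lemma right_integral h : L * h = eps h *: L.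
Proof.
rewrite [LHS]left_integralE ?counitM ?epsL ?mul1r // => x.
by rewrite mulrA lintL scalerAl.
Qed.

Lemma sw_rint W (f : H -> H -> W) h : bilin f ->
  sw (fun a b => sw (fun c d => f (a * c) (b * d)) h) L = eps h *: sw f L.
Proof.
by move=> bf; rewrite -sw_mul // right_integral (lin_scale _ _ (lin_sw f)).
Qed.

(** The diagonal action on the coproduct of [L] is trivial, so a factor on one leg moves to the
    other leg at the price of an antipode. *)
Lemma int_slide_l W (f : H -> H -> W) h : bilin f ->
  sw (fun a b => f a (h * b)) L = sw (fun a b => f (ap h * a) b) L.
Proof.
move=> bf; have [fl fr] := bf.
transitivity (sw (fun h1 h3 => sw (fun u v => sw (fun a b =>
    f (ap h1 * (u * a)) (v * b)) L) h3) h); last first.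
  under eq_sw => h1 h3 do
    (rewrite (sw_lint (f := fun a b => f (ap h1 * a) b)); last lin).
  by rewrite (sw_epsr (f := fun h1 => sw (fun a b => f (ap h1 * a) b) L)); last lin.
rewrite -(swA (F := fun h1 u v => sw (fun a b => f (ap h1 * (u * a)) (v * b)) L)); try lin.
rewrite -(sw_epsl (f := fun h => sw (fun a b => f a (h * b)) L)); last lin.
apply: eq_sw => b' v; rewrite swC.
under [RHS]eq_sw => a b.
  under eq_sw => h1 u do rewrite mulrA.
  rewrite (sw_apl (f := fun z => f (z * a) (v * b))); last lin.
  rewrite mul1r; over.
by rewrite sw_scale.
Qed.

Lemma int_slide_r W (f : H -> H -> W) h : bilin f ->
  sw (fun a b => f (a * h) b) L = sw (fun a b => f a (b * ap h)) L.
Proof.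
move=> bf; have [fl fr] := bf.
transitivity (sw (fun h1 h3 => sw (fun u v => sw (fun a b =>
    f (a * u) (b * v * ap h3)) L) h1) h); last first.
  under eq_sw => h1 h3 do
    (rewrite swC (sw_rint (f := fun a b => f a (b * ap h3))); last lin).
  by rewrite (sw_epsl (f := fun h3 => sw (fun a b => f a (b * ap h3)) L)); last lin.
rewrite (swA (F := fun u v h3 => sw (fun a b => f (a * u) (b * v * ap h3)) L)); try lin.
rewrite -(sw_epsr (f := fun h => sw (fun a b => f (a * h) b) L)); last lin.
apply: eq_sw => u b'; rewrite swC.
under [RHS]eq_sw => a b.
  under eq_sw => v h3 do rewrite -mulrA.
  rewrite (sw_apr (f := fun z => f (a * u) (b * z))); last lin.
  rewrite mulr1; over.
by rewrite sw_scale.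
Qed.

End Integrals.

Section Eigenvector.
Variable k : closedFieldType.

Lemma eigen_exists (V : vectType k) (X : {vspace V}) (f : V -> V) :
  linear f -> (forall x, x \in X -> f x \in X) -> X != 0%VS ->
  exists c : k, exists2 v, v \in X & (v != 0) && (f v == c *: v).
Proof.
move=> lf fX X0; pose b := vbasis X; pose n := \dim X.
have n0 : (0 < n)%N by rewrite lt0n dimv_eq0.
pose M : 'M[k]_n := \matrix_(i, j) coord b j (f b`_i).
have /closed_rootP[c] : size (char_poly M) != 1%N.
  by rewrite size_char_poly eqSS -lt0n.
rewrite -eigenvalue_root_char => /eigenvalueP[v vM v0].
have bX i : b`_(nat_of_ord (i : 'I_n)) \in X.
  by apply: vbasis_mem; rewrite mem_nth // size_tuple.
exists c, (\sum_i v 0 i *: b`_i); first by apply: memv_suml => i _; rewrite memvZ.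
apply/andP; split.
  apply: contraNneq v0 => E; apply/eqP/rowP => i; rewrite mxE.
  have/freeP fr := basis_free (vbasisP X).
  exact: (fr (fun i => v 0 i) E i).
apply/eqP; rewrite (lin_sum _ _ lf) scaler_sumr.
transitivity (\sum_j (v *m M) 0 j *: b`_j); last first.
  by rewrite vM; apply: eq_bigr => j _; rewrite mxE scalerA.
transitivity (\sum_(i < n) \sum_j (v 0 i * M i j) *: b`_j).
  apply: eq_bigr => i _; rewrite (lin_scale _ _ lf).
  rewrite [in LHS](coord_vbasis (fX _ (bX i))) scaler_sumr.
  by apply: eq_bigr => j _; rewrite scalerA mxE.
rewrite exchange_big; apply: eq_bigr => j _.
by rewrite -scaler_suml mxE.
Qed.

End Eigenvector.

(** * Primitive idempotents as representatives of the simple modules *)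

Section PrimitiveIdempotents.
Variables (k : closedFieldType) (A : falgType k).
Hypothesis vnA : vn_regular A.

(** The last clause says that the corner [e * A * e] is the line of [e]: primitivity with Schur's
    lemma built in. *)
Definition primitive_idem (e : A) :=
  [/\ e != 0, e * e = e & forall x, exists c : k, e * x * e = c *: e].

Let corner (e : A) : {vspace A} := limg (linfun (fun x => e * x * e)).

Let cornerP e x : e * x * e \in corner e.
Proof.
have le : linear (fun x => e * x * e) by lin.
by apply/memv_imgP; exists x; rewrite ?memvf // linfunP.
Qed.

Let corner_ex e y : y \in corner e -> exists x, y = e * x * e.
Proof.
have le : linear (fun x => e * x * e) by lin.
by case/memv_imgP => x _ ->; exists x; rewrite linfunP.
Qed.

(** If the corner is larger than the line of [e], subtracting an eigenvalue from an element [x] of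
    it gives a nonzero [y] with [y * u = 0] for some nonzero [u]. Regularity turns [y] into a
    nonzero idempotent [g] that also kills [u], hence has a smaller corner. *)
Lemma primitive_below e : e != 0 -> e * e = e ->
  exists2 f, primitive_idem f & e * f = f /\ f * e = f.
Proof.
have [n] := ubnP (\dim (corner e)); elim: n e => // n IH e len e0 ee.
have [sub|nsub] := boolP (corner e <= <[e]>)%VS.
  exists e => //; split=> // x; apply/vlineP.
  by apply: (subvP sub); apply: cornerP.
have [x xC xe] := subvPn nsub.
have C1 y : y \in corner e -> e * y = y.
  by case/corner_ex=> z ->; rewrite !mulrA ee.
have C2 y : y \in corner e -> y * e = y.
  by case/corner_ex=> z ->; rewrite -!mulrA ee.
have eC : e \in corner e by rewrite -[X in X \in _]ee -[X in X * _]ee.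
have [| | |c [u uC /andP[u0 /eqP xu]]] :=
  @eigen_exists k A (corner e) (fun u => x * u).
- by lin.
- by move=> u uC; rewrite -(C1 _ xC) -(C2 _ uC) mulrA -[e * x * u]mulrA.
- by apply: contraNneq e0 => C0; rewrite C0 memv0 in eC.
pose y := x - c *: e.
have yC : y \in corner e by rewrite rpredB ?rpredZ.
have y0 : y != 0.
  by apply: contraNneq xe => /eqP; rewrite subr_eq0 => /eqP->; apply/vlineP; exists c.
have yu : y * u = 0 by rewrite mulrBl xu -scalerAl C1 // subrr.
have [t yty] := vnA y; pose g := e * t * y.
have gg : g * g = g.
  by rewrite /g -!mulrA (mulrA y e) C2 // (mulrA y t) yty.
have eg : e * g = g by rewrite /g !mulrA ee.
have ge : g * e = g by rewrite /g -mulrA C2.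
have g0 : g != 0.
  have yg : y * g = y by rewrite /g !mulrA C2.
  by apply: contraNneq y0 => g0; rewrite -yg g0 mulr0.
have gu : g * u = 0 by rewrite /g -mulrA yu mulr0.
clearbody g; have [|f pf [gf fg]] := IH g _ g0 gg.
  have sub : (corner g <= corner e)%VS.
    apply/subvP => _ /corner_ex[z ->].
    have -> : g * z * g = e * (g * z * g) * e by rewrite !mulrA eg -!mulrA ge.
    exact: cornerP.
  have neq : corner g != corner e.
    apply: contraTneq u0 => E; rewrite -E in eC; have [z ez] := corner_ex eC.
    by rewrite negbK -(C1 _ uC) ez -mulrA gu mulr0.
  apply: leq_trans (_ : \dim (corner e) <= n)%N => //.
  rewrite ltn_neqAle dimvS // andbT; apply: contra neq => /eqP dE.
  by rewrite eqEdim sub dE leqnn.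
exists f => //; split; first by rewrite -gf mulrA eg.
by rewrite -fg -mulrA ge.
Qed.

(* The modules [A * e i] represent the simple modules of a split semisimple
   algebra; the last clause replaces the Wedderburn decomposition. *)
Definition idem_system (I : finType) (e : I -> A) :=
  [/\ forall i, primitive_idem (e i),
      forall i j, i != j -> forall x, e i * x * e j = 0 &
      forall f : A -> k^o, linear f -> (forall x y, f (x * y) = f (y * x)) ->
        (forall i, f (e i) = 0) -> forall x, f x = 0].

(** For primitive idempotents: [A * e] and [A * g] are isomorphic. *)
Let linked (e g : A) := exists a, e * a * g != 0.

Let orth_seq (s : seq A) :=
  (forall e, e \in s -> primitive_idem e) /\
  pairwise (fun e g => `[< forall a, e * a * g = 0 /\ g * a * e = 0 >]) s.

(** This bounds the length of a list of unlinked idempotents, so a maximal one exists. *)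
Let orth_free s : orth_seq s -> free s.
Proof.
elim: s => [|e s IH] [ps pw]; first by rewrite /free span_nil dimv0.
move: pw; rewrite /= => /andP[/allP oe pw].
rewrite free_cons IH ?andbT; last first.
  by split=> // g gs; apply: ps; rewrite inE gs orbT.
have [e0 ee _] := ps e (mem_head _ _).
apply: contra e0 => es; rewrite -ee.
have le : linear (fun x => e * x) by lin.
have: e * e \in (linfun (fun x => e * x) @: <<s>>)%VS.
  by rewrite -(linfunP le) memv_img.
rewrite limg_span -memv0 => h; apply: (subvP _ _ h).
apply/span_subvP => _ /mapP[g gs ->]; rewrite linfunP // memv0.
by have /asboolP/(_ 1)[] := oe g gs; rewrite mulr1 => ->.
Qed.

Lemma idem_system_exists : exists (I : finType) (e : I -> A), idem_system e.
Proof.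
have [s [os smax]] : exists s, orth_seq s /\
    forall g, primitive_idem g -> exists2 e, e \in s & linked e g.
  suff ext n s : orth_seq s -> (\dim {:A} - size s < n)%N ->
      exists s', orth_seq s' /\
        forall g, primitive_idem g -> exists2 e, e \in s' & linked e g.
    by apply: (ext (\dim {:A}).+1 [::]); rewrite ?ltnS ?leq_subr //; split.
  elim: n s => // n IH s os len.
  have [ok|/existsNP[g /not_implyP[pg ng]]] :=
    pselect (forall g, primitive_idem g -> exists2 e, e \in s & linked e g).
    by exists s.
  have og e : e \in s -> forall a, e * a * g = 0 /\ g * a * e = 0.
    move=> es a; have E b : e * b * g = 0.
      by apply/eqP/negPn/negP => nz; apply: ng; exists e => //; exists b.
    (* Regularity makes the relation symmetric: [g * a * e] equals [(g * a * e) * y * (g * a * e)],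
       which contains the factor [e * y * g]. *)
    split=> //; have [y <-] := vnA (g * a * e).
    by rewrite -!mulrA (mulrA y) (mulrA e) (mulrA e) E mul0r !mulr0.
  have ogs : orth_seq (g :: s).
    have [ps pw] := os; split=> [e|]; first by rewrite inE => /predU1P[->//|/ps].
    rewrite /= pw andbT; apply/allP => e es; apply/asboolP => a.
    by have [] := og e es a.
  have sz : (size (g :: s) <= \dim {:A})%N.
    by have := orth_free ogs; rewrite /free => /eqP <-; apply: dimvS; apply: subvf.
  by apply: IH ogs _; move: len sz => /=; lia.
have [ps pw] := os.
exists 'I_(size s), (fun i : 'I_(size s) => s`_i).
have si i : (i < size s)%N -> s`_i \in s by exact: mem_nth.
have orth (i j : 'I_(size s)) : i != j -> forall x, s`_i * x * s`_j = 0.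
  have pw' (a b : 'I_(size s)) : (a < b)%N ->
      forall x, s`_a * x * s`_b = 0 /\ s`_b * x * s`_a = 0.
    by move=> ab x; have /(pairwiseP 0)/(_ a b (ltn_ord a) (ltn_ord b) ab)/asboolP := pw.
  move=> ij x; case: (ltngtP i j) => [lij|lji|/val_inj E].
  - by case: (pw' i j lij x).
  - by case: (pw' j i lji x).
  - by rewrite E eqxx in ij.
split=> // [i|f lf fC fe]; first exact/ps/si/ltn_ord.
(* Take a nonzero [z] in [e * A * g] with [z * y * z = z]. By Schur's lemma [e * (z * y) * e = e]
   and [g * (y * z) * g = g], so a trace function has the same value at [g] and at the listed
   [e]. *)
have fprim g : primitive_idem g -> f g = 0.
  move=> pg; have [e es [a nz]] := smax g pg.
  have [e0 ee eC] := ps e es; have [g0 gg gC] := pg.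
  have [z [zE nz']] : exists z, z = e * a * g /\ z != 0 by exists (e * a * g).
  move: nz' nz => nz _; have [y zyz] := vnA z.
  have ez : e * z = z by rewrite zE !mulrA ee.
  have zg : z * g = z by rewrite zE -mulrA gg.
  have [c cE] := eC (z * y); have [d dE] := gC (y * z).
  have one b : z = b *: z -> b = 1.
    move/(congr1 (fun u => u - z)); rewrite subrr -[X in _ - X]scale1r -scalerBl.
    by move=> /esym/eqP; rewrite scaler_eq0 (negPf nz) orbF subr_eq0 => /eqP.
  have c1 : c = 1.
    apply: one; have : e * (z * y) * e * z = z by rewrite -!mulrA ez !mulrA ez.
    by rewrite cE -scalerAl ez.
  have d1 : d = 1.
    apply: one; have : z * (g * (y * z) * g) = z.
      by rewrite !mulrA zg -!mulrA zg !mulrA.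
    by rewrite dE -scalerAr zg.
  have -> : g = (g * y) * z by rewrite -zg mulrA -(mulrA g) dE d1 scale1r.
  rewrite fC mulrA (_ : z * g * y = z * y) ?zg //.
  have -> : f (z * y) = f (e * (z * y) * e).
    by rewrite [in RHS]fC !mulrA ee ez.
  rewrite cE c1 scale1r.
  by have := fe (Ordinal (etrans (index_mem e s) es)); rewrite /= nth_index.
(* The idempotent [e] absorbs primitive idempotents below [1 - e] until it equals 1; [fprim] keeps
   [f] zero on [A * e]. *)
have grow n e : e * e = e -> (forall a, f (a * e) = 0) ->
    (\dim {:A} - \dim (limg (amulr e)) < n)%N -> forall x, f x = 0.
  elim: n e => // n IH e ee fe0 len x.
  have [e1|ne1] := eqVneq (1 - e) 0.
    by rewrite -[x]mulr1 (subr0_eq e1) fe0.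
  have ee' : (1 - e) * (1 - e) = 1 - e.
    by rewrite mulrBl mul1r mulrBr mulr1 ee subrr subr0.
  have [g pg [eg ge]] := primitive_below ne1 ee'.
  have [g0 gg gC] := pg.
  have Eg : e * g = 0 by rewrite -eg mulrA mulrBr mulr1 ee subrr mul0r.
  have gE : g * e = 0 by rewrite -ge -mulrA mulrBl mul1r ee subrr mulr0.
  apply: (IH (e + g)).
  - by rewrite mulrDl !mulrDr ee gg Eg gE addr0 add0r.
  - move=> a; rewrite mulrDr (lin_mapD _ _ lf) fe0 add0r -gg mulrA fC mulrA.
    by have [c ->] := gC a; rewrite (lin_scale _ _ lf) fprim // scaler0.
  - suff lt : (\dim (limg (amulr e)) < \dim (limg (amulr (e + g)%R)))%N.
      have : (\dim (limg (amulr (e + g)%R)) <= \dim {:A})%N by rewrite dimvS ?subvf.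
      by move: len lt; lia.
    have sub : (limg (amulr e) <= limg (amulr (e + g)%R))%VS.
      apply/subvP => _ /memv_imgP[y _ ->]; apply/memv_imgP; exists (y * e).
        by rewrite memvf.
      by rewrite !lfunE /= mulrDr -!mulrA ee Eg mulr0 addr0.
    rewrite ltn_neqAle dimvS // andbT; apply/negP => /eqP dE.
    have /eqP E : limg (amulr e) == limg (amulr (e + g)%R).
      by rewrite eqEdim sub dE leqnn.
    have : g \in limg (amulr e).
      rewrite E; apply/memv_imgP; exists g; rewrite ?memvf //.
      by rewrite lfunE /= mulrDr gE gg add0r.
    case/memv_imgP => y _; rewrite lfunE /= => gy; case/eqP: g0.
    by rewrite -gg {1}gy -mulrA Eg mulr0.
apply: (grow (\dim {:A}).+1 0); rewrite ?mulr0 ?ltnS ?leq_subr // => a.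
by rewrite mulr0 (lin_map0 lf).
Qed.

End PrimitiveIdempotents.

(** * Irreducible characters and trace functions *)

Section Characters.
Variables (k : closedFieldType) (A : falgType k).
Hypotheses (char_k : [pchar k] =i pred0) (vnA : vn_regular A).
Local Notation "a *: v" := (@GRing.scale k _ a v) : ring_scope.

Lemma natr_eq0 n : (n%:R == 0 :> k) = (n == 0)%N.
Proof. by have /pcharf0P := char_k; apply. Qed.

Lemma natr_inj0 : injective (fun n : nat => n%:R : k).
Proof.
move=> m n; wlog le_mn : m n / (m <= n)%N.
  by move=> W E; case: (leqP m n) => [|/ltnW] le; [|symmetry]; apply: W.
move=> E; have := natr_eq0 (n - m).
by rewrite natrB // E subrr eqxx => /esym/eqP; lia.
Qed.

Definition trace_fun (f : A -> k^o) :=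
  linear f /\ forall x y, f (x * y) = f (y * x).

Definition regular_char (h : A) : k := trf (fun x => h * x).

Lemma lin_regular_char : linear (regular_char : A -> k^o).
Proof. by apply: lin_trf; lin. Qed.

Lemma regular_charC x y : regular_char (x * y) = regular_char (y * x).
Proof.
rewrite /regular_char; under eq_trf => z do rewrite -mulrA.
rewrite (@trf_comp _ _ _ (fun z => y * z) (fun z => x * z)); try lin.
by apply: eq_trf => z; rewrite mulrA.
Qed.

(** If [x * y * x = x], then [x * y] is idempotent and its regular trace is the dimension of a space
    containing [x]. *)
Lemma regular_char_nondeg x : (forall y, regular_char (x * y) = 0) -> x = 0.
Proof.
move=> x0; have [y xyx] := vnA x; pose X := limg (amull (x * y)).
have XE z : z \in X -> x * y * z = z.
  by case/memv_imgP => u _ ->; rewrite lfunE /= !mulrA xyx.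
have := x0 y; rewrite /regular_char (trf_proj (X := X)); [|lin| |] => //.
  move/eqP; rewrite natr_eq0 dimv_eq0 => /eqP X0.
  have : x \in X by rewrite -xyx; apply/memv_imgP; exists x; rewrite ?memvf ?lfunE.
  by rewrite X0 memv0 => /eqP.
by move=> z; apply/memv_imgP; exists z; rewrite ?memvf ?lfunE.
Qed.

Variables (I : finType) (e : I -> A).
Hypothesis sys : idem_system e.

(** The character of the simple module [A * e i], onto which right multiplication by [e i] projects
    [A]. *)
Definition irr (i : I) (h : A) : k := trf (fun x => h * x * e i).
Definition deg (i : I) : nat := \dim (limg (amulr (e i))).

Let ee i : e i * e i = e i. Proof. by have [/(_ i)[]] := sys. Qed.
Let e0 i : e i != 0. Proof. by have [/(_ i)[]] := sys. Qed.

Lemma lin_irr i : linear (irr i : A -> k^o).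
Proof. by apply: lin_trf; lin. Qed.

Lemma irrC i x y : irr i (x * y) = irr i (y * x).
Proof.
rewrite /irr; under eq_trf => z do rewrite -!mulrA (mulrA y).
rewrite (@trf_comp _ _ _ (fun z => y * z * e i) (fun z => x * z)); try lin.
by apply: eq_trf => z; rewrite !mulrA.
Qed.

Lemma irr_e i j : irr i (e j) = (i == j)%:R.
Proof.
have [prim orth _] := sys; rewrite /irr; case: eqVneq => [->|ij].
  rewrite (trf_proj (X := <[e j]>%VS)).
  - by rewrite dim_vline e0.
  - by lin.
  - by move=> x; apply/vlineP; have [_ _] := prim j; apply.
  - by move=> _ /vlineP[c ->]; rewrite -scalerAr -scalerAl !ee.
rewrite (eq_trf (g := fun=> 0)) => [|x]; last by rewrite orth 1?eq_sym.
by rewrite /trf big1 // => l _; rewrite linear0.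
Qed.

Lemma irr_inj i j : (forall x, irr i x = irr j x) -> i = j.
Proof.
move=> /(_ (e i)); rewrite !irr_e eqxx eq_sym; case: eqVneq => // _ /eqP.
by rewrite oner_eq0.
Qed.

(** Both sides agree at every [e j], where [irr i] is a Kronecker symbol, so the last clause of
    [idem_system] applies. *)
Lemma trace_fun_expand f x : trace_fun f -> f x = \sum_i f (e i) * irr i x.
Proof.
case=> lf fC; have [_ _ sep] := sys; apply/eqP; rewrite -subr_eq0; apply/eqP.
apply: (sep (fun x => f x - \sum_i f (e i) * irr i x)).
- apply: lin_add => //; apply: lin_opp; apply: lin_bigop => i.
  by apply: (lin_mulr (A := k^o)); apply: lin_irr.
- move=> y z; rewrite fC; congr (_ - _).
  by apply: eq_bigr => i _; rewrite irrC.
move=> j; rewrite (bigD1 j) //= irr_e eqxx mulr1 big1 ?addr0 ?subrr // => i ij.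
by rewrite irr_e (negPf ij) mulr0.
Qed.

(** The trace form of the decomposition of [A], as a bimodule, into products of a simple module and
    its dual. It is a trace function in each variable, so [trace_fun_expand] reduces it to the pairs
    of idempotents. *)
Lemma trf_sandwich a b : trf (fun x => a * x * b) = \sum_i irr i a * irr i b.
Proof.
pose F (x y : A) : k^o := trf (fun z : A => x * z * y).
have tl y : trace_fun (fun x => F x y).
  split; first by apply: lin_trf; lin.
  move=> x x'; rewrite /F; under eq_trf => z do rewrite -!mulrA (mulrA x').
  rewrite (@trf_comp _ _ _ (fun z => x' * z * y) (fun z => x * z)); try lin.
  by apply: eq_trf => z; rewrite !mulrA.
rewrite -/(F a b) (trace_fun_expand _ (tl b)); apply: eq_bigr => i _.
rewrite mulrC; congr (_ * _); rewrite (_ : F (e i) b = irr i b) //.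
have tr : trace_fun (fun y => F (e i) y).
  split; first by apply: lin_trf; lin.
  move=> x x'; rewrite /F; under eq_trf => z do rewrite (mulrA (_ * z)).
  rewrite (@trf_comp _ _ _ (fun z => e i * z * x) (fun z => z * x')); try lin.
  by apply: eq_trf => z; rewrite !mulrA.
rewrite (trace_fun_expand _ tr) (bigD1 i) //= big1 ?addr0 => [|j ji].
  by rewrite (_ : F _ _ = irr i (e i)) // irr_e eqxx mul1r.
by rewrite (_ : F _ _ = irr j (e i)) // irr_e (negPf ji) mul0r.
Qed.

Lemma irr1 i : irr i 1 = (deg i)%:R.
Proof.
rewrite /irr; under eq_trf => x do rewrite mul1r.
apply: trf_proj; first by lin.
  by move=> x; apply/memv_imgP; exists x; rewrite ?memvf ?lfunE.
by move=> _ /memv_imgP[x _ ->]; rewrite lfunE /= -mulrA ee.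
Qed.

Lemma deg_gt0 i : (0 < deg i)%N.
Proof.
rewrite lt0n dimv_eq0; apply: contraNneq (e0 i) => X0.
rewrite -memv0 -X0; apply/memv_imgP; exists (e i); rewrite ?memvf //.
by rewrite lfunE /= ee.
Qed.

Lemma irr_idem i u : u * u = u -> exists n : nat, irr i u = n%:R.
Proof.
move=> uu; apply: (@trf_idem _ _ (fun x => u * x * e i)) => [|x]; first by lin.
by rewrite -!mulrA ee !mulrA uu.
Qed.

Lemma regular_charE h : regular_char h = \sum_i (deg i)%:R * irr i h.
Proof.
rewrite /regular_char; under eq_trf => x do rewrite -[h * x]mulr1.
by rewrite trf_sandwich; apply: eq_bigr => i _; rewrite irr1 mulrC.
Qed.

Lemma dim_sum_deg : \dim {:A} = (\sum_i deg i ^ 2)%N.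
Proof.
apply: natr_inj0; rewrite /= -trf_id natr_sum.
rewrite (eq_trf (g := fun x : A => 1 * x * 1)) => [|x]; last by rewrite mul1r mulr1.
by rewrite trf_sandwich; apply: eq_bigr => i _; rewrite irr1 natrX expr2.
Qed.

Lemma central_scalar z i : (forall x, z * x = x * z) ->
  exists c : k, forall x, z * x * e i = c *: (x * e i).
Proof.
move=> zC; have [/(_ i)[_ _ /(_ z)[c cE]] _ _] := sys; exists c => x.
by rewrite zC -mulrA -[in LHS]ee zC scalerAr -cE -!mulrA zC.
Qed.

Lemma irr_central z i c x : (forall x, z * x * e i = c *: (x * e i)) ->
  irr i (z * x) = c * irr i x.
Proof.
by move=> zE; rewrite /irr -trfZ; apply: eq_trf => y; rewrite -(mulrA z) zE.
Qed.

Lemma irr_deg1 i x : deg i = 1%N -> x * e i = irr i x *: e i.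
Proof.
move=> d1; have eX : e i \in limg (amulr (e i)).
  by apply/memv_imgP; exists (e i); rewrite ?memvf ?lfunE //= ee.
have XE : limg (amulr (e i)) = <[e i]>%VS.
  by apply/esym/eqP; rewrite eqEdim -memvE eX dim_vline e0; rewrite /deg in d1; rewrite d1.
have /choice[p pE] : forall y, exists c : k, y * e i = c *: e i.
  move=> y; apply/vlineP; rewrite -XE; apply/memv_imgP.
  by exists y; rewrite ?memvf ?lfunE.
have puniq y c : y * e i = c *: e i -> p y = c.
  move=> E; apply/eqP; rewrite -subr_eq0.
  have : (p y - c) *: e i == 0 by rewrite scalerBl -pE E subrr.
  by rewrite scaler_eq0 (negPf (e0 i)) orbF.
rewrite pE; congr (_ *: _).
rewrite /irr; under eq_trf => y do rewrite -mulrA pE -scalerAr pE.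
rewrite (@trf_rank1 _ _ p (p x *: e i)).
  by rewrite (puniq _ (p x)) // -scalerAl ee.
by move=> a y z; apply: puniq; rewrite mulrDl -scalerAl !pE scalerA -scalerDl.
Qed.

Definition alg_char (f : A -> k^o) :=
  [/\ linear f, f 1 = 1 & forall x y, f (x * y) = f x * f y].

Lemma deg1_alg_char i : deg i = 1%N -> alg_char (irr i).
Proof.
move=> d1; split=> [||x y]; [exact: lin_irr | by rewrite irr1 d1 |].
apply/eqP; rewrite -subr_eq0.
have : (irr i (x * y) - irr i x * irr i y) *: e i == 0.
  by rewrite scalerBl -irr_deg1 // mulrC -scalerA -irr_deg1 // -mulrA scalerAr
    -irr_deg1 // subrr.
by rewrite scaler_eq0 (negPf (e0 i)) orbF.
Qed.

(** The values [f (e i)] are 0 or 1, and [f 1 = 1] says that the degrees of the [i] with value 1 add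
    up to 1: there is just one, of degree one. *)
Lemma alg_char_irr f : alg_char f ->
  exists2 i, deg i = 1%N & forall x, f x = irr i x.
Proof.
case=> lf f1 fM; have tf : trace_fun f by split=> // x y; rewrite !fM mulrC.
have f01 i : {b : bool | f (e i) = b%:R}.
  apply: cid; have := fM (e i) (e i); rewrite ee => /eqP.
  rewrite -subr_eq0 -[X in X - _]mulr1 -mulrBr mulf_eq0 subr_eq0.
  by case/orP => /eqP E; [exists false | exists true].
pose b i := sval (f01 i).
have E : 1%N = (\sum_(i | b i) deg i)%N.
  apply: natr_inj0; rewrite /= natr_sum big_mkcond.
  transitivity (f 1); [by rewrite f1 | rewrite (trace_fun_expand _ tf)].
  apply: eq_bigr => i _; rewrite irr1 (svalP (f01 i)) -/(b i).
  by case: (b i); rewrite ?mul1r ?mul0r.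
have [i bi] : exists i, b i.
  apply/existsP; rewrite -[X in is_true X]negbK negb_exists; apply/negP => /forallP nb.
  by rewrite big_pred0 // in E => i; apply/negbTE.
have d1 := deg_gt0 i; rewrite (bigD1 i) //= in E.
have R0 : (\sum_(j | b j && (j != i)) deg j = 0)%N by lia.
exists i; first by lia.
move=> x; rewrite (trace_fun_expand _ tf) (bigD1 i) //= (svalP (f01 i)) -/(b i) bi.
rewrite mul1r big1 ?addr0 // => j ji; rewrite (svalP (f01 j)) -/(b j).
case bj: (b j); last by rewrite mul0r.
by move: R0; rewrite (bigD1 j) ?bj //=; have := deg_gt0 j; lia.
Qed.

End Characters.

(** * The cointegral, Radford's formula and group-like elements *)

Section HopfIntegral.
Variables (k : fieldType) (H : hopfAlgType k).
Local Notation "a *: v" := (@GRing.scale k _ a v) : ring_scope.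
Implicit Types (W : vectType k) (x y h : H).

(* The cointegral of Larson and Radford. *)
Definition lam (h : H) : k := trf (fun x : H => ap (ap x) * h).

Lemma lin_lam : linear (lam : H -> k^o).
Proof. by apply: lin_trf; lin. Qed.

Lemma hom_sep W (u v : W) : (forall f : 'Hom(W, k^o), f u = f v) -> u = v.
Proof.
move=> uv; rewrite (bvecE u) (bvecE v); apply: eq_bigr => i _; congr (_ *: _).
have lc : linear (coord (vbasis {:W}) i : W -> k^o) by move=> a x y; rewrite linearP.
by have := uv (linfun (coord (vbasis {:W}) i : W -> k^o)); rewrite !linfunP.
Qed.

(** Under a functional [f] the left side is the trace of the operator sending [x] to the sum of the
    [f h_2 *: (ap (ap x) * h_1)]. [E1] writes this operator as [sw F]; [E2] evaluates the trace of
    [sw F] after a cyclic rotation, where an antipode cancels. *)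
Lemma lam_sw1 h : sw (fun a b => lam a *: b) h = lam h *: 1.
Proof.
apply: hom_sep => f; rewrite lin_swE; last by lin.
pose F a b := sw (fun u v => f (ap b * v) *: u) (ap (ap a) * h).
have bF : bilin F by rewrite /F; lin.
have E1 x : sw F x = sw (fun u v => f v *: (ap (ap x) * u)) h.
  transitivity (sw (fun x1 x2 => sw (fun p q => sw (fun u v =>
     f (ap x2 * ap (ap q) * v) *: (ap (ap p) * u)) h) x1) x).
    apply: eq_sw => a b; rewrite /F sw_mul; last by lin.
    rewrite sw_ap; last by lin.
    rewrite sw_ap; last by lin.
    by apply: eq_sw => p q; apply: eq_sw => u v; rewrite mulrA.
  rewrite (swA (F := fun p q x2 => sw (fun u v =>
     f (ap x2 * ap (ap q) * v) *: (ap (ap p) * u)) h)); try lin.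
  rewrite -(sw_epsr (f := fun x => sw (fun u v => f v *: (ap (ap x) * u)) h)); last lin.
  apply: eq_sw => p y; rewrite swC sw_scale; apply: eq_sw => u v.
  under eq_sw => q x2 do rewrite -antipodeM.
  rewrite (sw_apl (f := fun z => f (ap z * v) *: (ap (ap p) * u))); last lin.
  by rewrite antipode1 mul1r.
have E2 : trf (sw F) = lam h * f 1.
  rewrite (trf_sw_cyc bF) mulrC -trfZ; apply: eq_trf => a; set Y := _ * h.
  transitivity (\sum_j sw (fun u1 w => sw (fun u2 v =>
      f (ap (coord (vbasis {:H}) j u2 *: bvec j) * v) *: u1) w) Y).
    apply: eq_bigr => j _; rewrite /F -/Y lin_swE; last by lin.
    rewrite -(swA (F := fun u1 u2 v => f (ap (coord (vbasis {:H}) j u2 *: bvec j) * v) *: u1)).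
    - apply: eq_sw => u v; rewrite (lin_scale _ _ (lin_sw _)) sw_scale.
      apply: eq_sw => u1 u2.
      rewrite [ap (_ *: _)]linearZ -scalerAl [f (_ *: _)]linearZ /= scalerA.
      by congr (_ *: _); exact: mulrC.
    - by lin.
    - move=> u1 v; apply: lin_scalel; apply: lin_homf; apply: lin_mull.
      by apply: lin_homf; apply: lin_scalel => c x y; rewrite linearP.
    - by lin.
  transitivity (sw (fun u1 w => eps w *: (f 1 *: u1)) Y); last first.
    by rewrite (sw_epsr (f := fun u => f 1 *: u)) //; lin.
  transitivity (sw (fun u1 w => sw (fun u2 v => f (ap u2 * v) *: u1) w) Y); last first.
    apply: eq_sw => u1 w.
    by rewrite (sw_apl (f := fun z => f z *: u1)) //; lin.
  rewrite /sw /tlift exchange_big; apply: eq_bigr => i1 _.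
  rewrite exchange_big; apply: eq_bigr => i2 _; rewrite -scaler_sumr; congr (_ *: _).
  rewrite exchange_big; apply: eq_bigr => i3 _.
  rewrite exchange_big; apply: eq_bigr => i4 _; rewrite -scaler_sumr; congr (_ *: _).
  rewrite [in RHS](bvecE (bvec i3)) [in RHS]linear_sum mulr_suml linear_sum scaler_suml.
  by [].
have -> : f (lam h *: 1) = lam h * f 1 by rewrite linearZ.
rewrite -E2.
under [in RHS]eq_trf => x do rewrite E1.
rewrite /sw /tlift trf_sum; apply: eq_bigr => i _.
rewrite trf_sum; apply: eq_bigr => j _.
by rewrite !trfZ [f _]linearZ /=; congr (_ * _); exact: mulrC.
Qed.

Lemma lam_sw W (f : H -> W) h :
  linear f -> sw (fun a b => lam a *: f b) h = lam h *: f 1.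
Proof.
move=> lf; rewrite -(lin_scale _ _ lf) -lam_sw1 lin_swE //.
by apply: eq_sw => a b; rewrite (lin_scale _ _ lf).
Qed.

(** The squared antipode is the Nakayama automorphism of [lam]. *)
Lemma lam_nakayama x y : lam (y * x) = lam (ap (ap x) * y).
Proof.
rewrite /lam; under [LHS]eq_trf => t do rewrite mulrA.
rewrite [LHS](@trf_comp _ _ _ (fun t => ap (ap t) * y) (fun t => t * x)); try lin.
by apply: eq_trf => t; rewrite 2!antipodeM mulrA.
Qed.

Variables (L : H) (intL : norm_integral L).
Let lintL h : h * L = eps h *: L. Proof. exact: intL.1. Qed.
Let rintL h : L * h = eps h *: L. Proof. exact: right_integral intL h. Qed.
Let epsL : eps L = 1. Proof. exact: intL.2. Qed.

Lemma lam_integral : lam L = 1.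
Proof.
rewrite /lam; under eq_trf => x do rewrite lintL !counit_ap.
by rewrite trf_rank1 //; lin.
Qed.

(** Slide [h] to the other leg of [L] and apply the cointegral identity. The coproduct of [L] thus
    yields dual bases: traces become sums over [L], and the antipode is seen to be injective. *)
Lemma lam_dual_basis h : sw (fun a b => lam (ap h * a) *: b) L = h.
Proof.
have ll := lin_lam.
rewrite -(int_slide_l intL (f := fun a b => (lam a : k^o) *: b)); last by lin.
by rewrite (lam_sw (f := fun b => h * b)) ?lam_integral ?scale1r ?mulr1 //; lin.
Qed.

Lemma antipode_lam h : sw (fun a b => lam (a * h) *: b) L = ap h.
Proof.
have ll := lin_lam.
rewrite (int_slide_r intL (f := fun a b => (lam a : k^o) *: b)); last by lin.
by rewrite (lam_sw (f := fun b => b * ap h)) ?lam_integral ?scale1r ?mul1r //; lin.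
Qed.

Lemma antipode_inj : injective (ap : H -> H).
Proof.
move=> x y E; rewrite -(lam_dual_basis x) -(lam_dual_basis y).
by apply: eq_sw => a b; rewrite E.
Qed.

Lemma antipode_surj h : exists y : H, ap y = h.
Proof.
have i0 : lker (ap : 'Hom(H, H)) == 0%VS by apply/lker0P; apply: antipode_inj.
by exists ((ap : 'Hom(H, H))^-1%VF h); rewrite lker0_lfunVK.
Qed.

Lemma lam_nondeg x : (forall y, lam (y * x) = 0) -> x = 0.
Proof.
move=> x0; apply: antipode_inj; rewrite linear0 -(antipode_lam x).
by rewrite /sw /tlift big1 // => i _; rewrite big1 // => j _; rewrite x0 scale0r scaler0.
Qed.

Lemma trf_lam (F : H -> H) : linear F ->
  trf F = sw (fun a b => lam (ap (F b) * a) : k^o) L.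
Proof.
move=> lF; have ll := lin_lam.
pose phi (p : 'I_(\dim {:H}) * 'I_(\dim {:H})) x : k^o :=
  comul L p.1 p.2 * lam (ap x * bvec p.1).
rewrite (trf_basis (v := fun p => bvec p.2) (phi := phi)) //.
- by rewrite /phi /sw /tlift pair_big.
- by move=> p; apply: (lin_mulr (A := k^o)); lin.
move=> x; rewrite -[in LHS](lam_dual_basis x) /sw /tlift pair_big.
by apply: eq_bigr => p _; rewrite scalerA.
Qed.

Lemma dim_dual_le : (\dim {:dual H} <= \dim {:H})%N.
Proof.
have -> : {:dual H}%VS = <<[seq dvec i | i <- enum 'I_(\dim {:H})]>>%VS.
  apply/vspaceP => u; rewrite memvf (dvecE u); apply/esym/memv_suml => i _.
  by rewrite memvZ // memv_span // map_f // mem_enum.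
by apply: leq_trans (dim_span _) _; rewrite size_map size_enum_ord.
Qed.

(** Sending [f] to the sum of the [f L_1 *: L_2] maps the dual onto [H], by [lam_dual_basis]; a
    surjection that does not raise dimensions is injective. *)
Lemma sw_integral_inj (f g : H -> k^o) : linear f -> linear g ->
  sw (fun a b => f a *: b) L = sw (fun a b => g a *: b) L -> forall x, f x = g x.
Proof.
move=> lf lg E x; have ll := lin_lam.
pose Phi (f : dual H) : H := sw (fun a b => f a *: b) L.
have lP : linear Phi by rewrite /Phi; lin.
have sP : limg (linfun Phi) = {:H}%VS.
  apply/vspaceP => y; rewrite memvf.
  apply/memv_imgP; exists (linfun (fun a => lam (ap y * a) : k^o)); rewrite ?memvf //.
  rewrite linfunP // /Phi -[LHS](lam_dual_basis y); apply: eq_sw => a b.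
  by rewrite linfunP //; lin.
have dD := dim_dual_le.
have k0 : lker (linfun Phi) = 0%VS.
  apply/eqP; rewrite -dimv_eq0; have := limg_ker_dim (linfun Phi) {:dual H}.
  rewrite sP capfv => E'; rewrite -leqn0 -(leq_add2r (\dim {:H})) E'.
  exact: dD.
have : linfun f - linfun g \in lker (linfun Phi).
  rewrite memv_ker linearB /= !linfunP // subr_eq0; apply/eqP.
  transitivity (sw (fun a b => f a *: b) L); first by apply: eq_sw => a b; rewrite linfunP.
  by rewrite E; apply: eq_sw => a b; rewrite linfunP.
rewrite k0 memv0 subr_eq0 => /eqP/lfunP/(_ x).
by rewrite !linfunP.
Qed.

(* Radford's distinguished group-like element of H. *)
Definition dgl : H := sw (fun a b => lam b *: a) L.

(** The sliding computation for [lam] also applies to [m]: on the coproduct of [L], [m] and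
    [m L * lam] give the same element. *)
Lemma lam_uniq (m : H -> k^o) : linear m ->
  (forall h, sw (fun a b => m a *: b) h = m h *: 1) -> forall h, m h = m L * lam h.
Proof.
move=> lm mi h; have ll := lin_lam.
have M x : sw (fun a b => m (ap x * a) *: b) L = m L *: x.
  rewrite -(int_slide_l intL (f := fun a b => m a *: b)); last by lin.
  under eq_sw => a b do rewrite scalerAr.
  by rewrite -sw_mulr mi -scalerAr mulr1.
have E : sw (fun a b => m (ap 1 * a) *: b) L =
         sw (fun a b => (m L * lam (ap 1 * a)) *: b) L.
  rewrite M -{1}(lam_dual_basis 1) sw_scale.
  by apply: eq_sw => a b; rewrite scalerA.
have := sw_integral_inj _ _ E h; rewrite antipode1 mul1r; apply; first by lin.
by apply: (lin_mulr (A := k^o)); lin.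
Qed.

(** Under any functional the left side becomes again a left cointegral in [h], hence a multiple of
    [lam]; the factor is read off at [L]. *)
Lemma sw_dgl W (f : H -> W) h :
  linear f -> sw (fun a b => lam b *: f a) h = lam h *: f dgl.
Proof.
move=> lf; have ll := lin_lam; apply: hom_sep => g.
rewrite lin_swE; last by lin.
pose m h : k^o := sw (fun a b => lam b * g (f a) : k^o) h.
have lm : linear m by rewrite /m; lin.
have := lam_uniq lm _ h; rewrite [m L](_ : _ = g (f dgl)); last first.
  rewrite /dgl !lin_swE //; last by lin.
  by apply: eq_sw => a b; rewrite lin_scale // linearZ.
move=> E; transitivity (m h); first by apply: eq_sw => a b; rewrite linearZ.
rewrite E {E}; first by rewrite linearZ; exact: mulrC.
move=> {}h; rewrite /m.
transitivity (sw (fun a c => sw (fun a1 b => g (f a1) *: (lam b *: c)) a) h).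
  apply: eq_sw => a c; rewrite sw_scalel.
  by apply: eq_sw => a1 b; rewrite scalerA mulrC.
rewrite (swA (F := fun a1 b c => g (f a1) *: (lam b *: c))); try lin.
under eq_sw => a b do rewrite -sw_scale lam_sw1.
rewrite sw_scalel.
by apply: eq_sw => a b; rewrite scalerA mulrC.
Qed.

Lemma counit_dgl : eps dgl = 1.
Proof.
rewrite /dgl lin_swE; last by lin.
have ll := lin_lam; rewrite -lam_integral.
rewrite -(sw_epsl (f := fun b => lam b : k^o)) //.
by apply: eq_sw => a b; rewrite linearZ; exact: mulrC.
Qed.

Lemma comul_dgl : comul dgl = tens dgl dgl.
Proof.
have ll := lin_lam.
transitivity (sw (fun a b => lam b *: tens a dgl) L).
  rewrite /dgl lin_swE; last by lin.
  transitivity (sw (fun a b => sw (fun a1 a2 => lam b *: tens a1 a2) a) L).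
    apply: eq_sw => a b; rewrite linearZ -sw_scale; congr (_ *: _).
    have tE u v : id (tens u v) = tlift (@tens k H H) (tens u v).
      by rewrite tlift_tens //; exact: bilin_tens.
    exact: (tensor_ext (@lin_id _ _) (@lin_tlift _ _ _ _ _) tE (comul a)).
  rewrite (swA (F := fun a1 a2 b => lam b *: tens a1 a2)); try lin.
  apply: eq_sw => a b; rewrite (sw_dgl (f := fun x => tens a x)); last by lin.
  by [].
by rewrite (sw_dgl (f := fun x => tens x dgl)) ?lam_integral ?scale1r //; lin.
Qed.

Lemma dgl_grouplike : dgl \in @grouplike k H.
Proof. by rewrite inE comul_dgl counit_dgl !eqxx. Qed.

Lemma gl_sw W (f : H -> H -> W) g :
  g \in @grouplike k H -> bilin f -> sw f g = f g g.
Proof. by rewrite inE => /andP[/eqP cg _] bf; rewrite /sw cg tlift_tens. Qed.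

Lemma gl_mulV g : g \in @grouplike k H -> ap g * g = 1.
Proof. by move=> gg; exact: (antipode_mull (Grouplike gg)). Qed.

Lemma gl_mulrV g : g \in @grouplike k H -> g * ap g = 1.
Proof. by move=> gg; exact: (antipode_mulr (Grouplike gg)). Qed.

Lemma antipode_integral : ap L = L.
Proof.
rewrite [LHS](left_integralE intL) ?counit_ap ?epsL ?scale1r // => h.
have [y <-] := antipode_surj h.
by rewrite -antipodeM rintL linearZ /= counit_ap.
Qed.

Lemma right_cointegral_uniq (m : H -> k^o) : linear m ->
  (forall h, sw (fun a b => m b *: a) h = m h *: 1) ->
  forall h, m (ap h) = m L * lam h.
Proof.
move=> lm mi h; rewrite (lam_uniq (m := fun h => m (ap h))) ?antipode_integral //.
  by lin.
move=> {}h; apply: antipode_inj; rewrite linearZ /= antipode1 -mi sw_ap; last by lin.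
by rewrite lin_swE; [apply: eq_sw => a b; rewrite linearZ | lin].
Qed.

(** Both [lam (ap h)] and [lam (dgl * h)] are right cointegrals in [h] with the same value at
    [L]. *)
Lemma lam_antipode h : lam (ap h) = lam (dgl * h).
Proof.
have ll := lin_lam; have [y <-] := antipode_surj h.
transitivity (lam L * lam y).
  rewrite -[in X in X * _]antipode_integral.
  apply: (@right_cointegral_uniq (fun h => lam (ap h))); first by lin.
  move=> {}h; apply: antipode_inj; rewrite linearZ /= antipode1 -lam_sw1 sw_ap; last by lin.
  by rewrite lin_swE; [apply: eq_sw => a b; rewrite linearZ | lin].
have <- : lam (dgl * L) = lam L by rewrite lintL counit_dgl scale1r.
symmetry; apply: (@right_cointegral_uniq (fun h => lam (dgl * h))); first by lin.
have gI u v : dgl * u = dgl * v -> u = v.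
  by move/(congr1 ( *%R (ap dgl))); rewrite !mulrA (gl_mulV dgl_grouplike) !mul1r.
move=> {}h; apply: gI; rewrite -scalerAr mulr1.
rewrite -(sw_dgl (f := id)); last by lin.
rewrite sw_mul; last by lin.
rewrite (gl_sw (f := fun a b => sw (fun c d => lam (b * d) *: (a * c)) h) dgl_grouplike);
  last by lin.
by rewrite sw_mulr; apply: eq_sw => a b; rewrite -scalerAr.
Qed.

(** Radford's formula for the fourth power of the antipode. The modular function is trivial, [L]
    being two-sided, so only [dgl] appears. The two sides are compared under [lam] by moving factors
    with [lam_nakayama] and [lam_antipode]. *)
Lemma radford y : ap (ap (ap (ap y))) * dgl = dgl * y.
Proof.
have ll := lin_lam.
apply/eqP; rewrite -subr_eq0; apply/eqP; apply: lam_nondeg => z.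
have [z' <-] := antipode_surj z; have [x <-] := antipode_surj z'.
rewrite -lam_nakayama mulrBl (lin_mapB _ _ ll) -[dgl * y * x]mulrA -lam_antipode.
rewrite antipodeM [lam (ap x * _)]lam_nakayama -antipodeM lam_antipode mulrA.
by rewrite [lam (dgl * _ * _)]lam_nakayama !mulrA subrr.
Qed.

(** If [g] is a combination of the other group-likes [s], apply its coordinate [c] at [s_i] to the
    first leg of the coproduct: the result is [c *: g] on one side and [c *: s_i] on the other, so
    [c = 0]. *)
Lemma gl_free (s : seq H) : uniq s -> {subset s <= @grouplike k H} -> free s.
Proof.
elim: s => [|g s IH]; first by rewrite /free span_nil dimv0.
rewrite /= free_cons => /andP[gs us] sub.
have fs : free s by apply: IH => // x xs; apply: sub; rewrite inE xs orbT.
rewrite fs andbT; apply/negP => gS.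
have gE := @coord_span _ _ _ (in_tuple s) g gS.
have gg : g \in @grouplike k H by apply: sub; rewrite mem_head.
have c0 i : coord (in_tuple s) i g = 0.
  have lc : linear (coord (in_tuple s) i : H -> k^o) by move=> a u v; rewrite linearP.
  pose phi x := sw (fun a b => (coord (in_tuple s) i a : k^o) *: b) x.
  have lphi : linear phi by rewrite /phi; lin.
  have phiE x : x \in @grouplike k H -> phi x = coord (in_tuple s) i x *: x.
    by move=> xg; apply: gl_sw => //; lin.
  have sg (j : 'I_(size s)) : s`_j \in @grouplike k H.
    by apply: sub; rewrite inE mem_nth ?orbT.
  have := phiE g gg; rewrite {1}gE (lin_sum _ _ lphi) (bigD1 i) //= big1 ?addr0.
    rewrite (lin_scale _ _ lphi) phiE // coord_free // eqxx scale1r => /eqP.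
    rewrite -subr_eq0 -scalerBr scaler_eq0 => /orP[/eqP //|].
    by rewrite subr_eq0 => /eqP E; rewrite -E mem_nth in gs.
  move=> j ji; rewrite (lin_scale _ _ lphi) phiE // coord_free //.
  by rewrite (negPf ji) scale0r scaler0.
move: gg; rewrite inE => /andP[_]; rewrite gE big1 ?linear0 1?eq_sym ?oner_eq0 //.
by move=> i _; rewrite c0 scale0r.
Qed.

Lemma gl_size (s : seq H) :
  uniq s -> {subset s <= @grouplike k H} -> (size s <= \dim {:H})%N.
Proof.
move=> us sg; have /eqP <- := gl_free us sg; apply: dimvS; exact: subvf.
Qed.

Lemma gl_exp g n : g \in @grouplike k H -> g ^+ n \in @grouplike k H.
Proof.
move=> gg; elim: n => [|n IH]; first exact: grouplike1.
by rewrite exprS; exact: (grouplikeM (Grouplike gg) (Grouplike IH)).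
Qed.

Lemma gl_order g : g \in @grouplike k H -> exists2 n, (0 < n)%N & g ^+ n = 1.
Proof.
move=> gg; pose s := [seq g ^+ i | i <- iota 0 (\dim {:H}).+1].
have ns : ~~ uniq s.
  apply/negP => us; suff /(gl_size us) : {subset s <= @grouplike k H}.
    by rewrite size_map size_iota ltnn.
  by move=> _ /mapP[i _ ->]; exact: gl_exp.
have [i [j [lij E]]] : exists i j, (i < j)%N /\ g ^+ i = g ^+ j.
  move: ns => /(uniqPn 0)[i [j [lij lj]]].
  rewrite size_map size_iota in lj.
  rewrite !(nth_map 0%N) ?size_iota ?(ltn_trans lij) // !nth_iota ?(ltn_trans lij) //.
  by rewrite !add0n; exists i, j.
exists (j - i)%N; first by rewrite subn_gt0.
have gi n : ap g ^+ n * g ^+ n = 1.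
  elim: n => [|n IH]; first by rewrite mulr1.
  by rewrite exprSr exprS mulrA -(mulrA _ _ g) gl_mulV // mulr1.
by rewrite -[LHS]mul1r -(gi i) -mulrA -exprD subnKC ?(ltnW lij) // -E gi.
Qed.

End HopfIntegral.

(** * Integral relations between roots of unity, from [k] to [algC] *)

Section RootTransfer.
Import Num.Theory.
Variable k : closedFieldType.
Hypothesis char_k : [pchar k] =i pred0.

Lemma intr_eq0_char0 (c : int) : (c%:~R == 0 :> k) = (c == 0).
Proof.
by case: c => n; rewrite ?NegzE ?mulrNz ?oppr_eq0 -pmulrn natr_eq0.
Qed.

Lemma root_Cyclotomic n (z : k) :
  n.-primitive_root z -> root (map_poly intr 'Phi_n) z.
Proof.
move=> pz; have n0 := prim_order_gt0 pz.
have X1 d : (0 < d)%N -> root (map_poly intr 'Phi_d) z -> (n %| d)%N.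
  move=> d0 rd; rewrite (prim_order_dvd pz) -subr_eq0.
  have : root (map_poly intr ('X^d - 1 : {poly int})) z.
    rewrite -prod_Cyclotomic // (big_rem d) -?dvdn_divisors //=.
    by rewrite rmorphM rootM rd.
  by rewrite rmorphB /= map_polyXn rmorph1 rootE !hornerE.
have : root (map_poly intr ('X^n - 1 : {poly int})) z.
  rewrite rmorphB /= map_polyXn rmorph1 rootE !hornerE.
  by rewrite (prim_expr_order pz) subrr.
rewrite -prod_Cyclotomic // rmorph_prod rootE horner_prod prodf_seq_eq0.
case/hasP => d; rewrite -dvdn_divisors // => dn rd.
have d0 : (0 < d)%N by apply: dvdn_gt0 dn.
by rewrite (_ : n = d) //; apply/eqP; rewrite eqn_dvd dn (X1 _ d0 rd).
Qed.

(** The minimal polynomial of [w] is cyclotomic. If [P] does not vanish at [w], the two are coprime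
    over the rationals; clearing denominators in a Bezout relation and evaluating at [z] makes a
    nonzero integer vanish in [k]. *)
Lemma root_transfer n (z : k) (w : algC) (P : {poly int}) :
  n.-primitive_root z -> n.-primitive_root w ->
  root (map_poly intr P) z -> root (map_poly intr P : {poly algC}) w.
Proof.
move=> pz pw rz; have [pf [Dpf mon_pf] dvpf] := minCpolyP w.
have Rinj : injective (map_poly (ratr : rat -> algC)).
  by apply: map_poly_inj; exact: fmorph_inj.
have QC (p : {poly int}) : map_poly ratr (map_poly intr p : {poly rat}) =
    map_poly intr p :> {poly algC}.
  by rewrite -map_poly_comp; apply: eq_map_poly => b; rewrite /= rmorph_int.
have pfE : pf = map_poly intr 'Phi_n.
  by apply: Rinj; rewrite -Dpf (minCpoly_cyclotomic pw) QC (Cintr_Cyclotomic pw).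
pose Q : {poly rat} := map_poly intr P.
apply/negPn/negP => nr.
have cop : coprimep pf Q.
  rewrite /coprimep; set g := gcdp _ _.
  have gpf : g %| pf by exact: dvdp_gcdl.
  have pf0 : pf != 0 by exact: monic_neq0.
  have /dvdpP[h hE] := gpf.
  have h0 : h != 0 by apply: contraNneq pf0 => h0; rewrite hE h0 mul0r.
  have g0 : g != 0 by apply: contraNneq pf0 => g0; rewrite hE g0 mulr0.
  have : root (map_poly ratr (h * g)) w by rewrite -hE dvpf.
  rewrite rmorphM rootM => /orP[rh|rg].
    have := dvpf h; rewrite rh => /esym/(dvdp_leq h0).
    rewrite hE size_mul // => le; have : (0 < size g)%N by rewrite size_poly_gt0.
    by move: le; case: (size g) => [//|[|m]] //=; lia.
  case/negP: nr; rewrite -QC dvpf; apply: dvdp_trans (dvdp_gcdr pf Q).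
  by rewrite -dvpf.
have /Bezout_eq1_coprimepP[[u v] /= uv] := cop.
have [qu [a a0 uE]] := rat_poly_scale u.
have [qv [b b0 vE]] := rat_poly_scale v.
have E : b *: qu * 'Phi_n + a *: qv * P = (a * b)%:P.
  apply: (@map_inj_poly _ _ (intr : int -> rat)); [exact: intr_inj | by [] |].
  rewrite map_polyC rmorphD !rmorphM /= !map_polyZ /= -pfE -/Q.
  transitivity ((a%:~R * b%:~R) *: (u * pf + v * Q)); last by rewrite uv alg_polyC -?intrM.
  rewrite uE vE scalerDr -!scalerAl !scalerA; congr (_ *: _ + _ *: _).
    by rewrite mulrAC mulfV ?mul1r // intr_eq0.
  by rewrite -mulrA mulfV ?mulr1 // intr_eq0.
have := congr1 (fun p => (map_poly (intr : int -> k) p).[z]) E.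
rewrite map_polyC rmorphD !(rmorphM (map_poly _)) /= !hornerE (eqP (root_Cyclotomic pz)) (eqP rz).
rewrite !mulr0 addr0 => /esym/eqP.
by rewrite intr_eq0_char0 mulf_eq0 (negPf a0) (negPf b0).
Qed.

Lemma prim_root_exists n : (0 < n)%N -> exists z : k, n.-primitive_root z.
Proof.
move=> n0; have [r rE] := closed_field_poly_normal ('X^n - 1 : {poly k}).
have m1 : ('X^n - 1 : {poly k}) \is monic by rewrite monicXnsubC.
rewrite (monicP m1) scale1r in rE.
have : has n.-primitive_root r.
  apply: has_prim_root => //.
  - by apply/allP => x xr; rewrite /root_of_unity rE root_prod_XsubC.
  - by rewrite -separable_prod_XsubC -rE separable_Xn_sub_1 // natr_eq0 // -lt0n.
  have := congr1 (fun p : {poly k} => size p) rE.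
  by rewrite size_XnsubC // size_prod_XsubC => -[->].
by case/hasP => z _ pz; exists z.
Qed.

Lemma root_exists n (c : k) : (0 < n)%N -> exists x, x ^+ n = c.
Proof.
move=> n0; have /closed_rootP[x] : size ('X^n - c%:P) != 1%N.
  by rewrite size_XnsubC // eqSS -lt0n.
by rewrite rootE !hornerE subr_eq0 => /eqP; exists x.
Qed.

(* Over the complex numbers the sum is [\sum_i |\sum_j a i j w ^ j|^2]. *)
Lemma cyclotomic_norm_sum_neq0 n (z : k) (I : finType) (a : I -> 'I_n -> nat) i0 :
  n.-primitive_root z -> (\sum_j a i0 j = 1)%N ->
  \sum_i (\sum_j (a i j)%:R * z ^+ j) * (\sum_j (a i j)%:R * z ^+ (n - j)) != 0.
Proof.
move=> pz a1; have n0 := prim_order_gt0 pz.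
have [w pw] := C_prim_root_exists n0.
pose P : {poly int} := \sum_i (\sum_j (a i j)%:R *: 'X^j) *
  (\sum_j (a i j)%:R *: 'X^(n - j)).
have PE (R : comNzRingType) (x : R) : (map_poly intr P).[x] =
    \sum_i (\sum_j (a i j)%:R * x ^+ j) * (\sum_j (a i j)%:R * x ^+ (n - j)).
  rewrite rmorph_sum horner_sum; apply: eq_bigr => i _.
  rewrite rmorphM /= hornerM !rmorph_sum !horner_sum; congr (_ * _).
    by apply: eq_bigr => j _; rewrite /= map_polyZ map_polyXn !hornerE rmorph_nat.
  by apply: eq_bigr => j _; rewrite /= map_polyZ map_polyXn !hornerE rmorph_nat.
apply/negP => E0; have := @root_transfer n z w P pz pw.
rewrite !rootE !PE => /(_ E0); apply/negP.
have w0 : w != 0.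
  apply/eqP => w0; move: (prim_expr_order pw); rewrite w0 expr0n (gtn_eqF n0).
  by move/eqP; rewrite eq_sym oner_eq0.
have wj (j : 'I_n) : w ^+ (n - j) = (w ^+ j)^*.
  have -> : (w ^+ j)^* = (w ^+ j)^-1.
    rewrite -exprVn rmorphXn; congr (_ ^+ _).
    rewrite invC_norm; have -> : `|w| = 1.
      apply/eqP; rewrite -(@pexpr_eq1 _ _ n) // -normrX (prim_expr_order pw).
      by rewrite normr1.
    by rewrite expr1n invr1 mul1r.
  apply: (mulIf (x := w ^+ j)); first by rewrite expf_neq0.
  by rewrite -exprD subnK ?(ltnW (ltn_ord j)) // (prim_expr_order pw) mulVf ?expf_neq0.
pose s i := \sum_j (a i j)%:R * w ^+ j.
have sE i : (\sum_j (a i j)%:R * w ^+ j) * (\sum_j (a i j)%:R * w ^+ (n - j)) =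
    `|s i| ^+ 2.
  rewrite normCK; congr (_ * _); rewrite rmorph_sum; apply: eq_bigr => j _.
  by rewrite rmorphM rmorph_nat wj.
under eq_bigr => i _ do rewrite sE.
rewrite psumr_eq0 => [|i _]; last by rewrite exprn_ge0 // normr_ge0.
apply/negP => /allP/(_ i0 (mem_index_enum _)); rewrite expf_eq0 /= normr_eq0.
(* The coefficients of the term [i0] add up to 1, so its inner sum is a single power of [w]. *)
have [j aj] : exists j, a i0 j != 0%N.
  apply/existsP; rewrite -[X in is_true X]negbK negb_exists; apply/negP => /forallP n1.
  by move: a1; rewrite big1 // => j _; apply/eqP; have := n1 j; rewrite negbK.
rewrite (bigD1 j) //= in a1; rewrite -lt0n in aj.
have R0 : (\sum_(i | i != j) a i0 i = 0)%N by move: a1 aj; case: (a i0 j) => [|[|?]] //=; lia.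
have a1' : a i0 j = 1%N by move: a1; rewrite R0 addn0.
rewrite /s (bigD1 j) //= a1' mul1r big1 ?addr0 ?expf_eq0 ?(negPf w0) ?andbF // => l lj.
have /eqP := R0; rewrite sum_nat_eq0 => /forallP/(_ l); rewrite lj /= => /eqP->.
by rewrite mul0r.
Qed.

End RootTransfer.

(** * Character values at elements with a central power *)

Section TwistedTrace.
Variables (k : closedFieldType) (A : falgType k).
Hypotheses (char_k : [pchar k] =i pred0) (vnA : vn_regular A).
Variables (I : finType) (e : I -> A).
Hypothesis sys : idem_system e.
Local Notation "a *: v" := (@GRing.scale k _ a v) : ring_scope.

Lemma geometric_sum0 n (t : k) :
  t ^+ n = 1 -> t != 1 -> \sum_(j < n) t ^+ j = 0.
Proof.
move=> tn t1; apply/eqP; have /eqP := subrX1 t n; rewrite tn subrr eq_sym mulf_eq0.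
by rewrite subr_eq0 (negPf t1).
Qed.

(* The eigenvalues of [w] on a simple module are [u * z ^ j], and those of
   its inverse [u^-1 * z ^ (m - j)]. *)
Lemma irr_finite_order (m : nat) (z : k) (w w' : A) (i : I) :
  (1 < m)%N -> m.-primitive_root z -> w' * w = 1 -> w * w' = 1 ->
  (forall x, w ^+ m * x = x * w ^+ m) ->
  exists a : 'I_m -> nat, exists2 u : k, u != 0 &
  [/\ irr e i w = u * \sum_j (a j)%:R * z ^+ j,
      irr e i w' = u^-1 * \sum_j (a j)%:R * z ^+ (m - j) &
      (\sum_j a j)%N = deg e i].
Proof.
move=> m1 pz w'w ww' wm; have m0 : (0 < m)%N by apply: ltnW.
have [/(_ i)[e0 ee _] _ _] := sys; set E := e i in e0 ee *.
have li := lin_irr e i.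
have [c cE] := central_scalar sys i wm; rewrite -/E in cE.
have w'm n : w' ^+ n * w ^+ n = 1.
  elim: n => [|n IH]; first by rewrite mulr1.
  by rewrite exprSr exprS mulrA -(mulrA _ w') w'w mulr1.
have c0 : c != 0.
  apply: contraNneq e0 => c0; have := cE E; rewrite c0 scale0r -mulrA ee => wE.
  by rewrite -[E]mul1r -(w'm m) -mulrA wE mulr0.
have [u uc] := root_exists c m0.
have u0 : u != 0 by apply: contraNneq c0 => u0; rewrite -uc u0 expr0n gtn_eqF.
pose v := u^-1 *: w.
have vX n : v ^+ n = (u^-1) ^+ n *: w ^+ n by rewrite exprZn.
have vm x : v ^+ m * (x * E) = x * E.
  by rewrite vX -scalerAl mulrA cE scalerA exprVn uc mulVf // scale1r.
have z0 : z != 0.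
  apply/eqP => z0; have := prim_expr_order pz; rewrite z0 expr0n gtn_eqF //.
  by move/eqP; rewrite eq_sym oner_eq0.
have mR : (m%:R : k) != 0 by rewrite natr_eq0 // -lt0n.
(* On the module, the Fourier projector onto the eigenspace of [v] for [z ^+ j]; its trace is the
   multiplicity [a j]. *)
pose p (j : 'I_m) : A := (m%:R)^-1 *: \sum_(l < m) (z^-1) ^+ (j * l) *: v ^+ l.
have lm (y : A) : linear (fun x : A => x * y) by lin.
have pE j y : p j * y = (m%:R)^-1 *: \sum_(l < m) (z^-1) ^+ (j * l) *: (v ^+ l * y).
  rewrite -scalerAl mulr_suml; congr (_ *: _); apply: eq_bigr => l _.
  by rewrite -scalerAl.
have vp j x : v * (p j * (x * E)) = z ^+ j *: (p j * (x * E)).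
  rewrite pE -scalerAr scalerA mulrC -scalerA; congr (_ *: _).
  pose G l := (z^-1) ^+ (j * l) *: (v ^+ l * (x * E)).
  have G0m : G m = G 0%N.
    by rewrite /G muln0 vm mul1r mulnC exprM exprVn (prim_expr_order pz) invr1 expr1n.
  have : \sum_(l < m) G l.+1 = \sum_(l < m) G l.
    apply: (addrI (G 0%N)); rewrite -[RHS]addrC -{2}G0m.
    by rewrite -(big_ord_recr m (fun l => G l)) /= big_ord_recl.
  move=> GS; transitivity (z ^+ j *: \sum_(l < m) G l.+1); last by rewrite GS.
  rewrite mulr_sumr scaler_sumr; apply: eq_bigr => l _.
  rewrite /G -scalerAr mulrA -exprS scalerA mulnS exprD (mulrA (z ^+ j)) -exprMn mulfV //.
  by rewrite expr1n mul1r.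
have vlp j l x : v ^+ l * (p j * (x * E)) = z ^+ (j * l) *: (p j * (x * E)).
  elim: l => [|l IH]; first by rewrite muln0 mul1r scale1r.
  by rewrite exprS -mulrA IH -scalerAr vp scalerA -exprD mulnS addnC.
have pp j x : p j * (p j * (x * E)) = p j * (x * E).
  rewrite {1}pE; under eq_bigr => l _ do
    rewrite vlp scalerA -exprMn mulVf // expr1n scale1r.
  by rewrite sumr_const card_ord -scaler_nat scalerA mulVf // scale1r.
have /choice[a aE] : forall j, exists n : nat, irr e i (p j) = n%:R.
  move=> j; apply: (@trf_idem _ _ (fun x => p j * x * E)) => [|x]; first by lin.
  by rewrite -!mulrA ee pp.
have sumv r : (r < m)%N -> irr e i (v ^+ r) = \sum_(j < m) (a j)%:R * z ^+ (j * r).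
  move=> rm; have -> : v ^+ r = \sum_(j < m) z ^+ (j * r) *: p j.
    rewrite /p; under [RHS]eq_bigr => j _ do rewrite !scaler_sumr.
    rewrite exchange_big (bigD1 (Ordinal rm)) //= [X in _ = _ + X]big1 ?addr0.
      transitivity (\sum_(j < m) (m%:R)^-1 *: v ^+ r); last first.
        apply: eq_bigr => j _; rewrite !scalerA; congr (_ *: _).
        by rewrite mulrCA -exprMn mulfV // expr1n mulr1.
      by rewrite big_const_ord iter_addr_0 -scaler_nat scalerA mulfV // scale1r.
    move=> l lr; pose t := z ^+ r * (z^-1) ^+ l.
    transitivity (\sum_(j < m) ((m%:R)^-1 * t ^+ j) *: v ^+ l).
      apply: eq_bigr => j _; rewrite !scalerA; congr (_ *: _).
      rewrite mulrCA; congr (_ * _).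
      by rewrite /t exprMn -!exprM ![(_ * j)%N]mulnC.
    rewrite -scaler_suml -mulr_sumr geometric_sum0 ?mulr0 ?scale0r //.
      rewrite /t exprMn -!exprM ![(_ * m)%N]mulnC !exprM exprVn.
      by rewrite (prim_expr_order pz) invr1 !expr1n mulr1.
    apply: contraNneq lr => t1; have : z ^+ r = z ^+ l.
      by rewrite -[RHS]mul1r -t1 /t -mulrA -exprMn mulVf // expr1n mulr1.
    move/eqP; rewrite (eq_prim_root_expr pz) !modn_small // => /eqP E'.
    by apply/eqP/val_inj; rewrite /= E'.
  rewrite (lin_sum _ _ li); apply: eq_bigr => j _; rewrite (lin_scale _ _ li) aE.
  exact: mulrC.
exists a, u => //; split.
- have := sumv 1%N m1; under eq_bigr => j _ do rewrite muln1; move <-.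
  by rewrite expr1 (lin_scale _ _ li) mulrA mulfV // mul1r.
(* On the module [v ^+ m] is the identity, so the inverse of [w = u *: v] acts as
   [u^-1 *: v ^+ m.-1]. *)
- have -> : irr e i w' = u^-1 * irr e i (v ^+ m.-1).
    rewrite /irr -trfZ; apply: eq_trf => x.
    rewrite -/E; transitivity (w' * (v ^+ m * (x * E))); first by rewrite vm mulrA.
    rewrite -(mulrA _ x) !vX -!scalerAl scalerA -exprS prednK // -scalerAr.
    by congr (_ *: _); rewrite -{1}(prednK m0) exprS !mulrA w'w mul1r.
  rewrite sumv ?prednK //; congr (_ * _); apply: eq_bigr => j _; congr (_ * _).
  apply: (mulIf (x := z ^+ j)); first by rewrite expf_neq0.
  rewrite -!exprD subnK ?(ltnW (ltn_ord j)) // -mulnSr prednK // mulnC exprM.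
  by rewrite (prim_expr_order pz) expr1n.
apply: (natr_inj0 char_k); rewrite /= natr_sum -irr1 //.
have := sumv 0%N m0; rewrite expr0 => ->.
by apply: eq_bigr => j _; rewrite muln0 mulr1.
Qed.

End TwistedTrace.

(** * The squared antipode has nonzero trace *)

Section LarsonRadford.
Variables (k : closedFieldType) (H : hopfAlgType k).
Hypothesis char_k : [pchar k] =i pred0.
Variables (L : H) (intL : norm_integral L).
Local Notation "a *: v" := (@GRing.scale k _ a v) : ring_scope.
Let vnH : vn_regular H := integral_vn_regular intL.
Let ll := @lin_lam k H.
Local Notation T := (fun x : H => ap (ap x)).

Lemma dual_regular_char (f : H -> k^o) :
  linear f -> exists w, forall h, f h = regular_char (w * h).
Proof.
move=> lf; have lr := @lin_regular_char k H.
pose Phi (w : H) : dual H := linfun (fun h => regular_char (w * h) : k^o).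
have PE w h : Phi w h = regular_char (w * h) by rewrite linfunP //; lin.
have lP : linear Phi.
  move=> a u v; apply/lfunP => h; rewrite add_lfunE scale_lfunE !PE.
  by rewrite mulrDl -scalerAl lr.
have k0 : lker (linfun Phi) == 0%VS.
  apply/lker0P => u v; rewrite !linfunP // => E; apply/eqP; rewrite -subr_eq0; apply/eqP.
  apply: (regular_char_nondeg char_k vnH) => y.
  by rewrite mulrBl (lin_mapB _ _ lr) -!PE E subrr.
have : limg (linfun Phi) = {:dual H}%VS.
  apply/eqP; rewrite eqEdim subvf limg_dim_eq; first exact: dim_dual_le.
  by rewrite (eqP k0) capv0.
move=> E; have : linfun f \in limg (linfun Phi) by rewrite E memvf.
case/memv_imgP => w _; rewrite linfunP // => fE; exists w => h.
by rewrite -PE -fE linfunP.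
Qed.

(** Write [lam] as [regular_char (w * _)]. The Nakayama automorphism is the squared antipode for
    [lam] and trivial for the regular character, so [w] conjugates one into the other. *)
Lemma antipode2_inner : exists w w' : H,
  [/\ w' * w = 1, w * w' = 1 & forall x, x * w = w * T x].
Proof.
have [w wE] := dual_regular_char ll.
have wT x : x * w = w * T x.
  apply/eqP; rewrite -subr_eq0; apply/eqP.
  apply: (regular_char_nondeg char_k vnH) => y.
  rewrite mulrBl (lin_mapB _ _ (@lin_regular_char k H)) -!mulrA -wE -lam_nakayama.
  by rewrite wE regular_charC -!mulrA subrr.
have inj v : v * w = 0 -> v = 0.
  move=> vw; apply: (lam_nondeg intL) => h.
  rewrite wE mulrA regular_charC mulrA vw mul0r.
  exact: (lin_map0 (@lin_regular_char k H)).
have k0 : lker (amulr w) == 0%VS.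
  apply/lker0P => u v; rewrite !lfunE /= => E; apply/eqP; rewrite -subr_eq0.
  by apply/eqP/inj; rewrite mulrBl E subrr.
pose w' := ((amulr w)^-1)%VF 1; have w'w : w' * w = 1.
  by have := lker0_lfunVK k0 1; rewrite lfunE.
exists w, w'; split=> //; apply/eqP; rewrite -subr_eq0; apply/eqP/inj.
by rewrite mulrBl -mulrA w'w mulr1 mul1r subrr.
Qed.

(** [lam 1] is the trace of the squared antipode, which is conjugation by [w]. By [trf_sandwich] it
    is the sum of the products of [irr i w'] and [irr i w]; the trivial representation supplies the
    term of degree one required by [cyclotomic_norm_sum_neq0]. *)
Lemma lam1_neq0 : lam (1 : H) != 0.
Proof.
have [I [e sys]] := idem_system_exists vnH.
have [w [w' [w'w ww' wT]]] := antipode2_inner.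
have [n n0 gn] := gl_order (dgl_grouplike intL).
(* The fourth power of the antipode is conjugation by [dgl], of order dividing [n], so the squared
   antipode has order dividing [2 n] and [w ^+ m] is central. *)
pose m := n.*2; have m1 : (1 < m)%N by rewrite /m; lia.
have [z pz] := prim_root_exists char_k (ltnW m1).
have wm x : w ^+ m * x = x * w ^+ m.
  have wj j : x * w ^+ j = w ^+ j * iter j T x.
    elim: j => [|j IH]; first by rewrite mulr1 mul1r.
    by rewrite exprSr mulrA IH -mulrA wT mulrA.
  have gj j : iter j.*2 T x * dgl L ^+ j = dgl L ^+ j * x.
    elim: j => [|j IH]; first by rewrite mulr1 mul1r.
    by rewrite doubleS !iterS exprS mulrA (radford intL) -mulrA IH mulrA.
  by have := gj n; rewrite gn mulr1 mul1r => Tx; rewrite wj -/m -/m Tx.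
have lamE : lam (1 : H) = \sum_i irr e i w' * irr e i w.
  rewrite -(trf_sandwich sys).
  have E : trf (fun x : H => ap (ap x) * 1) = trf (fun x : H => w' * x * w).
    by apply: eq_trf => x; rewrite mulr1 -mulrA wT mulrA w'w mul1r.
  exact: E.
have /choice[a aP] := fun i => irr_finite_order char_k sys i m1 pz w'w ww' wm.
have [i0 d0 epsE] : exists2 i, deg e i = 1%N & forall x, eps x = irr e i x.
  apply: (alg_char_irr char_k sys (f := fun x => eps x)); split.
  - by lin.
  - exact: counit1.
  - exact: counitM.
have -> : lam (1 : H) = \sum_i (\sum_j (a i j)%:R * z ^+ j) *
                  (\sum_j (a i j)%:R * z ^+ (m - j)).
  rewrite lamE; apply: eq_bigr => i _; have [u u0 [-> -> _]] := aP i.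
  by rewrite mulrC mulrACA mulfV // mul1r.
apply: (cyclotomic_norm_sum_neq0 char_k (i0 := i0)) => //.
by have [u u0 [_ _ ->]] := aP i0.
Qed.

Lemma dgl1 : dgl L = 1.
Proof.
have := sw_dgl intL (f := id) 1 (@lin_id _ _); rewrite sw_one; last by lin.
by move/(congr1 ( *:%R (lam (1 : H))^-1)); rewrite !scalerA mulVf ?lam1_neq0 // !scale1r.
Qed.

Lemma antipode4 x : ap (ap (ap (ap x))) = x :> H.
Proof. by have := radford intL x; rewrite dgl1 mulr1 mul1r. Qed.

(** [n] and [m] are the multiplicities of the eigenvalues 1 and -1. The condition allows 0 as well,
    so that an involution may be composed with a projection commuting with it. *)
Lemma trf_involution (V : vectType k) (f : V -> V) : linear f ->
  (forall x, f (f (f x)) = f x) -> exists n m : nat,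
  trf f = n%:R - m%:R /\ trf (fun x => f (f x)) = n%:R + m%:R.
Proof.
move=> lf f3; have h2 : (2%:R : k) != 0 by rewrite natr_eq0.
have idem (c : k) : c ^+ 2 = 1 -> exists n : nat,
    trf (fun x => (2%:R)^-1 *: (f (f x) + c *: f x)) = n%:R.
  move=> c2; apply: trf_idem => [|x]; first by lin.
  rewrite !(lin_scale _ _ lf, lin_mapD _ _ lf) !f3; congr (_ *: _).
  set u := f (f x); set v := f x.
  have -> : c *: ((2%:R)^-1 *: (v + c *: u)) = (2%:R)^-1 *: (u + c *: v).
    by rewrite scalerA mulrC -scalerA scalerDr scalerA -expr2 c2 scale1r addrC.
  rewrite -scalerDl (_ : _ + _ = 1 :> k) ?scale1r //.
  by rewrite -[X in X + X]mulr1 -mulrDr; exact: mulVf.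
have [n nE] := idem 1 (expr1n _ _); have [m mE] := idem (-1) (etrans (sqrrN 1) (expr1n _ _)).
have E c : trf (fun x => (2%:R)^-1 *: (f (f x) + c *: f x)) =
    (2%:R)^-1 * (trf (fun x => f (f x)) + c * trf f).
  by rewrite trfZ trfD trfZ.
exists n, m; rewrite -nE -mE !E mul1r mulN1r -mulrBr -mulrDr.
set P := trf (fun x => f (f x)); set Q := trf f.
have -> : P + Q - (P - Q) = Q *+ 2 by rewrite opprB addrCA addrAC subrr add0r -mulr2n.
have -> : P + Q + (P - Q) = P *+ 2 by rewrite addrACA subrr addr0 -mulr2n.
have half (c : k) : c = (2%:R)^-1 * (c *+ 2).
  by rewrite -[c *+ 2]mulr_natr mulrCA mulVf // mulr1.
by split; exact: half.
Qed.

Lemma lin_T : linear (fun x : H => ap (ap x)). Proof. by lin. Qed.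

Lemma regular_char_T x : regular_char (T x) = regular_char x.
Proof.
rewrite /regular_char.
transitivity (trf (fun y => T (x * T y))).
  by apply: eq_trf => y; rewrite !antipodeM antipode4.
rewrite (@trf_comp _ _ _ (fun y => x * T y) (fun y => T y)); try lin.
by apply: eq_trf => y; rewrite antipode4.
Qed.

Lemma regular_char_integral : regular_char L = 1.
Proof.
rewrite /regular_char; under eq_trf => x do rewrite (right_integral intL).
by rewrite trf_rank1 ?intL.2 //; lin.
Qed.

(* [H (x) H] is a free [H]-module of rank [dim H]. *)
Lemma regular_char_sq (h : H) :
  sw (fun a b : H => regular_char a * regular_char b : k^o) h =
  (\dim {:H})%:R * regular_char h.
Proof.
have lr := @lin_regular_char k H.
(* The Galois map, with inverse [psi]: it turns multiplication by [h] on the first factor into the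
   diagonal action on the tensor square. *)
pose phi : tensor H H -> tensor H H := tlift (fun x y => sw (fun a b => tens a (b * y)) x).
pose psi : tensor H H -> tensor H H :=
  tlift (fun x y => sw (fun a b => tens a (ap b * y)) x).
have lphi : linear phi by exact: lin_tlift.
have lpsi : linear psi by exact: lin_tlift.
have phiE x y : phi (tens x y) = sw (fun a b => tens a (b * y)) x.
  by rewrite /phi tlift_tens //; lin.
have psiE x y : psi (tens x y) = sw (fun a b => tens a (ap b * y)) x.
  by rewrite /psi tlift_tens //; lin.
have pp t : phi (psi t) = t.
  move: t; apply: tensor_ext; [exact: (lin_comp lphi lpsi) | exact: lin_id |].
  move=> x y; rewrite psiE lin_swE //; under eq_sw => a b do rewrite phiE.
  rewrite (swA (F := fun a1 a2 b => tens a1 (a2 * (ap b * y)))); try lin.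
  under eq_sw => a b.
    under eq_sw => u v do rewrite mulrA.
    rewrite (sw_apr (f := fun z => tens a (z * y))); last lin.
    rewrite mul1r; over.
  by rewrite (sw_epsr (f := fun a => tens a y)) //; lin.
have qq t : psi (phi t) = t.
  move: t; apply: tensor_ext; [exact: (lin_comp lpsi lphi) | exact: lin_id |].
  move=> x y; rewrite phiE lin_swE //; under eq_sw => a b do rewrite psiE.
  rewrite (swA (F := fun a1 a2 b => tens a1 (ap a2 * (b * y)))); try lin.
  under eq_sw => a b.
    under eq_sw => u v do rewrite mulrA.
    rewrite (sw_apl (f := fun z => tens a (z * y))); last lin.
    rewrite mul1r; over.
  by rewrite (sw_epsr (f := fun a => tens a y)) //; lin.
have dE x y : tmul (comul h) (phi (tens x y)) = phi (tens (h * x) y).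
  rewrite !phiE sw_mul; last by lin.
  rewrite /tmul -/(sw _ h); apply: eq_sw => a b; rewrite -/(sw _ x).
  rewrite lin_swE; last by exact: lin_tlift.
  by apply: eq_sw => c d; rewrite tlift_tens ?mulrA //; lin.
have E1 t : phi (tmap (fun x => h * x) id t) = tmul (comul h) (phi t).
  move: t; apply: tensor_ext.
  - by apply: (lin_comp lphi); exact: lin_tlift.
  - by apply: (lin_comp (@lin_tmul_r _ _ _)); exact: lphi.
  by move=> x y; rewrite dE /tmap tlift_tens //; split=> v; lin.
have lG : linear (fun t : tensor H H => tmul (comul h) t) by exact: lin_tmul_r.
have lF : linear (tmap (fun x => h * x) (id : H -> H)) by exact: lin_tlift.
have -> : (\dim {:H})%:R * regular_char h = trf (fun t : tensor H H => tmul (comul h) t).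
  rewrite -(trf_id H) mulrC -trf_tens; [|lin|exact: lin_id].
  transitivity (trf (fun t => psi (tmul (comul h) (phi t)))).
    by apply: eq_trf => t; rewrite -E1 qq.
  rewrite (@trf_comp _ _ _ (fun t => tmul (comul h) (phi t)) psi) //; last first.
    exact: (lin_comp lG lphi).
  by apply: eq_trf => t; rewrite pp.
symmetry; transitivity (sw (fun a b => trf (tmap (fun x : H => a * x) (fun x : H => b * x))) h).
  transitivity (trf (fun t => \sum_i \sum_j
      comul h i j *: tmap (fun x : H => bvec i * x) (fun x : H => bvec j * x) t)).
    apply: eq_trf => t; rewrite {1}(tensE (comul h)) (lin_sum _ _ (@lin_tmul_l _ _ t)).
    apply: eq_bigr => i _; rewrite (lin_sum _ _ (@lin_tmul_l _ _ t)).
    apply: eq_bigr => j _; rewrite (lin_scale _ _ (@lin_tmul_l _ _ t)); congr (_ *: _).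
    by rewrite /tmul tlift_tens //; lin.
  rewrite trf_sum; apply: eq_bigr => i _; rewrite trf_sum; apply: eq_bigr => j _.
  by rewrite trfZ.
by apply: eq_sw => a b; rewrite trf_tens //; lin.
Qed.

End LarsonRadford.

(** * The antipode is an involution *)

Section AntipodeInvolution.
Variables (k : closedFieldType) (H : hopfAlgType k).
Hypothesis char_k : [pchar k] =i pred0.
Variables (L : H) (intL : norm_integral L).
Local Notation "a *: v" := (@GRing.scale k _ a v) : ring_scope.
Let ll := @lin_lam k H.
Let lr := @lin_regular_char k H.
Let S4 := antipode4 char_k intL.
Local Notation N := (\dim {:H}).

Let N0 : (N%:R : k) != 0.
Proof.
rewrite natr_eq0 // dimv_eq0; apply: contraTneq (memvf (1 : H)) => ->.
by rewrite memv0 oner_eq0.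
Qed.

(** By [regular_char_sq] this is an idempotent of the dual, so [P] below is a projection; it
    commutes with the squared antipode. *)
Let e0 (x : H) : k^o := (N%:R)^-1 * regular_char x.
Let P (x : H) : H := sw (fun a b => e0 b *: a) x.

Let le0 : linear e0. Proof. by apply: (lin_mulr (A := k^o)); exact: lr. Qed.
Let lP : linear P. Proof. exact: lin_sw. Qed.

Let PP x : P (P x) = P x.
Proof.
rewrite {2}/P lin_swE //; under eq_sw => a b.
  rewrite (lin_scale _ _ lP) /P sw_scale; over.
rewrite (swA (F := fun a1 a2 b => e0 b *: (e0 a2 *: a1))); try lin.
apply: eq_sw => a b.
under eq_sw => u v do rewrite scalerA; rewrite -sw_scalel; congr (_ *: _).
rewrite /e0.
under eq_sw => u v do rewrite mulrACA [regular_char v * _]mulrC.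
rewrite -(@sw_mulr _ _ k^o) regular_char_sq mulrA.
by rewrite -(mulrA (N%:R^-1)) mulVf // mulr1.
Qed.

Let PT x : P (ap (ap x)) = ap (ap (P x)).
Proof.
rewrite /P !sw_ap; try lin.
rewrite [in RHS]lin_swE; last by lin.
rewrite [in RHS]lin_swE; last by lin.
apply: eq_sw => a b; rewrite /e0 (regular_char_T char_k intL).
by rewrite ![ap (_ *: _)]linearZ.
Qed.

Let lQ : linear (fun x => ap (ap (P x))). Proof. by lin. Qed.

Let trQ : trf (fun x => ap (ap (P x))) = (N%:R)^-1 * lam (1 : H).
Proof.
rewrite (trf_lam intL) //.
transitivity (sw (fun u c => sw (fun a b =>
    e0 c * lam (ap (ap (ap (ap a * b)))) : k^o) u) L).
  rewrite (swA (F := fun a b c => e0 c * lam (ap (ap (ap (ap a * b)))) : k^o)); try lin.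
  apply: eq_sw => a b; rewrite {1}/P.
  rewrite (@lin_swE _ _ _ _ _ (fun x => lam (ap (ap (ap x)) * a) : k^o)); last by lin.
  apply: eq_sw => c d; rewrite !linearZ -scalerAl (lin_scale _ _ ll).
  by rewrite 3!antipodeM S4.
under eq_sw => u c.
  rewrite -(@sw_mulr _ _ k^o) (sw_apl (f := fun z => lam (ap (ap (ap z))) : k^o)); last lin.
  rewrite !antipode1 mulrC; over.
have -> : (N%:R)^-1 * lam (1 : H) = e0 L * lam (1 : H).
  by rewrite /e0 (regular_char_integral intL) mulr1.
rewrite -(sw_epsl (f := e0)) // (@sw_mull _ _ k^o).
by apply: eq_sw => a b; exact: mulrAC.
Qed.

(** Let [T] be the squared antipode, an involution with eigenvalue multiplicities [r] and [s], so
    [r + s = N]. By [trQ] its trace [r - s] is [N] times the trace of [T] composed with [P], an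
    integer, and it is not zero. Hence [r] or [s] vanishes and [T] is plus or minus the identity; it
    fixes 1. *)
Lemma antipode2 x : ap (ap x) = x :> H.
Proof.
have lT := @lin_T k H.
have [n [m [trQE _]]] : exists n m : nat, trf (fun x => ap (ap (P x))) = n%:R - m%:R /\
    trf (fun x => ap (ap (P (ap (ap (P x)))))) = n%:R + m%:R.
  by apply: trf_involution => // y; rewrite !PT S4 !PP.
have [r [s [trT trTT]]] : exists r s : nat, trf (fun x : H => ap (ap x)) = r%:R - s%:R /\
    trf (fun x : H => ap (ap (ap (ap x)))) = r%:R + s%:R.
  by apply: (trf_involution char_k (f := fun x : H => ap (ap x))) => // y; rewrite S4.
have lamT : lam (1 : H) = trf (fun x : H => ap (ap x)).
  by apply: eq_trf => y; rewrite mulr1.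
have rs : (r + s)%N = N.
  apply: (natr_inj0 char_k); rewrite /= natrD -trTT -trf_id.
  by apply: eq_trf => y; rewrite S4.
have E : (r + N * m = s + N * n)%N.
  apply: (natr_inj0 char_k); rewrite /= !natrD !natrM.
  have : r%:R - s%:R = N%:R * (n%:R - m%:R) :> k.
    by rewrite -trT -lamT -trQE trQ mulrA mulfV // mul1r.
  move/eqP; rewrite mulrBr subr_eq => /eqP->.
  by rewrite addrAC subrK addrC.
have nrs : r != s.
  apply: contraNneq (lam1_neq0 char_k intL) => rE.
  by rewrite lamT trT rE subrr.
have [c c1 cT] : exists2 c : k, c * c = 1 & trf (fun x : H => ap (ap x)) = c * N%:R.
  have [lt|le] := ltnP m n.
    exists 1; rewrite ?mul1r // trT.
    have leN : (N * m + N <= N * n)%N by rewrite -mulnSr leq_mul2l lt orbT.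
    have s0 : s = 0%N by move: E rs leN; generalize N => M; generalize (M * m)%N (M * n)%N; lia.
    rewrite -rs s0 addn0.
    by rewrite subr0.
  exists (-1); rewrite ?mulrNN ?mul1r // trT.
  have neq : n != m.
    by apply: contraNneq nrs => nm; move: E; rewrite nm => /eqP; rewrite eqn_add2r.
  have leN : (N * n + N <= N * m)%N.
    by rewrite -mulnSr leq_mul2l ltn_neqAle neq le orbT.
  have r0 : r = 0%N by move: E rs leN; generalize N => M; generalize (M * m)%N (M * n)%N; lia.
  by rewrite -rs r0 sub0r mulN1r.
have h2 : (2%:R : k) != 0 by rewrite natr_eq0.
have half (v : H) : (2%:R)^-1 *: (v + v) = v.
  by rewrite -mulr2n -scaler_nat scalerA mulVf // scale1r.
(* The projection onto the eigenspace of [T] for [- c]; its trace is zero, hence so is its rank. *)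
pose F (y : H) := (2%:R)^-1 *: (y - c *: ap (ap y)).
have lF : linear F by rewrite /F; lin.
have FF y : F (F y) = F y.
  rewrite {1}/F (_ : c *: ap (ap (F y)) = - F y) ?opprK ?half //.
  have TF : ap (ap (F y)) = (2%:R)^-1 *: (ap (ap y) - c *: y).
    have TZ a (v : H) : ap (ap (a *: v)) = a *: ap (ap v) by exact: (lin_scale a v lT).
    by rewrite /F TZ (lin_mapB y (c *: ap (ap y)) lT) TZ S4.
  rewrite TF scalerA mulrC -scalerA scalerBr scalerA c1 scale1r.
  by rewrite /F -scalerN opprB.
have : trf F = (\dim (limg (linfun F)))%:R.
  apply: trf_proj => // [y|y]; first by rewrite -(linfunP lF) memv_img ?memvf.
  by case/memv_imgP => z _ ->; rewrite linfunP.
have -> : trf F = 0.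
  rewrite /F trfZ trfD trf_id (eq_trf (g := fun y : H => (- c) *: ap (ap y))).
    by rewrite trfZ cT mulrA mulNr c1 mulN1r subrr mulr0.
  by move=> y; rewrite scaleNr.
move=> /esym/eqP; rewrite natr_eq0 // dimv_eq0 => /eqP F0.
have Fx y : F y = 0.
  by apply/eqP; rewrite -memv0 -F0 -(linfunP lF) memv_img ?memvf.
have cE (y : H) : y = c *: ap (ap y).
  have /eqP := Fx y; rewrite /F scaler_eq0 invr_eq0 (negPf h2) subr_eq0.
  by move/eqP.
have -> : ap (ap x) = 1 *: ap (ap x) by rewrite scale1r.
suff -> : 1 = c by rewrite -cE.
have /eqP := cE 1; rewrite !antipode1 -subr_eq0 -{1}[1]scale1r -scalerBl.
by rewrite scaler_eq0 oner_eq0 orbF subr_eq0 => /eqP.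
Qed.

End AntipodeInvolution.

(** * Consequences of the involution: symmetry of [lam] and of [L] *)

Section SymmetricIntegral.
Variables (k : closedFieldType) (H : hopfAlgType k).
Hypothesis char_k : [pchar k] =i pred0.
Variables (L : H) (intL : norm_integral L).
Local Notation "a *: v" := (@GRing.scale k _ a v) : ring_scope.
Implicit Types (W : vectType k) (x y h : H) (f g : dual H).
Let S2 := antipode2 char_k intL.
Let vnH : vn_regular H := integral_vn_regular intL.
Local Notation N := (\dim {:H}).
Let ll := @lin_lam k H.

Lemma dim_neq0 : (N%:R : k) != 0.
Proof.
rewrite natr_eq0 // dimv_eq0; apply: contraTneq (memvf (1 : H)) => ->.
by rewrite memv0 oner_eq0.
Qed.

Lemma sw_apl' W (f : H -> W) x :
  linear f -> sw (fun a b => f (ap b * a)) x = eps x *: f 1.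
Proof.
move=> lf; transitivity (sw (fun a b => f (ap (ap a * b))) x).
  by apply: eq_sw => a b; rewrite antipodeM S2.
by rewrite (sw_apl (f := fun z => f (ap z))) ?antipode1 //; lin.
Qed.

Lemma sw_apr' W (f : H -> W) x :
  linear f -> sw (fun a b => f (b * ap a)) x = eps x *: f 1.
Proof.
move=> lf; transitivity (sw (fun a b => f (ap (a * ap b))) x).
  by apply: eq_sw => a b; rewrite antipodeM S2.
by rewrite (sw_apr (f := fun z => f (ap z))) ?antipode1 //; lin.
Qed.

Lemma lam_regular h : lam h = regular_char h.
Proof.
have [I [e sys]] := idem_system_exists vnH.
rewrite (regular_charE sys) /lam.
rewrite (eq_trf (g := fun x : H => 1 * x * h)) => [|x]; last by rewrite S2 mul1r.
by rewrite (trf_sandwich sys); apply: eq_bigr => i _; rewrite (irr1 sys).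
Qed.

Lemma lamC x y : lam (x * y) = lam (y * x).
Proof. by rewrite !lam_regular regular_charC. Qed.

Lemma lam_swr W (f : H -> W) h :
  linear f -> sw (fun a b => lam b *: f a) h = lam h *: f 1.
Proof. by move=> lf; rewrite (sw_dgl intL) // (dgl1 char_k intL). Qed.

Lemma lam_ap h : lam (ap h) = lam h.
Proof. by rewrite (lam_antipode intL) (dgl1 char_k intL) mul1r. Qed.

Lemma lam1 : lam (1 : H) = N%:R.
Proof.
rewrite -trf_id /lam; apply: eq_trf => x; by rewrite mulr1 S2.
Qed.

(** The action of the dual on [H]. It realises functionals as operators commuting with the left
    coaction, whose traces, kernels and images can be used. *)
Definition hit f x : H := sw (fun a b => f b *: a) x.

Lemma lin_hit f : linear (hit f). Proof. exact: lin_sw. Qed.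

Lemma lin_hitl x : linear (fun f => hit f x). Proof. by rewrite /hit; lin. Qed.

Lemma hitM f g x : hit (f * g) x = hit f (hit g x).
Proof.
rewrite /hit lin_swE; last by lin.
transitivity (sw (fun a b => sw (fun c d => (g b * f d) *: c) a) x); last first.
  by apply: eq_sw => a b; rewrite (lin_scale _ _ (lin_sw _)) sw_scale; apply: eq_sw
    => c d; rewrite scalerA.
rewrite (swA (F := fun c d b => (g b * f d) *: c)); try lin.
apply: eq_sw => a b; rewrite dmulE -/(sw _ b) sw_scalel.
by apply: eq_sw => c d; rewrite mulrC.
Qed.

Lemma counit_hit f x : eps (hit f x) = f x.
Proof.
rewrite /hit lin_swE; last by lin.
rewrite -(sw_epsl (f := f)); last by lin.
by apply: eq_sw => a b; rewrite linearZ; exact: mulrC.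
Qed.

Lemma hit_inj f g : (forall x, hit f x = hit g x) -> f = g.
Proof. by move=> E; apply/lfunP => x; rewrite -(counit_hit f) -(counit_hit g) E. Qed.

(** Up to the factor [N], evaluation at [L] is the regular character of the dual. *)
Lemma trf_hit f : trf (hit f) = N%:R * f L.
Proof.
rewrite (trf_lam intL (@lin_hit f)).
transitivity (sw (fun u c => sw (fun a b => f c * lam (ap b * a) : k^o) u) L).
  rewrite (swA (F := fun a b c => f c * lam (ap b * a) : k^o)); try lin.
  apply: eq_sw => a b; rewrite {1}/hit.
  rewrite (@lin_swE _ _ _ _ _ (fun x => lam (ap x * a) : k^o)); last by lin.
  by apply: eq_sw => c d; rewrite linearZ -scalerAl (lin_scale _ _ ll).
under eq_sw => u c.
  rewrite -(@sw_mulr _ _ k^o) (sw_apl' (f := fun z => lam z : k^o)); last by lin.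
  rewrite lam1; over.
rewrite -[in RHS](sw_epsl (f := f)); last by lin.
rewrite (@sw_mulr _ _ k^o); apply: eq_sw => a b.
by rewrite [LHS]mulrC -[LHS]mulrA [RHS]mulrCA.
Qed.

(** [N * (f * g) L] is the trace of [hit f] composed with [hit g], which is symmetric in [f] and
    [g]. *)
Lemma integral_cocomm W (F : H -> H -> W) :
  bilin F -> sw F L = sw (fun a b => F b a) L.
Proof.
move=> bF; suff E : comul L = sw (fun a b => tens b a) L.
  rewrite /sw [in LHS]E [LHS]lin_swE; last by lin.
  by apply: eq_sw => a b; rewrite tlift_tens.
apply: tensor_sep => f' g'; pose f : dual H := f'; pose g : dual H := g'.
rewrite [RHS]lin_swE; last by lin.
have E : N%:R * (f * g) L = N%:R * (g * f) L.
  rewrite -!trf_hit; under eq_trf => x do rewrite hitM.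
  rewrite trf_comp; try exact: lin_hit.
  by apply: eq_trf => x; rewrite hitM.
have {}E := mulfI dim_neq0 E.
rewrite -[LHS](dmulE f g) E dmulE; apply: eq_sw => a b.
by rewrite tlift_tens 1?mulrC //; lin.
Qed.

Definition dual_basis_elt f : H := sw (fun a b => f a *: ap b) L.

Lemma dual_basis_eltP f y : lam (dual_basis_elt f * y) = f y.
Proof.
rewrite /dual_basis_elt sw_mull (@lin_swE _ _ _ _ _ (fun x => lam x : k^o)); last by lin.
transitivity (sw (fun a b => f b * lam (ap y * a) : k^o) L).
  rewrite (integral_cocomm (F := fun a b => f b * lam (ap y * a) : k^o)); last by lin.
  have E a b : lam (f a *: ap b * y) = f a * lam (ap y * b).
    by rewrite -scalerAl (lin_scale _ _ ll); congr (_ * _);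
      rewrite -[in RHS]lam_ap antipodeM S2.
  exact: (eq_sw (W := k^o) L E).
rewrite -[in RHS](lam_dual_basis intL y) lin_swE; last by lin.
have E a b : f b * lam (ap y * a) = f (lam (ap y * a) *: b).
  by rewrite linearZ; exact: mulrC.
exact: (eq_sw (W := k^o) L E).
Qed.

Definition tracial f := forall x y, f (x * y) = f (y * x).

Lemma dual_basis_elt_central f x :
  tracial f -> dual_basis_elt f * x = x * dual_basis_elt f.
Proof.
move=> tf; apply/eqP; rewrite -subr_eq0; apply/eqP/(lam_nondeg intL) => y.
rewrite mulrBr (lin_mapB _ _ ll).
have -> : lam (y * (dual_basis_elt f * x)) = f (x * y).
  by rewrite lamC -mulrA dual_basis_eltP.
have -> : lam (y * (x * dual_basis_elt f)) = f (y * x).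
  by rewrite mulrA lamC dual_basis_eltP.
by rewrite tf subrr.
Qed.

End SymmetricIntegral.

(** * The character ring and its orthogonality relations *)

Section CharacterRing.
Variables (k : closedFieldType) (H : hopfAlgType k).
Hypothesis char_k : [pchar k] =i pred0.
Variables (L : H) (intL : norm_integral L).
Local Notation "a *: v" := (@GRing.scale k _ a v) : ring_scope.
Implicit Types (W : vectType k) (x y h : H) (f g : dual H).
Let S2 := antipode2 char_k intL.
Local Notation N := (\dim {:H}).
Variables (I : finType) (e : I -> H).
Hypothesis sys : idem_system e.

Let ee i : e i * e i = e i. Proof. by have [/(_ i)[]] := sys. Qed.

Definition chi (i : I) : dual H := linfun (irr e i : H -> k^o).

Lemma chiE i x : chi i x = irr e i x.
Proof. by rewrite linfunP //; exact: lin_irr. Qed.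

Lemma tracial_chi i : tracial (chi i).
Proof. by move=> x y; rewrite !chiE irrC. Qed.

Lemma tracial_expand f : tracial f -> f = \sum_i f (e i) *: chi i.
Proof.
move=> tf; apply/lfunP => x; rewrite sum_lfunE.
rewrite (trace_fun_expand sys (f := f)); last by split=> //; lin.
by apply: eq_bigr => i _; rewrite scale_lfunE chiE.
Qed.

Lemma chi_e i j : chi i (e j) = (i == j)%:R.
Proof. by rewrite chiE (irr_e sys). Qed.

Lemma tracialM f g : tracial f -> tracial g -> tracial (f * g).
Proof.
move=> tf tg x y; rewrite !dmulE -!/(sw _ _) !sw_mul; try lin.
rewrite swC; apply: eq_sw => a b; apply: eq_sw => c d.
by rewrite tf tg.
Qed.

Lemma tracial_ap f : tracial f -> tracial (ap f : dual H).
Proof. by move=> tf x y; rewrite !dual_antipodeE !antipodeM tf. Qed.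

(** Stands for being the character of a module: natural values at idempotents give natural
    coefficients on the irreducible characters. *)
Definition natchar f :=
  tracial f /\ forall u, u * u = u -> exists n : nat, f u = n%:R.

Lemma natchar_chi i : natchar (chi i).
Proof.
by split=> [|u uu]; [exact: tracial_chi | rewrite chiE; apply: irr_idem sys _ _ uu].
Qed.

Lemma natchar_ap f : natchar f -> natchar (ap f : dual H).
Proof.
case=> tf nf; split=> [|u uu]; first exact: tracial_ap.
by rewrite dual_antipodeE; apply: nf; rewrite -antipodeM uu.
Qed.

Lemma natchar_coef f : natchar f -> exists c : I -> nat, f = \sum_i (c i)%:R *: chi i.
Proof.
case=> tf nf; have /choice[c cE] : forall i, exists n : nat, f (e i) = n%:R.
  by move=> i; apply: nf; rewrite ee.
exists c; rewrite {1}(tracial_expand tf); apply: eq_bigr => i _.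
by rewrite cE.
Qed.

(* On an idempotent the product of two irreducible characters is the trace of
   an idempotent operator of [H (x) H]. *)
Lemma natchar_chiM i j : natchar (chi i * chi j).
Proof.
split=> [|u uu]; first by apply: tracialM; exact: tracial_chi.
have lt : linear (fun s : tensor H H => tmul s (tens (e i) (e j))).
  exact: lin_tmul_l.
have ld s : linear (fun t : tensor H H => tmul s t) by exact: lin_tmul_r.
pose F (s t : tensor H H) := tmul (tmul s t) (tens (e i) (e j)).
have lF s : linear (F s) by exact: (lin_comp lt (ld s)).
have lF' t : linear (fun s => F s t).
  by apply: (lin_comp lt); exact: lin_tmul_l.
have trF : (chi i * chi j) u = trf (F (comul u)).
  rewrite dmulE; transitivity (sw (fun a b =>
      trf (tmap (fun x : H => a * x * e i) (fun x : H => b * x * e j))) u).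
    by apply: eq_sw => a b; rewrite trf_tens ?chiE //; lin.
  transitivity (trf (fun t => \sum_l \sum_l' comul u l l' *:
     tmap (fun x : H => bvec l * x * e i) (fun x : H => bvec l' * x * e j) t)).
    rewrite trf_sum; apply: eq_bigr => l _; rewrite trf_sum; apply: eq_bigr => l' _.
    by rewrite trfZ.
  apply: eq_trf => t; rewrite {2}(tensE (comul u)) (lin_sum _ _ (lF' t)).
  apply: eq_bigr => l _; rewrite (lin_sum _ _ (lF' t)); apply: eq_bigr => l' _.
  rewrite (lin_scale _ _ (lF' t)); congr (_ *: _).
  move: t; apply: tensor_ext; [exact: lin_tlift | exact: lF |] => x y.
  rewrite /F !tmul_tens /tmap tlift_tens //.
  by split=> v; lin.
have tA (s t r : tensor H H) : tmul s (tmul t r) = tmul (tmul s t) r.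
  move: s; apply: tensor_ext; first exact: lin_tmul_l.
    by apply: lin_comp; exact: lin_tmul_l.
  move=> a b; move: t; apply: tensor_ext.
  - by apply: (lin_comp (@lin_tmul_r _ _ _)); exact: lin_tmul_l.
  - by apply: (lin_comp (@lin_tmul_l _ _ _)); exact: lin_tmul_r.
  move=> c d; move: r; apply: tensor_ext.
  - by apply: (lin_comp (@lin_tmul_r _ _ _)); exact: lin_tmul_r.
  - exact: lin_tmul_r.
  by move=> p q; rewrite !tmul_tens !mulrA.
rewrite trF; apply: trf_idem => // t; rewrite /F !tA -comulM uu.
by rewrite -!tA tmul_tens !ee.
Qed.

Lemma natcharD f g : natchar f -> natchar g -> natchar (f + g).
Proof.
move=> [tf nf] [tg ng]; split=> [x y|u uu]; first by rewrite !add_lfunE tf tg.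
have [n E] := nf u uu; have [m E'] := ng u uu.
by exists (n + m)%N; rewrite add_lfunE E E' natrD.
Qed.

Lemma natchar_sum (J : Type) (r : seq J) (c : J -> nat) (F : J -> dual H) :
  (forall j, natchar (F j)) -> natchar (\sum_(j <- r) (c j)%:R *: F j).
Proof.
move=> nF; elim: r => [|j r IH].
  rewrite big_nil; split=> [x y|u _]; first by rewrite !zero_lfunE.
  by exists 0%N; rewrite zero_lfunE.
rewrite big_cons; apply: natcharD => //; have [tF nFj] := nF j.
split=> [x y|u uu]; first by rewrite !scale_lfunE tF.
have [n E] := nFj u uu; exists (c j * n)%N.
by rewrite scale_lfunE E natrM.
Qed.

Lemma natcharM f g : natchar f -> natchar g -> natchar (f * g).
Proof.
move=> /natchar_coef[c ->] /natchar_coef[d ->].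
rewrite mulr_suml; under eq_bigr => i _ do rewrite -scalerAl.
apply: natchar_sum => i; rewrite mulr_sumr; under eq_bigr => j _ do rewrite -scalerAr.
by apply: natchar_sum => j; exact: natchar_chiM.
Qed.

(** The element [b] representing [chi i] through [lam] is central. If it acts on the module [j] by
    [c], both [chi j b] and [chi i (e j) = lam (b * e j)] equal [c] times the degree of [j]. *)
Lemma chi_pairing i j : (chi i * ap (chi j)) L = (i == j)%:R.
Proof.
have lr := @lin_regular_char k H.
rewrite dmulE; pose b := dual_basis_elt L (chi i).
transitivity (chi j b).
  rewrite /b /dual_basis_elt lin_swE; last by lin.
  by apply: eq_sw => x y; rewrite dual_antipodeE linearZ.
have bC x : b * x = x * b by apply: (dual_basis_elt_central char_k intL); exact: tracial_chi.
have /choice[c cE] := fun l => central_scalar sys l bC.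
have := dual_basis_eltP char_k intL (chi i) (e j); rewrite -/b.
rewrite (lam_regular char_k intL) (regular_charE sys) (bigD1 j) //= big1 ?addr0.
  rewrite (irr_central _ (cE j)) (irr_e sys) eqxx mulr1 chi_e => <-.
  by rewrite chiE -[b]mulr1 (irr_central _ (cE j)) (irr1 sys) mulrC.
move=> l lj; rewrite (irr_central _ (cE l)) (irr_e sys) (negPf lj).
by rewrite !mulr0.
Qed.

Lemma pairing_cocomm f g : (f * g) L = (g * f) L.
Proof.
rewrite !dmulE -!/(sw _ L) (integral_cocomm char_k intL (F := fun a b => f a * g b : k^o)).
  by apply: eq_sw => a b; rewrite mulrC.
by lin.
Qed.

Lemma chi_ap_pairing i j : (ap (chi i) * chi j) L = (i == j)%:R.
Proof. by rewrite pairing_cocomm chi_pairing eq_sym. Qed.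

Lemma tracial_pairing f : tracial f -> f = \sum_i (ap (chi i) * f) L *: chi i.
Proof.
move=> tf; rewrite {1}(tracial_expand tf); apply: eq_bigr => i _; congr (_ *: _).
rewrite {2}(tracial_expand tf) mulr_sumr sum_lfunE (bigD1 i) //= big1 ?addr0.
  by rewrite -scalerAr scale_lfunE chi_ap_pairing eqxx; exact/esym/mulr1.
move=> j ji; rewrite -scalerAr scale_lfunE chi_ap_pairing eq_sym (negPf ji).
exact: mulr0.
Qed.

Lemma tracial_pairing' f : tracial f -> f = \sum_i (chi i * f) L *: ap (chi i).
Proof.
move=> tf; have tS : tracial (ap f : dual H) by exact: tracial_ap.
have SS g : ap (ap g) = g :> dual H.
  by apply/lfunP => x; rewrite !dual_antipodeE S2.
rewrite -{1}[f]SS {1}(tracial_pairing tS) linear_sum; apply: eq_bigr => i _.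
rewrite linearZ /=; congr (_ *: _); rewrite -antipodeM dual_antipodeE.
by rewrite (antipode_integral intL) pairing_cocomm.
Qed.

End CharacterRing.

(** * The adjoint action and Yetter-Drinfeld submodules *)

Section YetterDrinfeldSubspaces.
Variables (k : closedFieldType) (H : hopfAlgType k).
Hypothesis char_k : [pchar k] =i pred0.
Variables (L : H) (intL : norm_integral L).
Local Notation "a *: v" := (@GRing.scale k _ a v) : ring_scope.
Implicit Types (W : vectType k) (x y h : H) (f g : dual H) (X Y : {vspace H}).
Let S2 := antipode2 char_k intL.
Local Notation N := (\dim {:H}).
Let ll := @lin_lam k H.

Definition ad h x : H := sw (fun a b => a * x * ap b) h.
Definition lhit f x : H := sw (fun a b => f a *: b) x.

(* Stability under the left coaction and the adjoint action: the
   Yetter-Drinfeld submodules of [H]. *)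
Definition dsub X :=
  (forall f x, x \in X -> lhit f x \in X) /\ (forall h x, x \in X -> ad h x \in X).

Lemma lin_ad h : linear (ad h). Proof. by rewrite /ad; lin. Qed.
Lemma lin_adl x : linear (fun h => ad h x). Proof. exact: lin_sw. Qed.
Lemma lin_lhit f : linear (lhit f). Proof. exact: lin_sw. Qed.

Lemma ad1 x : ad 1 x = x.
Proof. by rewrite /ad sw_one ?antipode1 ?mul1r ?mulr1 //; lin. Qed.

Lemma adM h h' x : ad (h * h') x = ad h (ad h' x).
Proof.
rewrite /ad sw_mul; last by lin.
apply: eq_sw => a b; rewrite sw_mulr sw_mull; apply: eq_sw => c d.
by rewrite antipodeM !mulrA.
Qed.

Lemma counit_ad h x : eps (ad h x) = eps h * eps x.
Proof.
rewrite /ad lin_swE; last by lin.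
transitivity (sw (fun a b => eps b *: (eps a * eps x : k^o)) h).
  apply: eq_sw => a b; rewrite !counitM counit_ap; exact: mulrC.
by rewrite (sw_epsr (f := fun a => eps a * eps x : k^o)) //; lin.
Qed.

Lemma ap_ad h x : sw (fun a b => ap a * ad b x) h = x * ap h.
Proof.
rewrite /ad; under eq_sw => a b do rewrite sw_mulr.
rewrite -(swA (F := fun a u v => ap a * (u * x * ap v))); try lin.
under eq_sw => d v.
  under eq_sw => a u do rewrite !mulrA.
  rewrite (sw_apl (f := fun z => z * x * ap v)); last by lin.
  rewrite mul1r; over.
by rewrite (sw_epsl (f := fun v => x * ap v)) //; lin.
Qed.

Lemma ad_mul h x y : ad h (x * y) = sw (fun a b => ad a x * ad b y) h.
Proof.
have la := lin_adl y.
transitivity (sw (fun a b => sw (fun p q => p * x * ap q * ad b y) a) h); last first.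
  by apply: eq_sw => a b; rewrite -sw_mull.
rewrite (swA (F := fun p q b => p * x * ap q * ad b y)); try lin.
rewrite /ad; apply: eq_sw => p c; rewrite -/(ad _ _).
under [RHS]eq_sw => q b do rewrite -!mulrA.
by rewrite -!sw_mulr ap_ad !mulrA.
Qed.

Lemma mul_ad h x : sw (fun a b => ad a x * b) h = h * x.
Proof.
rewrite /ad; under eq_sw => a b do rewrite sw_mull.
rewrite (swA (F := fun u v b => u * x * ap v * b)); try lin.
under eq_sw => a b.
  under eq_sw => u v do rewrite -mulrA.
  rewrite (sw_apl (f := fun z => a * x * z)); last by lin.
  rewrite mulr1; over.
by rewrite (sw_epsr (f := fun a => a * x)) //; lin.
Qed.

Lemma ad_mulr h x : sw (fun a b => ad a (x * b)) h = h * x.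
Proof.
rewrite /ad (swA (F := fun u v b => u * (x * b) * ap v)); try lin.
under eq_sw => a b.
  under eq_sw => u v do rewrite -!mulrA (mulrA a).
  rewrite (sw_apr' char_k intL (f := fun z => a * x * z)); last by lin.
  rewrite mulr1; over.
by rewrite (sw_epsr (f := fun a => a * x)) //; lin.
Qed.

(** The general term of [hit f (ad h x)] after all coproducts are expanded; [a1], [a2], [b1], [b2]
    are the legs of [h] in order. *)
Let G f x a1 a2 b1 b2 : H :=
  sw (fun x1 x2 => f (a2 * x2 * ap b1) *: (a1 * x1 * ap b2)) x.

Lemma hit_adE f h x : hit f (ad h x) = sw (fun a1 c => sw (fun d b2 =>
  sw (fun a2 b1 => G f x a1 a2 b1 b2) d) c) h.
Proof.
transitivity (sw (fun a b => sw (fun a1 a2 => sw (fun b1 b2 =>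
    G f x a1 a2 b1 b2) b) a) h).
  rewrite /ad lin_swE; last exact: lin_hit.
  apply: eq_sw => a b; rewrite /hit /G sw_mul; last by lin.
  rewrite sw_mul; last by lin.
  apply: eq_sw => a1 a2; rewrite [RHS]swC; apply: eq_sw => x1 x2.
  by rewrite sw_ap; [apply: eq_sw => b1 b2 | lin].
rewrite (swA (F := fun a1 a2 b => sw (fun b1 b2 => G f x a1 a2 b1 b2) b)); try by rewrite /G; lin.
apply: eq_sw => a1 c.
by rewrite -(swA (F := fun a2 b1 b2 => G f x a1 a2 b1 b2)); try by rewrite /G; lin.
Qed.

(** For a tracial [f] the two middle legs of [h] meet cyclically inside [f] and cancel. *)
Lemma hit_ad f h x : tracial f -> hit f (ad h x) = ad h (hit f x).
Proof.
move=> tf; rewrite hit_adE /ad; apply: eq_sw => a1 c.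
transitivity (sw (fun d b2 => eps d *: (a1 * hit f x * ap b2)) c); last first.
  by rewrite (sw_epsl (f := fun b => a1 * hit f x * ap b)) //; lin.
apply: eq_sw => d b2; rewrite /G swC.
under eq_sw => x1 x2.
  under eq_sw => a2 b1 do rewrite tf mulrA.
  rewrite (sw_apl' char_k intL (f := fun z => f (z * x2) *: (a1 * x1 * ap b2)));
    last by lin.
  rewrite mul1r; over.
rewrite -sw_scale; congr (_ *: _); rewrite /hit sw_mulr sw_mull.
by apply: eq_sw => x1 x2; rewrite -scalerAr -scalerAl.
Qed.

(** [hit_adE] shows the outer legs of [y] around an inner expression; multiplication by [ap y_1] and
    [y_3] strips them off. *)
Lemma hit_ad_conj f y h : sw (fun h1 h2 => f (ad y h2) *: h1) h =
  sw (fun u w => sw (fun z v => ap u * hit f (ad z h) * v) w) y.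
Proof.
have la := lin_adl h; have lh := lin_hit f.
pose M d := sw (fun a2 b1 => sw (fun h1 h2 => f (a2 * h2 * ap b1) *: h1) h) d.
have lM : linear M by exact: lin_sw.
transitivity (M y).
  rewrite /M swC; apply: eq_sw => h1 h2; rewrite /ad lin_swE; last by lin.
  by rewrite sw_scalel.
pose R c := sw (fun d b2 => M d * ap b2) c.
have lR : linear R by exact: lin_sw.
have hE z : hit f (ad z h) = sw (fun a1 c => a1 * R c) z.
  rewrite hit_adE; apply: eq_sw => a1 c; rewrite /R sw_mulr; apply: eq_sw => d b2.
  rewrite /M sw_mull sw_mulr; apply: eq_sw => a2 b1.
  rewrite /G sw_mull sw_mulr; apply: eq_sw => h1 h2.
  by rewrite -scalerAl -scalerAr mulrA.
transitivity (sw (fun u w => sw (fun a1 w' => sw (fun c v =>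
     ap u * a1 * (R c * v)) w') w) y); last first.
  apply: eq_sw => u w.
  rewrite -(swA (F := fun a1 c v => ap u * a1 * (R c * v))); try lin.
  apply: eq_sw => z v; rewrite hE sw_mulr sw_mull.
  by apply: eq_sw => a1 c; rewrite !mulrA.
rewrite -(swA (F := fun u a1 w' => sw (fun c v => ap u * a1 * (R c * v)) w')); try lin.
under [RHS]eq_sw => t w'.
  rewrite swC; under eq_sw => c v do
    (rewrite (sw_apl (f := fun z => z * (R c * v))); last lin).
  rewrite -sw_scale; over.
rewrite (sw_epsl (f := fun w' => sw (fun c v => 1 * (R c * v)) w')); last by lin.
rewrite /R; under [RHS]eq_sw => c v do rewrite mul1r sw_mull.
rewrite (swA (F := fun d b v => M d * ap b * v)); try lin.
under [RHS]eq_sw => d t.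
  under eq_sw => b v do rewrite -mulrA.
  rewrite (sw_apl (f := fun z => M d * z)); last by lin.
  rewrite mulr1; over.
by rewrite (sw_epsr (f := M)).
Qed.

(** Averaging the operator [hit f] over the adjoint action gives again a [hit], for the functional
    [f] composed with [ad L]. *)
Lemma hit_ad_integral f h : sw (fun h1 h2 => f (ad L h2) *: h1) h =
  sw (fun z w => ad (ap w) (hit f (ad z h))) L.
Proof.
have la := lin_adl h; have lh := lin_hit f.
rewrite hit_ad_conj.
rewrite (integral_cocomm char_k intL
  (F := fun u w => sw (fun z v => ap u * hit f (ad z h) * v) w)); last by lin.
rewrite (swA (F := fun z v u => ap u * hit f (ad z h) * v)); try lin.
apply: eq_sw => z w; rewrite /ad -/(ad _ _) sw_ap; last by lin.
by apply: eq_sw => v u; rewrite S2.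
Qed.

(** The second leg of the coproduct of an element of a left coideal [X] may be taken in [X]. *)
Lemma dsub_ext W (F F' : H -> H -> W) X x : dsub X -> bilin F -> bilin F' ->
  (forall a b, b \in X -> F a b = F' a b) -> x \in X -> sw F x = sw F' x.
Proof.
move=> [sX _] bF bF' FF xX.
have E (K : H -> H -> W) : bilin K -> sw K x = \sum_i K (bvec i) (lhit (dvec i) x).
  move=> bK; rewrite /sw /tlift; apply: eq_bigr => i _.
  transitivity (K (bvec i) (\sum_j comul x i j *: bvec j)).
    by rewrite (lin_sum _ _ (bK.2 _)); apply: eq_bigr => j _; rewrite (lin_scale _ _ (bK.2 _)).
  congr (K _ _); rewrite /lhit /sw /tlift [RHS](bigD1 i) //= [X in _ + X]big1 ?addr0.
    by apply: eq_bigr => j _; rewrite dvec_coord coord_bvec eqxx scale1r.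
  move=> i' ii; rewrite big1 // => j _.
  by rewrite dvec_coord coord_bvec eq_sym (negPf ii) scale0r scaler0.
by rewrite !E //; apply: eq_bigr => i _; apply: FF; exact: sX.
Qed.

End YetterDrinfeldSubspaces.

(** * Complete reducibility and Schur's lemma *)

Section Projections.
Variables (k : closedFieldType) (H : hopfAlgType k).
Hypothesis char_k : [pchar k] =i pred0.
Variables (L : H) (intL : norm_integral L).
Local Notation "a *: v" := (@GRing.scale k _ a v) : ring_scope.
Implicit Types (W : vectType k) (x y h : H) (f g : dual H) (X Y Z : {vspace H}).
Let S2 := antipode2 char_k intL.
Local Notation N := (\dim {:H}).
Let ll := @lin_lam k H.

Lemma lhit_hit f g x : lhit g (hit f x) = hit f (lhit g x).
Proof.
rewrite {1}/hit [LHS]lin_swE; last by exact: lin_lhit.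
rewrite [lhit g x]/lhit [RHS]lin_swE; last by exact: lin_hit.
under eq_sw => a b do rewrite (lin_scale _ _ (lin_lhit g)) /lhit sw_scale.
under [RHS]eq_sw => a b do rewrite (lin_scale _ _ (lin_hit f)) /hit sw_scale.
rewrite (swA (F := fun u v b => f b *: (g u *: v))); try lin.
by apply: eq_sw => u c; apply: eq_sw => v b; rewrite !scalerA mulrC.
Qed.

Definition hit_ker f : {vspace H} := lker (linfun (hit f)).

Lemma hit_kerP f x : (x \in hit_ker f) = (hit f x == 0).
Proof. by rewrite memv_ker linfunP //; exact: lin_hit. Qed.

Lemma dsub_ker f : tracial f -> dsub (hit_ker f).
Proof.
move=> tf; split=> [g x|h x]; rewrite !hit_kerP => /eqP fx.
  by rewrite -lhit_hit fx (lin_map0 (lin_lhit g)).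
by rewrite (hit_ad char_k intL) // fx (lin_map0 (lin_ad h)).
Qed.

Lemma dsub_cap X Y : dsub X -> dsub Y -> dsub (X :&: Y)%VS.
Proof.
move=> [X1 X2] [Y1 Y2]; split=> [f x|h x]; rewrite !memv_cap => /andP[xX xY].
  by rewrite X1 ?Y1.
by rewrite X2 ?Y2.
Qed.

Lemma dsub_add X Y : dsub X -> dsub Y -> dsub (X + Y)%VS.
Proof.
move=> [X1 X2] [Y1 Y2]; split=> [f _|h _] /memv_addP[x xX [y yY ->]].
  by rewrite (lin_mapD _ _ (lin_lhit f)) memv_add ?X1 ?Y1.
by rewrite (lin_mapD _ _ (lin_ad h)) memv_add ?X2 ?Y2.
Qed.

Lemma dsub0 : dsub (0%VS : {vspace H}).
Proof.
split=> [f x|h x]; rewrite memv0 => /eqP->.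
  by rewrite (lin_map0 (lin_lhit f)) memv0.
by rewrite (lin_map0 (lin_ad h)) memv0.
Qed.

Lemma dsub_full : dsub {:H}.
Proof. by split=> [f x|h x] _; rewrite memvf. Qed.

Lemma memv_mul_lin W (F : H -> W) X Y (Z : {vspace W}) : linear F ->
  (forall x y, x \in X -> y \in Y -> F (x * y) \in Z) ->
  forall u, u \in (X * Y)%VS -> F u \in Z.
Proof.
move=> lF FZ u uXY.
have : (X * Y <= linfun F @^-1: Z)%VS.
  by apply/prodvP => x y xX yY; rewrite -memv_preim linfunP // FZ.
by move/subvP/(_ u uXY); rewrite -memv_preim linfunP.
Qed.

Lemma dsub_mul X Y : dsub X -> dsub Y -> dsub (X * Y)%VS.
Proof.
move=> dX dY; split=> [f|h].
  apply: memv_mul_lin (lin_lhit f) _ => x y xX yY.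
  rewrite /lhit sw_mul; last by lin.
  (* The second legs already lie in [X] and [Y]; inserting projections does not change the sum and
     puts each term in the product space. *)
  pose pX := projv X; pose pY := projv Y.
  have pE a c b : b \in X -> f (a * c) *: (b * b) \in {:H}%VS by rewrite memvf.
  rewrite (dsub_ext (F' := fun a b => sw (fun c d => f (a * c) *: (pX b * pY d)) y) dX)
    //; try lin.
    by apply: memv_sw => a b; apply: memv_sw => c d; rewrite memvZ // memv_mul ?memv_proj.
  move=> a b bX.
  apply: (dsub_ext (F' := fun c d => f (a * c) *: (pX b * pY d)) dY) => //; try lin.
  by move=> c d dY'; rewrite /pX /pY !projv_id.
apply: memv_mul_lin (lin_ad h) _ => x y xX yY.
rewrite ad_mul; apply: memv_sw => a b; apply: memv_mul.
  by case: dX => _; apply.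
by case: dY => _; apply.
Qed.

(** Maschke's averaging on the comodule side: the linear projection onto [X], averaged by the
    cointegral, becomes [hit] of this functional. The factor is the inverse of [lam 1]. *)
Let coproj X h : k^o := sw (fun a b => N%:R^-1 * lam (ap a * projv X b) : k^o) h.

Let lin_coproj X : linear (coproj X). Proof. exact: lin_sw. Qed.

Let coprojE X h : hit (linfun (coproj X)) h =
  sw (fun u v => sw (fun p q => (N%:R^-1 * lam (ap u * p)) *: q) (projv X v)) h.
Proof.
rewrite /hit; under eq_sw => a b do rewrite linfunP // /coproj sw_scalel.
transitivity (sw (fun h1 c => sw (fun a1 c' => sw (fun a2 b => sw (fun p q =>
    (N%:R^-1 * lam (ap a2 * p)) *: (h1 * ap a1 * q)) (projv X b)) c') c) h).
  apply: eq_sw => h1 c.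
  rewrite -(swA (F := fun a1 a2 b => sw (fun p q =>
    (N%:R^-1 * lam (ap a2 * p)) *: (h1 * ap a1 * q)) (projv X b))); try lin.
  (* The scalar [lam (ap a * _)] times 1 is expanded by the cointegral identity; the leg of [ap a]
     that leaves [lam] will cancel [h1]. *)
  apply: eq_sw => a b; rewrite -scalerA -[h1 in LHS]mulr1 scalerAr -lam_sw1.
  rewrite sw_mul; last by lin.
  rewrite sw_ap; last by lin.
  rewrite sw_mulr sw_scale; apply: eq_sw => a1 a2.
  rewrite sw_mulr sw_scale; apply: eq_sw => p q.
  by rewrite -scalerA -scalerAr mulrA.
rewrite -(swA (F := fun h1 a1 c' => sw (fun a2 b => sw (fun p q =>
    (N%:R^-1 * lam (ap a2 * p)) *: (h1 * ap a1 * q)) (projv X b)) c')); try lin.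
under eq_sw => d c'.
  rewrite (sw_apr (f := fun z => sw (fun a2 b => sw (fun p q =>
    (N%:R^-1 * lam (ap a2 * p)) *: (z * q)) (projv X b)) c')); last by lin.
  over.
rewrite (sw_epsl (f := fun c' => sw (fun a2 b => sw (fun p q =>
    (N%:R^-1 * lam (ap a2 * p)) *: (1 * q)) (projv X b)) c')); last by lin.
by apply: eq_sw => a b; apply: eq_sw => p q; rewrite mul1r.
Qed.

(** Two averages: the functional [coproj] gives a projection compatible with the coaction, and
    composing that functional with [ad L] makes the operator compatible with the adjoint action
    while it still projects onto [X]. *)
Lemma dsub_proj X : dsub X -> exists e,
  [/\ tracial e, forall x, hit e x \in X & forall x, x \in X -> hit e x = x].
Proof.
move=> dX; have [X1 X2] := dX; pose f : dual H := linfun (coproj X).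
have N0 := dim_neq0 H char_k.
have fX x : hit f x \in X.
  rewrite /f coprojE; apply: memv_sw => u v.
  have := X1 (linfun (fun p => N%:R^-1 * lam (ap u * p) : k^o)) _ (memv_proj X v).
  rewrite /lhit (eq_sw (g := fun p q => (N%:R^-1 * lam (ap u * p)) *: q)) // => p q.
  by rewrite linfunP //; lin.
have fid x : x \in X -> hit f x = x.
  move=> xX; rewrite /f coprojE.
  rewrite (dsub_ext (F' := fun u v => sw (fun p q => (N%:R^-1 * lam (ap u * p)) *: q) v) dX)
    //; [|lin|lin|by move=> a b bX; rewrite projv_id].
  rewrite -(swA (F := fun u p q => (N%:R^-1 * lam (ap u * p)) *: q)); try lin.
  under eq_sw => d q.
    rewrite (sw_apl (f := fun z => (N%:R^-1 * lam z) *: q)); last by lin.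
    rewrite (lam1 char_k intL) mulVf // scale1r; over.
  by rewrite (sw_epsl (f := id)) //; lin.
have la := lin_ad L; have lf := lin_hom f.
pose e : dual H := linfun (fun h => f (ad L h) : k^o).
have eE h : e h = f (ad L h) by rewrite linfunP //; lin.
have hE h : hit e h = sw (fun z w => ad (ap w) (hit f (ad z h))) L.
  rewrite -(hit_ad_integral char_k intL) /hit.
  by apply: eq_sw => a b; rewrite eE.
exists e; split=> [x y|x|x xX].
- have e_ad h z : e (ad h z) = eps h * e z.
    rewrite !eE -adM (right_integral intL) (lin_scale _ _ (lin_adl z)).
    by rewrite linearZ.
  (* [y * x] is the sum of the [ad y_1 (x * y_2)], so a functional invariant under [ad] is
     tracial. *)
  rewrite -[y * x in RHS](ad_mulr char_k intL) [RHS]lin_swE; last by lin.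
  under eq_sw => a b do rewrite e_ad.
  by rewrite (sw_epsl (f := fun b => e (x * b))) //; lin.
- by rewrite hE; apply: memv_sw => a b; apply: X2; exact: fX.
rewrite hE; under eq_sw => z w do rewrite fid ?X2 // -adM.
rewrite (sw_apl' char_k intL (f := fun u => ad u x)); last exact: lin_adl.
by rewrite intL.2 scale1r ad1.
Qed.

Lemma dim_proj X e : tracial e -> (forall x, hit e x \in X) ->
  (forall x, x \in X -> hit e x = x) -> (\dim X)%:R = N%:R * e L.
Proof.
by move=> te eX eid; rewrite -(trf_hit char_k intL) (trf_proj (lin_hit e) eX eid).
Qed.

Lemma dsub_compl X : dsub X ->
  exists Y, [/\ dsub Y, (X :&: Y)%VS = 0%VS & (X + Y)%VS = {:H}%VS].
Proof.
case/dsub_proj => e [te eX eid]; exists (hit_ker e); split; first exact: dsub_ker.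
  apply/eqP; rewrite -subv0; apply/subvP => x; rewrite memv_cap hit_kerP memv0.
  by case/andP => xX /eqP ex; rewrite -(eid x xX) ex.
apply/vspaceP => x; rewrite memvf -[x](subrK (hit e x)) addrC memv_add // hit_kerP.
by rewrite (lin_mapB _ _ (lin_hit e)) (eid _ (eX x)) subrr.
Qed.

Lemma dsub_compl_in X Z : dsub X -> dsub Z -> (X <= Z)%VS ->
  exists Y, [/\ dsub Y, (X :&: Y)%VS = 0%VS & (X + Y)%VS = Z].
Proof.
move=> dX dZ XZ; have [Y [dY XY0 XYf]] := dsub_compl dX.
exists (Y :&: Z)%VS; split; first exact: dsub_cap.
  by apply/eqP; rewrite -subv0 -XY0 capvA capvSl.
by rewrite vspace_modl // XYf capfv.
Qed.

Definition simple_dsub X := [/\ dsub X, X != 0%VS &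
  forall Y, dsub Y -> (Y <= X)%VS -> Y = 0%VS \/ Y = X].

Lemma simple_sub X : dsub X -> X != 0%VS ->
  exists2 Y, simple_dsub Y & (Y <= X)%VS.
Proof.
have [n] := ubnP (\dim X); elim: n X => // n IH X lt dX X0.
have [sX|/existsNP[Y /not_implyP[dY /not_implyP[YX /not_orP[Y0 YnX]]]]] :=
  pselect (forall Y, dsub Y -> (Y <= X)%VS -> Y = 0%VS \/ Y = X).
  by exists X; rewrite ?subvv.
have ltY : (\dim Y < \dim X)%N.
  rewrite ltn_neqAle dimvS // andbT; apply: contra_notN YnX => /eqP dE.
  by apply/eqP; rewrite eqEdim YX dE leqnn.
have [||| Z sZ ZY] := IH Y; [by apply: leq_trans ltY _ | exact: dY | exact/eqP |].
by exists Z => //; apply: subv_trans YX.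
Qed.

(* Schur's lemma for [X], seen in the character ring. *)
Lemma simple_proj X e : simple_dsub X -> tracial e -> (forall x, hit e x \in X) ->
  (forall x, x \in X -> hit e x = x) -> e * e = e /\
  forall f, tracial f -> exists c : k, e * f * e = c *: e.
Proof.
case=> dX X0 sX te eX eid.
have ee : e * e = e by apply: hit_inj => x; rewrite hitM eid.
split=> // f tf.
have [|x _|//|c [v vX /andP[v0 /eqP vE]]] :=
  @eigen_exists k H X (hit (e * f * e)); first exact: lin_hit.
  by rewrite -mulrA hitM.
exists c; pose g := e * f * e - c *: e.
have ge : g * e = g.
  have E : e * f * e * e = e * f * e by rewrite -[LHS]mulrA ee.
  by rewrite /g mulrBl E -scalerAl ee.
have tg : tracial g.
  move=> x y; rewrite !(add_lfunE, opp_lfunE, scale_lfunE) te.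
  by congr (_ - _); apply: tracialM => //; apply: tracialM.
have gE x : hit g x = hit (e * f * e) x - c *: hit e x.
  by rewrite (lin_mapB _ _ (lin_hitl x)) (lin_scale _ _ (lin_hitl x)).
have [||XE|XE] := sX (X :&: hit_ker g)%VS.
- by apply: dsub_cap => //; exact: dsub_ker.
- exact: capvSl.
- have : v \in (X :&: hit_ker g)%VS.
    by rewrite memv_cap vX hit_kerP gE vE (eid _ vX) subrr eqxx.
  by rewrite XE memv0 (negPf v0).
have g0 : g = 0.
  apply: hit_inj => x; rewrite -ge hitM.
  have : hit e x \in (X :&: hit_ker g)%VS by rewrite XE.
  rewrite memv_cap hit_kerP => /andP[_ /eqP->].
  by rewrite (lin_map0 (lin_hitl x)).
by apply/eqP; rewrite -subr_eq0 -/g g0.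
Qed.

End Projections.

(** * Rational eigenvalues of matrices of natural numbers *)

Section NatEigenvalue.
Variable k : closedFieldType.
Hypothesis char_k : [pchar k] =i pred0.

(** [a / b] is an eigenvalue of an integral matrix, and its characteristic polynomial is monic, so
    the rational root test applies. *)
Lemma nat_eigen_dvd (J : finType) (M : J -> J -> nat) (u : J -> k) j0 (a b : nat) :
  u j0 != 0 -> (0 < b)%N ->
  (forall j, b%:R * (\sum_j' (M j j')%:R * u j') = a%:R * u j) -> (b %| a)%N.
Proof.
move=> u0 b0 uE; pose d := gcdn a b.
have d0 : (0 < d)%N by rewrite gcdn_gt0 b0 orbT.
have [a' aE] : exists a', a = (a' * d)%N by apply/dvdnP; exact: dvdn_gcdl.
have [b' bE] : exists b', b = (b' * d)%N by apply/dvdnP; exact: dvdn_gcdr.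
have cop : coprime b' a'.
  rewrite /coprime -(eqn_pmul2r d0) mul1n muln_gcdl -aE -bE gcdnC.
  by rewrite /d gcdnC.
have b'0 : (0 < b')%N by move: b0; rewrite bE muln_gt0 => /andP[].
have bR : (b'%:R : k) != 0 by rewrite natr_eq0 // -lt0n.
have dR : (d%:R : k) != 0 by rewrite natr_eq0 // -lt0n.
pose n := #|J|; pose A : 'M[int]_n := \matrix_(i, j) (M (enum_val j) (enum_val i))%:Z.
pose c : k := a'%:R / b'%:R.
have ev : eigenvalue (map_mx intr A : 'M[k]_n) c.
  apply/eigenvalueP; exists (\row_i u (enum_val i)).
    apply/rowP => i; rewrite !mxE.
    transitivity (\sum_j' (M (enum_val i) j')%:R * u j').
      rewrite (reindex (@enum_val J J)) /=; last exact: onW_bij (enum_val_bij _).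
      by apply: eq_bigr => j _; rewrite !mxE mulrC -pmulrn.
    have := uE (enum_val i); rewrite aE bE !natrM => E.
    apply: (mulfI (mulf_neq0 bR dR)); rewrite E /c.
    by field.
  apply/eqP => /rowP/(_ (enum_rank j0)); rewrite !mxE enum_rankK => /eqP.
  exact/negP.
move: ev; rewrite eigenvalue_root_char -map_char_poly rootE => /eqP.
set p := char_poly A; have sp : size p = n.+1 by rewrite size_char_poly.
have mp : p`_n = 1.
  by have /monicP := char_poly_monic A; rewrite lead_coefE sp.
rewrite horner_coef size_map_poly_id0; last first.
  by rewrite (monicP (char_poly_monic A)) rmorph1 oner_eq0.
rewrite sp => pc.
have E : \sum_(i < n.+1) p`_i * (a' ^ i)%:Z * (b' ^ (n - i))%:Z = 0 :> int.
  apply/eqP; rewrite -(intr_eq0_char0 char_k) rmorph_sum /=; apply/eqP.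
  transitivity (b'%:R ^+ n * \sum_(i < n.+1) (map_poly intr p)`_i * c ^+ i : k);
    last by rewrite pc mulr0.
  rewrite mulr_sumr; apply: eq_bigr => i _; rewrite coef_map /= !intrM -!pmulrn !natrX.
  have bn : (b'%:R : k) ^+ i != 0 by rewrite expf_neq0.
  have -> : (b'%:R : k) ^+ n = b'%:R ^+ (n - i) * b'%:R ^+ i.
    by rewrite -exprD subnK // leq_ord.
  by rewrite /c expr_div_n; field.
have dv : (b' %| a' ^ n)%N.
  move: E; rewrite big_ord_recr /= mp mul1r subnn expn0 mulr1 => /eqP.
  rewrite addrC addr_eq0 => /eqP E.
  have : (b'%:Z %| (a' ^ n)%:Z)%Z.
    rewrite E rpredN rpred_sum // => i _; apply: dvdz_mull.
    have -> : (n - i)%N = (n - i).-1.+1 by rewrite prednK // subn_gt0.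
    by rewrite expnS PoszM dvdz_mulr.
  by [].
have b1 : b' = 1%N.
  by apply/eqP; rewrite -dvdn1 -(Gauss_dvdr _ (coprimeXr n cop)) muln1.
by rewrite aE bE b1 mul1n dvdn_mull.
Qed.

End NatEigenvalue.

(** * The dimension of a simple Yetter-Drinfeld submodule divides [N] *)

Section ClassEquation.
Variables (k : closedFieldType) (H : hopfAlgType k).
Hypothesis char_k : [pchar k] =i pred0.
Variables (L : H) (intL : norm_integral L).
Local Notation "a *: v" := (@GRing.scale k _ a v) : ring_scope.
Implicit Types (x y h : H) (f g : dual H) (X Y Z : {vspace H}).
Local Notation N := (\dim {:H}).

(* [\sum_i chi_i e (x) ap (chi_i) e] is a multiple of [e (x) e], so [N / \dim X]
   is an eigenvalue of a matrix of natural numbers. *)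
Lemma simple_dim_dvd X : simple_dsub X -> (\dim X %| N)%N.
Proof.
move=> sX; have [dX X0 _] := sX.
have [e [te eX eid]] := dsub_proj char_k intL dX.
have [ee eC] := simple_proj char_k intL sX te eX eid.
have dimX := dim_proj char_k intL te eX eid.
have [I [E sys]] := idem_system_exists (integral_vn_regular intL).
pose ch := chi E.
have tch i : tracial (ch i) by exact: tracial_chi.
have Xpos : (0 < \dim X)%N by rewrite lt0n dimv_eq0.
have eL0 : e L != 0.
  apply/eqP => eL; have /eqP := dimX.
  by rewrite eL mulr0 natr_eq0 // dimv_eq0 (negPf X0).
(* The wanted identity with its second factor paired with [y]. It holds because [e * y] expands on
   the characters and [e * y * e] is a multiple of [e]. *)
have key (y : dual H) : tracial y ->
    \sum_i ((ap (ch i) * e) * y) L *: (ch i * e) = ((e L)^-1 * (e * y) L) *: e.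
  move=> ty; have [t tE] := eC y ty.
  transitivity (e * y * e).
    rewrite [in RHS](tracial_pairing char_k intL sys (f := e * y)); last exact: tracialM.
    by rewrite mulr_suml; apply: eq_bigr => i _; rewrite -scalerAl mulrA.
  rewrite tE; congr (_ *: _).
  have -> : (e * y) L = t * e L.
    rewrite -[in LHS]ee -[in LHS]mulrA (pairing_cocomm char_k intL) tE.
    by rewrite scale_lfunE.
  by rewrite mulrCA mulVf // mulr1.
(* By [key], the difference of the two sides pairs to zero with every tracial functional, and the
   pairing is nondegenerate on these. The eigenvalue is [(e L)^-1 = N / \dim X]. *)
have main x y : \sum_i (ch i * e) x * (ap (ch i) * e) y = (e L)^-1 * (e x * e y).
  pose r : dual H := \sum_i (ch i * e) x *: (ap (ch i) * e) - ((e L)^-1 * e x) *: e.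
  have tr : tracial r.
    move=> u v; rewrite /r !add_lfunE !opp_lfunE !scale_lfunE !sum_lfunE te.
    congr (_ - _); apply: eq_bigr => i _; rewrite !scale_lfunE; congr (_ *: _).
    by apply: tracialM => //; exact: tracial_ap.
  have rz (z : dual H) : tracial z -> (r * z) L = 0.
    move=> tz; rewrite /r mulrBl add_lfunE opp_lfunE mulr_suml sum_lfunE.
    have := congr1 (fun f : dual H => f x) (key z tz); rewrite sum_lfunE scale_lfunE.
    rewrite -scalerAl scale_lfunE => kz; apply/eqP; rewrite subr_eq0; apply/eqP.
    transitivity (\sum_i ((ap (ch i) * e * z) L *: (ch i * e)) x).
      by apply: eq_bigr => i _; rewrite -scalerAl !scale_lfunE; exact: mulrC.
    by rewrite kz; exact: mulrAC.
  have r0 : r = 0.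
    rewrite (tracial_pairing' char_k intL sys tr) big1 // => i _.
    by rewrite (pairing_cocomm char_k intL) rz ?scale0r.
  have := congr1 (fun f : dual H => f y) r0.
  rewrite /r add_lfunE opp_lfunE scale_lfunE sum_lfunE zero_lfunE => /eqP.
  rewrite subr_eq0 => /eqP rE; transitivity (((e L)^-1 * e x) * e y); last by rewrite mulrA.
  by rewrite -[RHS]rE; apply: eq_bigr => i _; rewrite scale_lfunE.
have /choice[n nE] : forall p : I * I * I, exists m : nat,
    (ch p.1.1 * ch p.1.2) (E p.2) = m%:R.
  case=> [[i a] s] /=; have [_] := natchar_chiM sys i a; apply.
  by have [/(_ s)[]] := sys.
have /choice[m mE] : forall p : I * I * I, exists m : nat,
    (ap (ch p.1.1) * ch p.1.2 : dual H) (E p.2) = m%:R.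
  case=> [[i a] s] /=.
  have nc := natcharM sys (natchar_ap (natchar_chi sys i)) (natchar_chi sys a).
  by have [_] := nc; apply; have [/(_ s)[]] := sys.
have [s0 es0] : exists s, e (E s) != 0.
  apply/existsP; rewrite -[X in is_true X]negbK negb_exists; apply/negP => /forallP e0.
  case/eqP: eL0; rewrite (tracial_expand sys te) big1 ?zero_lfunE // => i _.
  by have := e0 i; rewrite negbK => /eqP->; rewrite scale0r.
(* The matrix of multiplication by the sum of the [ch i (x) ap (ch i)] on products of characters;
   the eigenvector holds the coordinates of [e (x) e]. *)
pose M (p p' : I * I) := (\sum_i n (i, p'.1, p.1) * m (i, p'.2, p.2))%N.
apply: (nat_eigen_dvd char_k (M := M) (u := fun p => e (E p.1) * e (E p.2))
  (j0 := (s0, s0))) => //; first by rewrite mulf_neq0.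
case=> s t /=; have expand (f : dual H) z :
    (f * e) z = \sum_a e (E a) * (f * ch a) z.
  rewrite {1}(tracial_expand sys te) mulr_sumr sum_lfunE; apply: eq_bigr => a _.
  by rewrite -scalerAr scale_lfunE.
have -> : \sum_(p' : I * I) (M (s, t) p')%:R * (e (E p'.1) * e (E p'.2)) =
    \sum_i (ch i * e) (E s) * (ap (ch i) * e) (E t).
  under [RHS]eq_bigr => i _ do rewrite !expand mulr_suml.
  under [RHS]eq_bigr => i _ do under eq_bigr => a _ do rewrite mulr_sumr.
  under [RHS]eq_bigr => i _ do rewrite pair_big.
  rewrite exchange_big; apply: eq_bigr => -[a b] _ /=.
  rewrite /M natr_sum mulr_suml; apply: eq_bigr => i _ /=.
  rewrite natrM -(nE (i, a, s)) -(mE (i, b, t)) /=.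
  by rewrite mulrC mulrACA.
rewrite main dimX mulrA; congr (_ * _).
by rewrite -mulrA mulfV // mulr1.
Qed.

Lemma dsub_dvd (d : nat) X : dsub X ->
  (forall Y, simple_dsub Y -> (Y <= X)%VS -> (d %| \dim Y)%N) -> (d %| \dim X)%N.
Proof.
have [n] := ubnP (\dim X); elim: n X => // n IH X lt dX dY.
have [->|X0] := eqVneq X 0%VS; first by rewrite dimv0 dvdn0.
have [Y sY YX] := simple_sub dX X0; have [dsY Y0 _] := sY.
have [Z [dZ YZ0 YZX]] := dsub_compl_in char_k intL dsY dX YX.
have dE : \dim X = (\dim Y + \dim Z)%N by rewrite -YZX dimv_disjoint_sum.
have Ypos : (0 < \dim Y)%N by rewrite lt0n dimv_eq0.
rewrite dE; apply: dvdn_add; first exact: dY.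
apply: IH => //; first by move: lt; rewrite dE; lia.
by move=> Y' sY' Y'Z; apply: dY => //; apply: subv_trans Y'Z _; rewrite -YZX addvSr.
Qed.

End ClassEquation.

(** * The central idempotent of a Yetter-Drinfeld subalgebra *)

Section NormalSubalgebra.
Variables (k : closedFieldType) (H : hopfAlgType k).
Hypothesis char_k : [pchar k] =i pred0.
Variables (L : H) (intL : norm_integral L).
Local Notation "a *: v" := (@GRing.scale k _ a v) : ring_scope.
Implicit Types (W : vectType k) (x y h u : H) (f g : dual H) (X Z : {vspace H}).
Let S2 := antipode2 char_k intL.
Let vnH : vn_regular H := integral_vn_regular intL.
Local Notation N := (\dim {:H}).
Let ll := @lin_lam k H.

(** The cointegral identity for [y_2 * x], multiplied by [ap y_1]. It moves the coaction from [x] to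
    [y], so that a submodule has a stable orthogonal for [lam]. *)
Lemma lam_slide x y : sw (fun a b => lam (y * b) *: a) x =
  sw (fun a b => lam (b * x) *: ap a) y.
Proof.
have lr h := lam_swr char_k intL h (@lin_id _ _).
transitivity (sw (fun a b => sw (fun c d => sw (fun u v =>
    lam (d * v) *: (ap a * (c * u))) x) b) y).
  rewrite -(swA (F := fun a c d => sw (fun u v => lam (d * v) *: (ap a * (c * u))) x)); try lin.
  under [RHS]eq_sw => t d.
    rewrite swC; under eq_sw => u v.
      under eq_sw => a c do rewrite mulrA.
      rewrite (sw_apl (f := fun z => lam (d * v) *: (z * u))); last by lin.
      rewrite mul1r; over.
    rewrite -sw_scale; over.
  by rewrite (sw_epsl (f := fun d => sw (fun u v => lam (d * v) *: u) x)) //; lin.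
apply: eq_sw => a b.
have := lr (b * x); rewrite sw_mul; last by lin.
move/(congr1 ( *%R (ap a))); rewrite -scalerAr mulr1 => <-.
rewrite sw_mulr; apply: eq_sw => c d; rewrite sw_mulr; apply: eq_sw => u v.
by rewrite -scalerAr.
Qed.

Lemma lam_idem u : u * u = u -> lam u = (\dim (limg (amull u)))%:R.
Proof.
move=> uu; rewrite (lam_regular char_k intL); apply: trf_proj; first by lin.
  by move=> x; apply/memv_imgP; exists x; rewrite ?memvf ?lfunE.
by move=> _ /memv_imgP[x _ ->]; rewrite lfunE /= mulrA uu.
Qed.

Lemma lam_idem_neq0 u : u * u = u -> u != 0 -> lam u != 0.
Proof.
move=> uu u0; rewrite lam_idem // natr_eq0 // dimv_eq0.
apply: contraNneq u0 => X0; rewrite -memv0 -X0; apply/memv_imgP.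
by exists u; rewrite ?memvf // lfunE /= uu.
Qed.

Variable Y : {vspace H}.
Hypotheses (dY : dsub Y) (Y1 : 1 \in Y) (YY : (Y * Y <= Y)%VS).

Let YM x y : x \in Y -> y \in Y -> x * y \in Y.
Proof. by move=> xY yY; apply: (subvP YY); exact: memv_mul. Qed.

Let gram (x : H) : 'rV[k]_(\dim Y) := \row_i lam ((vbasis Y)`_i * x).

Let lin_gram : linear gram.
Proof.
move=> a x y; apply/rowP => i; rewrite !mxE mulrDr -scalerAr.
by rewrite (lin_mapD _ _ ll) (lin_scale _ _ ll).
Qed.

Let orth := lker (linfun gram).

Let orthP x : reflect (forall y, y \in Y -> lam (y * x) = 0) (x \in orth).
Proof.
apply: (iffP idP) => [|xo]; rewrite memv_ker linfunP //.
  move=> /eqP/rowP go y yY; rewrite (coord_vbasis yY) mulr_suml (lin_sum _ _ ll).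
  rewrite big1 // => i _; rewrite -scalerAl (lin_scale _ _ ll).
  by have := go i; rewrite !mxE => ->; rewrite scaler0.
apply/eqP/rowP => i; rewrite !mxE; apply: xo; apply: vbasis_mem.
by rewrite mem_nth // size_tuple.
Qed.

Let dsub_orth : dsub orth.
Proof.
have [Yl Ya] := dY; split=> [f x|h x] /orthP xo; apply/orthP => y yY.
  have -> : lam (y * lhit f x) = f (sw (fun a b => lam (y * b) *: a) x).
    rewrite /lhit sw_mulr [LHS](lin_swE _ _ ll) [RHS]lin_swE; last by lin.
    have E a b : lam (y * (f a *: b)) = f (lam (y * b) *: a).
      by rewrite -scalerAr (lin_scale _ _ ll) [RHS]linearZ; exact: mulrC.
    exact: (eq_sw (W := k^o) x E).
  rewrite lam_slide (dsub_ext (F' := fun a b => 0) dY) //.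
  - by rewrite /sw /tlift big1 ?linear0 // => i _; rewrite big1 // => j _; rewrite scaler0.
  - by lin.
  - by split=> v a u w; rewrite scaler0 addr0.
  by move=> a b bY; rewrite xo // scale0r.
have -> : lam (y * ad h x) = lam (ad (ap h) y * x).
  rewrite /ad sw_ap; last by lin.
  rewrite sw_mulr sw_mull !(lin_swE _ _ ll).
  have E a b : lam (y * (a * x * ap b)) = lam (ap b * y * ap (ap a) * x).
    by rewrite S2 !mulrA (lamC char_k intL) !mulrA.
  exact: (eq_sw (W := k^o) h E).
by apply: xo; exact: Ya.
Qed.

(** The component of [L] in [X] is invariant under [ad], hence central, and its counit is
    [\dim X / N]. *)
Lemma dsub_central X : dsub X -> X != 0%VS ->
  exists b, [/\ b \in X, forall h, h * b = b * h & eps b != 0].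
Proof.
move=> dX X0; have [e [te eX eid]] := dsub_proj char_k intL dX.
have adb h : ad h (hit e L) = eps h *: hit e L.
  rewrite -(hit_ad char_k intL) //.
  have -> : ad h L = eps h *: L.
    rewrite /ad; under eq_sw => a b do
      rewrite intL.1 -scalerAl (right_integral intL) counit_ap.
    by rewrite (sw_epsl (f := fun b => eps b *: L)) //; lin.
  by rewrite (lin_scale _ _ (lin_hit e)).
exists (hit e L); split=> // [h|].
  rewrite -(mul_ad h); under eq_sw => a b do rewrite adb -scalerAl.
  by rewrite (sw_epsl (f := fun b => hit e L * b)) //; lin.
rewrite counit_hit; apply: contraNneq X0 => eL.
by rewrite -dimv_eq0 -(natr_eq0 char_k) (dim_proj char_k intL te eX eid) eL mulr0.
Qed.

(** Otherwise the intersection contains a central [b] with nonzero counit. Multiplication by [b]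
    permutes [b * Y], which yields a nonzero idempotent [w = z * b] with [z] in [Y]; [lam w] is a
    positive dimension, but [b] is orthogonal to [Y]. *)
Let cap_orth0 : (Y :&: orth)%VS = 0%VS.
Proof.
apply/eqP/negPn/negP => X0.
have [b [bX bC eb]] := dsub_central (dsub_cap dY dsub_orth) X0.
move: bX; rewrite memv_cap => /andP[bY /orthP bo].
have b0 : b != 0 by apply: contraNneq eb => ->; rewrite linear0.
have [y byb] := vnH b.
pose B := (amull b @: Y)%VS.
have BY x : x \in B -> exists2 z, z \in Y & x = b * z.
  by case/memv_imgP => z zY ->; exists z; rewrite ?lfunE.
have bB : b \in B by apply/memv_imgP; exists 1; rewrite ?lfunE /= ?mulr1.
have inj : (B :&: lker (amull b))%VS = 0%VS.
  apply/eqP; rewrite -subv0; apply/subvP => x; rewrite memv_cap memv_ker lfunE /= memv0.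
  case/andP => /BY[z _ ->] /eqP bbz.
  have <- : y * (b * (b * z)) = b * z by rewrite !mulrA (bC y) byb.
  by rewrite bbz mulr0.
have sB : (amull b @: B <= B)%VS.
  apply/subvP => _ /memv_imgP[x /BY[z zY ->] ->]; rewrite lfunE /=.
  by apply/memv_imgP; exists (b * z); rewrite ?lfunE ?YM.
have BB : (amull b @: B)%VS = B.
  by apply/eqP; rewrite eqEdim sB (limg_dim_eq inj) leqnn.
have : b \in (amull b @: B)%VS by rewrite BB.
case/memv_imgP => w /BY[z zY wE]; rewrite lfunE /= => bE.
have ww : w * w = w by rewrite {1}wE -(bC z) -mulrA -bE bC -wE.
have w0 : w != 0 by apply: contraNneq b0 => w0; rewrite bE w0 mulr0.
by have := lam_idem_neq0 ww w0; rewrite wE -(bC z) bo ?eqxx.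
Qed.

(** [l0] is the component of [L] in [Y] along [orth]: since [lam (l * L) = eps l], it represents the
    counit of [Y] and is therefore an integral of [Y]. *)
Let frobenius : exists l0, [/\ l0 \in Y, l0 != 0 &
  forall l, l \in Y -> eps l = 0 -> l * l0 = 0].
Proof.
have full : (Y + orth)%VS = {:H}%VS.
  apply/eqP; rewrite eqEdim subvf dimv_disjoint_sum //.
  have := limg_ker_dim (linfun gram) {:H}; rewrite capfv -/orth => <-.
  rewrite addnC leq_add2r; apply: leq_trans (dimvS (subvf _)) _.
  by rewrite dimvf /dim /= mul1n.
have : L \in (Y + orth)%VS by rewrite full memvf.
case/memv_addP => l0 l0Y [l1 /orthP l1o LE].
have pair l : l \in Y -> lam (l * l0) = eps l.
  move=> lY; have : lam (l * L) = eps l.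
    by rewrite intL.1 (lin_scale _ _ ll) (lam_integral intL); exact: mulr1.
  by rewrite LE mulrDr (lin_mapD _ _ ll) l1o // addr0.
exists l0; split=> // [|l lY el].
  apply: contraTneq (oner_neq0 k) => l00; rewrite negbK.
  by have := pair 1 Y1; rewrite l00 mulr0 (lin_map0 ll) counit1 => <-.
apply/eqP; rewrite -memv0 -cap_orth0 memv_cap YM //=; apply/orthP => y yY.
by rewrite mulrA pair ?YM // counitM el mulr0.
Qed.

(** [c = 1 - e], where the idempotent [e] generates the left ideal [J] spanned by the products of
    [H] with the augmentation ideal of [Y]. Adjoint stability makes [J] two-sided and [e] central,
    and the integral [l0] puts [c] in [Y]. *)
Lemma normal_subalg_idem : exists c,
  [/\ [/\ c \in Y, forall h, c * h = h * c, c * c = c, eps c = 1 &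
          forall l, l \in Y -> l * c = eps l *: c],
      ap c = c,
      forall W (F : H -> H -> W), bilin F -> sw (fun a b => F a (b * c)) c = F c c &
      N = (\dim Y * \dim (limg (amull c)))%N].
Proof.
have [Yl Ya] := dY; have [l0 [l0Y l00 l0E]] := frobenius.
pose Yp := (Y :&: lker eps)%VS; pose J := ({:H} * Yp)%VS.
have YpP x : (x \in Yp) = (x \in Y) && (eps x == 0) by rewrite memv_cap memv_ker.
have Jl a u : u \in J -> a * u \in J.
  apply: (memv_mul_lin (F := fun u => a * u)); first by lin.
  by move=> x y _ yY; rewrite mulrA memv_mul ?memvf.
have YpJ l : l \in Yp -> l \in J.
  by move=> lY; rewrite -[l]mul1r memv_mul ?memvf.
have [e eJ eid] := left_ideal_idem intL Jl.
have Jr u h : u \in J -> u * h \in J.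
  move: u; apply: (memv_mul_lin (F := fun u => u * h)); first by lin.
  move=> x l _ lY; rewrite -mulrA; apply: (Jl).
  have -> : l * h = sw (fun a b => b * ad (ap a) l) h.
    transitivity (sw (fun a b => sw (fun p q => b * ap q * (l * p)) a) h); last first.
      apply: eq_sw => a b; rewrite /ad sw_ap; last by lin.
      by rewrite sw_mulr; apply: eq_sw => p q; rewrite S2 !mulrA.
    rewrite (swA (F := fun p q b => b * ap q * (l * p))); try lin.
    under eq_sw => p c.
      rewrite (sw_apr' char_k intL (f := fun z => z * (l * p))); last by lin.
      rewrite mul1r; over.
    by rewrite (sw_epsr (f := fun p => l * p)) //; lin.
  apply: memv_sw => a b; apply: (Jl); apply: YpJ.
  move: lY; rewrite !YpP counit_ad => /andP[lY /eqP->]; rewrite mulr0 eqxx andbT.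
  exact: Ya.
(* The defect [z = (1 - e) * h * e] satisfies [z * a * z = 0] for all [a], because [e * a] lies in
   [J]; regularity gives [z = 0]. *)
have eC h : e * h = h * e.
  suff z0 : h * e - e * h * e = 0.
    by apply/eqP; rewrite eq_sym -subr_eq0 -[e * h in X in _ - X](eid _ (Jr _ h eJ)) z0.
  set z := _ - _; have zJ : z \in J by rewrite rpredB // Jl.
  have [a <-] := vnH z.
  have E : e * a * (1 - e) = 0.
    by rewrite mulrBr mulr1 (eid _ (Jr _ a eJ)) subrr.
  have zE : z = (1 - e) * h * e by rewrite /z !mulrBl mul1r.
  rewrite {2}zE -(mulrA z a) zE !mulrA.
  have -> : (1 - e) * h * e * a * (1 - e) = 0 by rewrite -!mulrA (mulrA e) E !mulr0.
  by rewrite !mul0r.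
have el0 : e * l0 = 0.
  have K : forall u, u \in J -> u * l0 \in 0%VS.
    apply: (memv_mul_lin (F := fun u => u * l0)); first by lin.
    move=> x l _; rewrite YpP => /andP[lY /eqP el].
    by rewrite -mulrA l0E // mulr0 memv0.
  by apply/eqP; rewrite -memv0 K.
have epse : eps e = 0.
  have K : forall u, u \in J -> u \in lker eps.
    apply: (memv_mul_lin (F := id)); first exact: lin_id.
    by move=> x l _; rewrite YpP memv_ker counitM => /andP[_ /eqP->]; rewrite mulr0.
  by apply/eqP; rewrite -memv_ker K.
pose c := 1 - e.
have cC h : c * h = h * c by rewrite mulrBl mulrBr mul1r mulr1 eC.
have cc : c * c = c by rewrite {2}/c mulrBr mulr1 cC mulrBr mulr1 eid // subrr subr0.
have epsc : eps c = 1.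
  by rewrite /c linearB /= counit1 epse; exact: subr0.
have cl l : l \in Y -> l * c = eps l *: c.
  move=> lY; have : l - eps l *: 1 \in J.
    apply: YpJ; rewrite YpP rpredB ?rpredZ //= linearB linearZ /= counit1.
    by rewrite subr_eq0; apply/eqP/esym/mulr1.
  move/eid => E; have : (l - eps l *: 1) * c = 0 by rewrite /c mulrBr mulr1 E subrr.
  by rewrite mulrBl -scalerAl mul1r => /eqP; rewrite subr_eq0 => /eqP.
(* [c * l0 = l0] since [e] kills [l0], while [l0 * c = eps l0 *: c]: [c] is a multiple of [l0]. *)
have cY : c \in Y.
  have cl0 : c * l0 = l0 by rewrite mulrBl mul1r el0 subr0.
  have E : l0 = eps l0 *: c by rewrite -cl // -cC cl0.
  have n0 : eps l0 != 0 by apply: contraNneq l00 => E0; rewrite E E0 scale0r.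
  by have : (eps l0)^-1 *: l0 \in Y; [rewrite memvZ | rewrite {2}E scalerA mulVf // scale1r].
have c0 : c != 0.
  by apply: contraTneq (oner_neq0 k) => c0; rewrite -epsc c0 linear0 eqxx.
have Sc : ap c = c.
  have Sl l : l \in Y -> eps l = 0 -> ap l * c = 0.
    move=> lY el; transitivity (sw (fun a b => ap a * (eps b *: c)) l).
      rewrite -(sw_epsr (f := fun a => ap a * c)); last by lin.
      by apply: eq_sw => a b; rewrite -scalerAr.
    rewrite (dsub_ext (F' := fun a b => ap a * b * c) dY) //; try lin.
      by rewrite (sw_apl (f := fun z => z * c)) ?el ?scale0r //; lin.
    by move=> a b bY; rewrite -cl // mulrA.
  have Se : ap e * c = 0.
    have K : forall u, u \in J -> ap u * c \in 0%VS.
      apply: (memv_mul_lin (F := fun u => ap u * c)); first by lin.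
      move=> x l _; rewrite YpP => /andP[lY /eqP el].
      by rewrite antipodeM -mulrA -cC mulrA Sl // mul0r memv0.
    by apply/eqP; rewrite -memv0 K.
  have E : ap c * c = c by rewrite {1}/c linearB /= antipode1 mulrBl Se subr0 mul1r.
  by have := congr1 ap E; rewrite antipodeM S2 E.
exists c; split=> // [W F bF|].
  rewrite (dsub_ext (F' := fun a b => eps b *: F a c) dY) //; try lin.
    by rewrite (sw_epsr (f := fun a => F a c)) //; lin.
  by move=> a b bY; rewrite cl // (lin_scale _ _ (bF.2 _)).
have lc0 : lam c != 0 by exact: lam_idem_neq0.
(* [hit f] projects onto [Y], so [\dim Y = N * f L = N / lam c], and [lam c] is the dimension of
   [c * H]. *)
pose f : dual H := linfun (fun h => (lam c)^-1 * lam (c * h) : k^o).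
have fE h : f h = (lam c)^-1 * lam (c * h) by rewrite linfunP //; lin.
have hE h : hit f h = (lam c)^-1 *: sw (fun a b => lam (c * b) *: a) h.
  by rewrite /hit sw_scale; apply: eq_sw => a b; rewrite fE scalerA.
have fY h : hit f h \in Y.
  rewrite hE memvZ // lam_slide -Sc sw_ap; last by lin.
  under eq_sw => a b do rewrite S2.
  have := Yl (linfun (fun a => lam (ap a * h) : k^o)) c cY.
  rewrite /lhit (eq_sw (g := fun a b => lam (ap a * h) *: b)) // => a b.
  by rewrite linfunP //; lin.
have fid h : h \in Y -> hit f h = h.
  move=> hY; rewrite hE.
  rewrite (dsub_ext (F' := fun a b => eps b *: (lam c *: a)) dY) //; try lin.
    rewrite (sw_epsr (f := fun a => lam c *: a)); last by lin.
    by rewrite scalerA mulVf // scale1r.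
  by move=> a b bY; rewrite cC cl // (lin_scale _ _ ll) scalerA.
apply: (natr_inj0 char_k); rewrite /= natrM -(lam_idem cc).
rewrite -(trf_proj (lin_hit f) fY fid) (trf_hit char_k intL) fE.
rewrite intL.1 epsc scale1r (lam_integral intL) mulr1.
by rewrite -mulrA mulVf // mulr1.
Qed.

End NormalSubalgebra.

(** * Quotient Hopf algebras *)

Section QuotientHopf.
Variables (k : fieldType) (H : hopfAlgType k) (B : falgType k).
Local Notation "a *: v" := (@GRing.scale k _ a v) : ring_scope.
Variables (pr : H -> B) (sec : B -> H).
Hypotheses (lpr : linear pr) (lsec : linear sec) (secK : cancel sec pr).
Hypotheses (pr1 : pr 1 = 1) (prM : forall x y, pr (x * y) = pr x * pr y).
Hypothesis (pr_ker : forall x, pr x = 0 ->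
  [/\ sw (fun a b => tens (pr a) (pr b)) x = 0, eps x = 0 & pr (ap x) = 0]).

Let D (x : H) : tensor B B := sw (fun a b => tens (pr a) (pr b)) x.

Let lD : linear D. Proof. exact: lin_sw. Qed.

Let q_comul : 'Hom(B, tensor B B) := linfun (fun b => D (sec b)).
Let q_counit : 'Hom(B, k^o) := linfun (fun b => eps (sec b) : k^o).
Let q_antipode : 'Hom(B, B) := linfun (fun b => pr (ap (sec b))).

Let pr_sec x : pr (sec (pr x) - x) = 0.
Proof. by rewrite (lin_mapB _ _ lpr) secK subrr. Qed.

Let qcE x : q_comul (pr x) = D x.
Proof.
rewrite linfunP; last by exact: (lin_comp lD lsec).
have [E _ _] := pr_ker (pr_sec x); apply/eqP; rewrite -subr_eq0.
by rewrite -(lin_mapB _ _ lD) /D E.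
Qed.

Let qeE x : q_counit (pr x) = eps x.
Proof.
rewrite linfunP; last by lin.
have [_ E _] := pr_ker (pr_sec x); apply/eqP; rewrite -subr_eq0.
by rewrite -linearB /= E.
Qed.

Let qaE x : q_antipode (pr x) = pr (ap x).
Proof.
rewrite linfunP; last by lin.
have [_ _ E] := pr_ker (pr_sec x); apply/eqP; rewrite -subr_eq0.
by rewrite -(lin_mapB _ _ lpr) -linearB /= E.
Qed.

Let DE (W : vectType k) (F : B -> B -> W) x : bilin F ->
  tlift F (D x) = sw (fun a b => F (pr a) (pr b)) x.
Proof.
move=> bF; rewrite /D lin_swE; last by exact: lin_tlift.
by apply: eq_sw => a b; rewrite tlift_tens.
Qed.

Let ind (P : B -> Prop) : (forall x, P (pr x)) -> forall b, P b.
Proof. by move=> Ppr b; rewrite -(secK b). Qed.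

Fact q_comulA b : tassoc (tmap q_comul id (q_comul b)) = tmap id q_comul (q_comul b).
Proof.
move: b; apply: ind => x; rewrite qcE /tmap DE; last by split=> v; lin.
rewrite DE; last by split=> v; lin.
rewrite /tassoc lin_swE; last by exact: lin_tlift.
transitivity (sw (fun a b => sw (fun u v =>
    tens (pr u) (tens (pr v) (pr b))) a) x).
  apply: eq_sw => a b; rewrite tlift_tens; last by lin.
  by rewrite qcE DE //; split=> w; lin.
rewrite (swA (F := fun u v b => tens (pr u) (tens (pr v) (pr b)))); try lin.
by apply: eq_sw => a b; rewrite qcE /D [RHS]lin_swE //; exact: (bilin_tens _ _).2.
Qed.

Fact q_counitl b : tlift (fun a b => q_counit a *: b) (q_comul b) = b.
Proof.
move: b; apply: ind => x; rewrite qcE DE; last by split=> v; lin.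
by under eq_sw => a b do rewrite qeE; rewrite sw_epsl.
Qed.

Fact q_counitr b : tlift (fun a b => q_counit b *: a) (q_comul b) = b.
Proof.
move: b; apply: ind => x; rewrite qcE DE; last by split=> v; lin.
by under eq_sw => a b do rewrite qeE; rewrite sw_epsr.
Qed.

Fact q_comul1 : q_comul 1 = tens 1 1.
Proof. by rewrite -pr1 qcE /D sw_one //; lin. Qed.

Fact q_comulM b b' : q_comul (b * b') = tmul (q_comul b) (q_comul b').
Proof.
move: b b'; apply: ind => x; apply: ind => y.
rewrite -prM !qcE /tmul /D sw_mul; last by lin.
rewrite DE; last by split=> v; lin.
apply: eq_sw => a b; rewrite DE; last by split=> v; lin.
by apply: eq_sw => c d; rewrite !prM.
Qed.

Fact q_counit1 : q_counit 1 = 1.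
Proof. by rewrite -pr1 qeE counit1. Qed.

Fact q_counitM b b' : q_counit (b * b') = q_counit b * q_counit b'.
Proof.
by move: b b'; apply: ind => x; apply: ind => y; rewrite -prM !qeE counitM.
Qed.

Fact q_antipodel b : tlift (fun a b => q_antipode a * b) (q_comul b) = q_counit b *: 1.
Proof.
move: b; apply: ind => x; rewrite qcE DE; last by split=> v; lin.
under eq_sw => a b do rewrite qaE -prM.
by rewrite sw_apl // pr1 qeE.
Qed.

Fact q_antipoder b : tlift (fun a b => a * q_antipode b) (q_comul b) = q_counit b *: 1.
Proof.
move: b; apply: ind => x; rewrite qcE DE; last by split=> v; lin.
under eq_sw => a b do rewrite qaE -prM.
by rewrite sw_apr // pr1 qeE.
Qed.

Lemma quotient_hopf : exists (Q : hopfAlgType k) (p : H -> Q),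
  [/\ linear p, p 1 = 1 & forall x y, p (x * y) = p x * p y] /\
  [/\ forall b, exists x, p x = b, forall x, p x = 0 <-> pr x = 0,
     \dim {:Q} = \dim {:B}, forall x, eps (p x) = eps x &
     forall x, comul (p x) = sw (fun a b => tens (p a) (p b)) x].
Proof.
pose mix := Falgebra_isHopf.Build k B q_comulA q_counitl q_counitr q_comul1 q_comulM
  q_counit1 q_counitM q_antipodel q_antipoder.
pose Q : hopfAlgType k := HB.pack (Falgebra.sort B) mix.
exists Q, pr; split; [by split | split=> //].
by move=> b; exists (sec b).
Qed.

End QuotientHopf.

Section IdempotentQuotient.
Variables (k : fieldType) (H : hopfAlgType k).
Local Notation "a *: v" := (@GRing.scale k _ a v) : ring_scope.

(** The quotient is realised inside [H] as [c * H], with unit [c]. The condition on the coproduct of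
    [c], times [1 (x) c], lets the coproduct descend: it makes [c (x) c] times the coproduct of [x]
    depend only on [c * x]. *)
Lemma idem_quotient (c : H) : (forall h, c * h = h * c) -> c * c = c -> eps c = 1 ->
  ap c = c ->
  (forall (W : vectType k) (F : H -> H -> W), bilin F -> sw (fun a b => F a (b * c)) c = F c c) ->
  exists (Q : hopfAlgType k) (p : H -> Q),
  [/\ linear p, p 1 = 1 & forall x y, p (x * y) = p x * p y] /\
  [/\ forall b, exists x, p x = b, forall x, p x = 0 <-> c * x = 0,
     \dim {:Q} = \dim (limg (amull c)), forall x, eps (p x) = eps x &
     forall x, comul (p x) = sw (fun a b => tens (p a) (p b)) x].
Proof.
move=> cC cc ec Sc Dc; pose U := limg (amull c).
have c0 : c != 0 by apply: contraTneq (oner_neq0 k) => c0; rewrite -ec c0 linear0 eqxx.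
have UP u : u \in U -> c * u = u.
  by case/memv_imgP => v _ ->; rewrite lfunE /= mulrA cc.
have cU u : c * u \in U by apply/memv_imgP; exists u; rewrite ?memvf ?lfunE.
have cUc : c \in U by rewrite -cc.
have isA : is_aspace U.
  apply/andP; split.
    apply/has_algidP; exists c; split=> // u uU; rewrite UP //.
    by rewrite -cC UP.
  by apply/prodvP => u v uU vU; rewrite -(UP u uU) -mulrA.
pose A := ASpace isA; have cA : algid A = c.
  by rewrite -[LHS](UP _ (memv_algid A)) (algidr (A := A)).
pose pr (x : H) : subvs_of A := vsproj A (c * x).
have prE x : vsval (pr x) = c * x by rewrite vsprojK.
have lpr : linear pr by move=> a x y; rewrite /pr mulrDr -scalerAr linearP.
have pr0 x : pr x = 0 <-> c * x = 0.
  split=> [px|cx]; first by rewrite -prE px.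
  by apply/val_inj; rewrite /= prE.
have prc x : pr (c * x) = pr x by rewrite /pr mulrA cc.
have [] := @quotient_hopf k H (subvs_of A) pr vsval lpr _ _ _ _ _.
- by move=> a u v; rewrite linearP.
- by move=> b; apply/val_inj; rewrite /= prE UP ?subvsP.
- by apply/val_inj; rewrite /= prE mulr1.
- move=> x y; apply/val_inj; rewrite /= !prE -!mulrA [x * (c * y)]mulrA -cC.
  by rewrite !mulrA cc.
- move=> x px; have {px} cx : c * x = 0 by apply/pr0.
  split.
  + pose F a b := sw (fun p q => tens (pr (a * p)) (pr (b * q))) x.
    transitivity (F c c).
      by apply: eq_sw => p q; rewrite !prc.
    rewrite -Dc; last by rewrite /F; lin.
    rewrite (eq_sw (g := F)); last first.
      by move=> a b; apply: eq_sw => p q; rewrite -cC -mulrA prc.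
    rewrite -[LHS](sw_mul (f := fun a b => tens (pr a) (pr b)) c x); last by lin.
    by rewrite cx (lin_map0 (lin_sw _)).
  + by rewrite -[eps x]mul1r -ec -counitM cx linear0.
  by rewrite -prc cC -{1}Sc -antipodeM cx linear0 (lin_map0 lpr).
move=> Q [p [h1 [h2 h3 h4 h5 h6]]]; exists Q, p; split=> //; split=> //.
- by move=> x; rewrite h3.
by rewrite h4 dimvf.
Qed.

End IdempotentQuotient.

(** * Finite groups as lists of units; group-likes as such lists *)

Section ListGroup.
Variables (A : unitRingType).
Implicit Types s t : seq A.

Definition mul_closed_seq s :=
  [/\ uniq s, 1 \in s, {in s, forall x, x \is a GRing.unit}
    & {in s &, forall x y, x * y \in s}].

(** Left multiplication by a member permutes the finite list, so the list contains the inverses. *)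
Lemma list_group s : mul_closed_seq s ->
  exists (gT : finGroupType) (f : gT -> A),
    [/\ injective f, forall x y, f (x * y)%g = f x * f y, f 1%g = 1
      & codom f =i s].
Proof.
move=> [us s1 sU sM].
have sV x : x \in s -> x^-1 \in s.
  move=> sx; have ux := sU x sx.
  have /perm_mem/(_ 1) : perm_eq [seq x * y | y <- s] s.
    apply: uniq_perm => //; first by rewrite map_inj_uniq //; exact: mulrI.
    apply: (uniq_min_size _ _ _).2; rewrite ?size_map //.
      by rewrite map_inj_uniq //; exact: mulrI.
    by move=> _ /mapP[y sy ->]; exact: sM.
  rewrite s1 => /mapP[y sy e].
  by rewrite -[x^-1]mulr1 e mulKr.
pose m (x y : seq_sub s) := SeqSub (sM _ _ (valP x) (valP y)).
pose o := SeqSub s1.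
pose v (x : seq_sub s) := SeqSub (sV _ (valP x)).
have mA : associative m by move=> x y z; apply: val_inj; rewrite /= mulrA.
have m1 : left_id o m by move=> x; apply: val_inj; rewrite /= mul1r.
have mV : left_inverse o v m.
  by move=> x; apply: val_inj; rewrite /= mulVr // (sU _ (valP x)).
pose gT : finGroupType := HB.pack (seq_sub s) (Finite_isGroup.Build (seq_sub s) mA m1 mV).
exists gT, (fun x : gT => ssval (x : seq_sub s)); split=> //.
  exact: val_inj.
move=> x; apply/idP/idP; first by case/codomP => y ->; exact: (valP (y : seq_sub s)).
by move=> sx; apply/codomP; exists (SeqSub sx : gT).
Qed.

Lemma list_lagrange s t : mul_closed_seq s -> mul_closed_seq t ->
  {subset t <= s} -> (size t %| size s)%N.
Proof.
move=> cs ct ts; have [gT [f [fi fM f1 fs]]] := list_group cs.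
have [us _ _ _] := cs; have [ut t1 _ tM] := ct.
have gP : group_set [set x : gT | f x \in t].
  apply/group_setP; split=> [|x y]; first by rewrite inE f1.
  by rewrite !inE fM; exact: tM.
have sz r : uniq r -> {subset r <= s} -> size r = #|[set x : gT | f x \in r]|.
  move=> ur rs; rewrite cardE -(size_map f); apply: perm_size.
  apply: uniq_perm => //; first by rewrite map_inj_uniq // enum_uniq.
  move=> x; apply/idP/mapP => [rx|[y]]; last by rewrite mem_enum inE => ry ->.
  have /codomP[y e] : x \in codom f by rewrite fs rs.
  by exists y => //; rewrite mem_enum inE -e.
have eT : [set x : gT | f x \in s]%SET = [set: gT]%SET.
  by apply/setP => x; rewrite !inE -fs codom_f.
rewrite (sz t) // (sz s) // eT.
exact: (@cardSg _ [set: gT]%G (group gP) (finset.subsetT _)).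
Qed.

Lemma list_cauchy s r : mul_closed_seq s -> prime r -> (r %| size s)%N ->
  exists2 z, z \in s & z != 1 /\ z ^+ r = 1.
Proof.
move=> cs pr; have [gT [f [fi fM f1 fs]]] := list_group cs.
have [us _ _ _] := cs.
have -> : size s = #|[set: gT]|.
  rewrite cardsT cardE -(size_map f); apply: perm_size.
  apply: uniq_perm => //; by rewrite map_inj_uniq // enum_uniq.
move=> /(Cauchy pr)[z _ oz]; exists (f z); first by rewrite -fs codom_f.
have fX n : f (z ^+ n)%g = f z ^+ n.
  by elim: n => [|n IH]; rewrite ?f1 // expgS exprS fM IH.
split; last by rewrite -fX -oz expg_order f1.
apply/eqP; rewrite -f1 => /fi z1; move: pr; rewrite -oz z1 order1.
by [].
Qed.

End ListGroup.

(** A duplicate-free list of maximal size inside [P] exhausts [P]. *)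
Lemma bounded_list (T : eqType) (P : T -> Prop) n :
  (forall s : seq T, uniq s -> {in s, forall x, P x} -> (size s <= n)%N) ->
  exists s : seq T, uniq s /\ forall x, x \in s <-> P x.
Proof.
move=> bd.
pose R m := `[< exists s : seq T, [/\ uniq s, {in s, forall x, P x} & size s = m] >].
have R0 : exists m, R m by exists 0%N; apply/asboolP; exists [::].
have Rn m : R m -> (m <= n)%N by move=> /asboolP[s [us sP <-]]; exact: bd.
case: (ex_maxnP R0 Rn) => m /asboolP[s [us sP sm]] mx; exists s; split=> // x.
split=> [/sP //|Px]; apply/negPn/negP => xs.
suff /mx : R m.+1 by rewrite ltnn.
apply/asboolP; exists (x :: s); rewrite /= xs us sm; split=> // y.
by rewrite inE => /predU1P[-> //|/sP].
Qed.

Section GrouplikeList.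
Variables (k : closedFieldType) (H : hopfAlgType k).
Local Notation "a *: v" := (@GRing.scale k _ a v) : ring_scope.

Definition gl_list (s : seq H) := uniq s /\ s =i @grouplike k H.

Lemma gl_list_exists : exists s, gl_list s.
Proof.
have [|s [us sP]] := @bounded_list H (fun x => x \in @grouplike k H) (\dim {:H}).
  by move=> s us sP; exact: gl_size.
by exists s; split=> // x; apply/idP/idP => /sP.
Qed.

Lemma gl_mul : {in @grouplike k H &, forall x y, x * y \in @grouplike k H}.
Proof. by move=> x y xg yg; exact: (grouplikeM (Grouplike xg) (Grouplike yg)). Qed.

Lemma gl_unit : {in @grouplike k H, forall x, x \is a GRing.unit}.
Proof.
by move=> x xg; apply/unitrP; exists (ap x); rewrite gl_mulV ?gl_mulrV.
Qed.

Lemma gl_list_closed s : gl_list s -> mul_closed_seq s.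
Proof.
move=> [us sP]; split=> //; first by rewrite sP grouplike1.
  by move=> x; rewrite sP; exact: gl_unit.
by move=> x y; rewrite !sP; exact: gl_mul.
Qed.

(** Connects the set-theoretic cardinality with the lists on which the group theory is done. *)
Lemma gl_list_card s n : gl_list s ->
  ([set: grouplikes H] #= `I_n)%card -> size s = n.
Proof.
move=> [us sP] cn; pose t := [seq insubd (grouplike_one H) x | x <- s].
have ut : uniq t.
  rewrite map_inj_in_uniq // => x y; rewrite !sP => xg yg /(congr1 val).
  by rewrite !insubdK.
have tP x : x \in t.
  apply/mapP; exists (val x); last by rewrite valKd.
  by rewrite sP; exact: valP.
have im : (nth (grouplike_one H) t @` `I_(size t) = [set: grouplikes H])%classic.
  apply/seteqP; split=> // x _; exists (index x t); last by rewrite nth_index.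
  by rewrite /mkset index_mem.
have st : size t = size s by rewrite size_map.
apply/esym/card_eq_II; rewrite card_eq_sym -st.
apply: (card_eq_trans _ cn); rewrite -im card_eq_sym; apply: inj_card_eq.
move=> i j; rewrite !inE /mkset => il jl /eqP.
by rewrite nth_uniq // => /eqP.
Qed.

End GrouplikeList.

(** * Group-likes of the dual as characters of degree one *)

Section DualGrouplike.
Variables (k : closedFieldType) (H : hopfAlgType k).
Local Notation "a *: v" := (@GRing.scale k _ a v) : ring_scope.

Lemma gl_dualP (g : dual H) : g \in @grouplike k (dual H) <->
  g 1 = 1 /\ forall a b, g (a * b) = g a * g b.
Proof.
rewrite inE; split.
  move=> /andP[/eqP gD /eqP g1]; split; first by rewrite -dual_counitE.
  move=> a b; rewrite -dual_comulP.
  have -> : dual_comul H g = tens g g by [].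
  by rewrite contract_tens scale_lfunE.
move=> [g1 gM]; apply/andP; split; apply/eqP; last first.
  by rewrite -[RHS]g1; exact: dual_counitE.
apply: contract_inj => a; apply/lfunP => b.
by rewrite [LHS]dual_comulP contract_tens scale_lfunE gM.
Qed.

Hypothesis char_k : [pchar k] =i pred0.
Variables (I : finType) (e : I -> H).
Hypothesis sys : idem_system e.

Lemma gl_chi i : deg e i = 1%N -> chi e i \in @grouplike k (dual H).
Proof.
move=> d1; have [_ c1 cM] := deg1_alg_char sys d1.
by apply/gl_dualP; split=> [|a b]; rewrite !chiE.
Qed.

Lemma gl_chiE g : g \in @grouplike k (dual H) ->
  exists2 i, deg e i = 1%N & g = chi e i.
Proof.
move=> /gl_dualP[g1 gM].
have [|i d1 gE] := alg_char_irr char_k sys (f := g); first by split=> //; lin.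
by exists i => //; apply/lfunP => x; rewrite chiE.
Qed.

Lemma chi_inj : injective (chi e).
Proof. by move=> i j E; apply: (irr_inj sys) => x; rewrite -!chiE E. Qed.

Lemma gl_list_chi (s : seq (dual H)) : gl_list s ->
  perm_eq s [seq chi e i | i <- enum [pred i | deg e i == 1%N]].
Proof.
move=> [us sP]; apply: uniq_perm => //.
  by rewrite map_inj_uniq ?enum_uniq //; exact: chi_inj.
move=> g; rewrite sP; apply/idP/mapP => [/gl_chiE[i di ->]|[i]].
  by exists i; rewrite // mem_enum inE di.
by rewrite mem_enum inE => /eqP di ->; exact: gl_chi.
Qed.

Lemma gl_list_size (s : seq (dual H)) : gl_list s -> size s = #|[pred i | deg e i == 1%N]|.
Proof. by move=> /gl_list_chi/perm_size ->; rewrite size_map -cardE. Qed.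

Lemma comm_deg1 : (forall x y : H, x * y = y * x) -> forall i, deg e i = 1%N.
Proof.
move=> xy i; have [prim _ _] := sys; have [e0 ee pe] := prim i.
rewrite /deg (_ : limg _ = <[e i]>%VS) ?dim_vline ?e0 //.
apply/eqP; rewrite eqEsubv -memvE; apply/andP; split; last first.
  by apply/memv_imgP; exists (e i); rewrite ?memvf // lfunE /= ee.
apply/subvP => _ /memv_imgP[x _ ->]; rewrite lfunE /=; have [c cE] := pe x.
by apply/vlineP; exists c; rewrite -cE (xy (e i)) -mulrA ee.
Qed.

Lemma comm_gl_list (s : seq (dual H)) : gl_list s -> (forall x y : H, x * y = y * x) ->
  size s = \dim {:H}.
Proof.
move=> sP xy; rewrite (gl_list_size sP) (dim_sum_deg char_k sys) -sum1_card.
rewrite (eq_bigl predT) => [|i]; last by rewrite inE comm_deg1.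
by apply: eq_bigr => i _; rewrite comm_deg1.
Qed.

End DualGrouplike.

Section QuotientGrouplike.
Variables (k : closedFieldType) (H Q : hopfAlgType k) (p : H -> Q) (c : H).
Local Notation "a *: v" := (@GRing.scale k _ a v) : ring_scope.
Hypotheses (pL : linear p) (p1 : p 1 = 1) (pM : forall x y, p (x * y) = p x * p y).
Hypotheses (pS : forall b, exists x, p x = b) (pc : p c = 1).
Hypothesis pe : forall x, eps (p x) = eps x.
Hypothesis pD : forall x, comul (p x) = sw (fun a b => tens (p a) (p b)) x.

(** Composition with [p] embeds the group of the quotient; since [p c = 1], its members take the
    value 1 at [c], and this is what is remembered of the quotient later. *)
Lemma quotient_gl (s : seq (dual H)) (t : seq (dual Q)) :
  gl_list s -> gl_list t ->
  exists u : seq (dual H), [/\ mul_closed_seq u, size u = size t,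
    {subset u <= s} & forall g : dual H, g \in u -> g c = 1].
Proof.
move=> sP tP; pose r (g : dual Q) : dual H := linfun (fun x => g (p x) : k^o).
have rE g x : r g x = g (p x) by rewrite linfunP //; lin.
have ri : injective r.
  by move=> f g E; apply/lfunP => b; have [x <-] := pS b; rewrite -!rE E.
have rM f g : r (f * g) = r f * r g.
  apply/lfunP => x; rewrite rE !dmulE pD /sw lin_tliftE; last by lin.
  by apply: eq_tlift => a b; rewrite tlift_tens ?rE //; lin.
have r1 : r 1 = 1.
  by apply/lfunP => x; rewrite rE !done_E.
have rg g : g \in @grouplike k (dual Q) -> r g \in @grouplike k (dual H).
  by move=> /gl_dualP[g1 gM]; apply/gl_dualP; split=> [|a b]; rewrite !rE ?p1 ?pM.
have [[us sg] [ut tg]] := (sP, tP); have [_ t1 _ tM] := gl_list_closed tP.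
have us' : {subset map r t <= s}.
  by move=> _ /mapP[g gt ->]; rewrite sg rg // -tg.
exists (map r t); split; rewrite ?size_map //; last first.
  move=> _ /mapP[g gt ->]; rewrite rE pc.
  by have /gl_dualP[] : g \in @grouplike k (dual Q) by rewrite -tg.
have [_ _ sU _] := gl_list_closed sP.
split; first by rewrite map_inj_uniq.
- by rewrite -r1 map_f.
- by move=> g /us' /sU.
by move=> _ _ /mapP[f ft ->] /mapP[g gt ->]; rewrite -rM map_f // tM.
Qed.

End QuotientGrouplike.

(** * Central group-likes and sums of small simple submodules *)

Section SmallSubmodules.
Variables (k : closedFieldType) (H : hopfAlgType k).
Hypothesis char_k : [pchar k] =i pred0.
Variables (L : H) (intL : norm_integral L).
Local Notation "a *: v" := (@GRing.scale k _ a v) : ring_scope.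
Implicit Types (X Y Z : {vspace H}) (g z : H).

Lemma dsub_ind (P : {vspace H} -> Prop) : P 0%VS ->
  (forall X Y, P X -> P Y -> P (X + Y)%VS) ->
  forall Y, dsub Y -> (forall X, simple_dsub X -> (X <= Y)%VS -> P X) -> P Y.
Proof.
move=> P0 PD Y; have [n] := ubnP (\dim Y); elim: n Y => // n IH Y lt dY PY.
have [->//|Y0] := eqVneq Y 0%VS.
have [X sX XY] := simple_sub dY Y0; have [dX X0 _] := sX.
have [Z [dZ XZ0 XZ]] := dsub_compl_in char_k intL dX dY XY.
have ZY : (Z <= Y)%VS by rewrite -XZ addvSr.
rewrite -XZ; apply: PD; first exact: PY.
apply: IH => // [|W sW WZ]; last exact: PY sW (subv_trans WZ ZY).
have : (\dim X + \dim Z)%N = \dim Y by rewrite -dimv_disjoint_sum ?XZ.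
have : (0 < \dim X)%N by rewrite lt0n dimv_eq0.
lia.
Qed.

Definition central_gl g := g \in @grouplike k H /\ forall h, g * h = h * g.

(** The coaction on a line is by a group-like element, and its generator, scaled to counit 1, is
    that element. The adjoint action on the line must be the counit, so the generator is central. *)
Lemma dsub_dim1 X : dsub X -> \dim X = 1%N -> exists2 g, central_gl g & X = <[g]>%VS.
Proof.
move=> dX X1; pose g0 := vpick X.
have g0X : g0 \in X := memv_pick X.
have g00 : g0 != 0 by rewrite vpick0 -dimv_eq0 X1.
have XE : X = <[g0]>%VS.
  by apply/esym/eqP; rewrite eqEdim -memvE g0X X1 dim_vline g00.
have [Xl Xa] := dX; have e0 : eps g0 != 0.
  apply: contra_neq g00 => e0; rewrite -[LHS](sw_epsr (f := id)); last by lin.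
  transitivity (sw (fun _ _ : H => 0 : H) g0); last first.
    by rewrite /sw /tlift big1 // => i _; rewrite big1 // => j _; rewrite scaler0.
  apply: (dsub_ext dX) => // [||a b]; try by lin.
  by rewrite XE => /vlineP[c ->]; rewrite linearZ /= e0 scaler0 scale0r.
pose g := (eps g0)^-1 *: g0.
have eg : eps g = 1 by rewrite linearZ /=; apply: mulVf.
have gX : X = <[g]>%VS.
  apply/esym/eqP; rewrite eqEdim -memvE memvZ //= X1 dim_vline.
  by rewrite scaler_eq0 invr_eq0 (negPf e0) (negPf g00).
have gX' : g \in X by rewrite memvZ.
exists g => //; split.
  rewrite inE eg eqxx andbT; apply/eqP.
  transitivity (sw (fun a b => eps b *: tens a g) g).
    have tE u v : id (tens u v) = tlift (@tens k H H) (tens u v).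
      by rewrite tlift_tens //; exact: bilin_tens.
    rewrite (tensor_ext (@lin_id _ _) (@lin_tlift _ _ _ _ _) tE (comul g)).
    apply: (dsub_ext dX) => //; [exact: bilin_tens | by lin |].
    move=> a b; rewrite gX => /vlineP[c ->].
    rewrite (lin_scale _ _ ((bilin_tens _ _).2 _)) linearZ /= eg; congr (_ *: _).
    exact/esym/mulr1.
  by rewrite (sw_epsr (f := fun a => tens a g)) //; lin.
move=> h; have adE y : ad y g = eps y *: g.
  have := Xa y g gX'; rewrite {1}gX => /vlineP[c cE].
  rewrite cE; congr (_ *: _).
  by have := counit_ad y g; rewrite cE linearZ /= eg mulr1 => <-; exact/esym/mulr1.
rewrite -[RHS]mul_ad; under eq_sw => a b do rewrite adE -scalerAl.
by rewrite (sw_epsl (f := fun b => g * b)) //; lin.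
Qed.

Lemma dsub_line g : central_gl g -> dsub <[g]>%VS.
Proof.
move=> [gg gC]; split=> [f x|h x] /vlineP[c ->].
  by rewrite (lin_scale _ _ (lin_lhit f)) memvZ // /lhit gl_sw ?memvZ ?memv_line //; lin.
rewrite (lin_scale _ _ (lin_ad h)) memvZ //.
suff -> : ad h g = eps h *: g by rewrite memvZ ?memv_line.
have -> : ad h g = g * sw (fun a b => a * ap b) h.
  by rewrite sw_mulr; apply: eq_sw => a b; rewrite mulrA gC.
by rewrite (sw_apr (f := id)) -?scalerAr ?mulr1 //; lin.
Qed.

Lemma dsub_span (s : seq H) : (forall g, g \in s -> central_gl g) -> dsub <<s>>%VS.
Proof.
elim: s => [|g s IH] sC; first by rewrite span_nil; exact: dsub0.
rewrite span_cons; apply: dsub_add; first by apply: dsub_line; apply: sC; rewrite mem_head.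
by apply: IH => x xs; apply: sC; rewrite inE xs orbT.
Qed.

(** Take [Y] of maximal dimension among submodules with only small simple ones. Adding a small
    simple [X] keeps the property: a simple [Z] of [X + Y] outside [Y] is disjoint from [Y], so its
    dimension is at most that of [X]. *)
Lemma small_dsub m : exists2 Y, dsub Y &
  forall X, simple_dsub X -> (X <= Y)%VS <-> (\dim X <= m)%N.
Proof.
pose P Y := dsub Y /\ forall X, simple_dsub X -> (X <= Y)%VS -> (\dim X <= m)%N.
pose R n := `[< exists2 Y, P Y & \dim Y = n >].
have R0 : exists n, R n.
  exists 0%N; apply/asboolP; exists 0%VS; last by rewrite dimv0.
  by split=> [|X _]; [exact: dsub0 | rewrite subv0 => /eqP->; rewrite dimv0].
have Rb n : R n -> (n <= \dim {:H})%N by move=> /asboolP[Y _ <-]; exact/dimvS/subvf.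
case: (ex_maxnP R0 Rb) => n /asboolP[Y [dY Ym] <-] mx; exists Y => // X sX.
split=> [|Xm]; first exact: Ym.
have [dX X0 Xs] := sX.
have disj Z : simple_dsub Z -> ~~ (Z <= Y)%VS -> (Z :&: Y)%VS = 0%VS.
  move=> [dZ _ Zs] ZY; case: (Zs (Z :&: Y)%VS) => //; first exact: dsub_cap.
    exact: capvSl.
  by move=> E; move: ZY; rewrite -E capvSr.
apply/negPn/negP => XY.
suff /mx : R (\dim (X + Y)).
  rewrite dimv_disjoint_sum ?disj //; have : (0 < \dim X)%N by rewrite lt0n dimv_eq0.
  lia.
apply/asboolP; exists (X + Y)%VS => //; split; first exact: dsub_add.
move=> Z sZ ZXY; have [|ZY] := boolP (Z <= Y)%VS; first exact: Ym.
have : (\dim (Z + Y) <= \dim (X + Y))%N by apply: dimvS; rewrite subv_add ZXY addvSr.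
rewrite !dimv_disjoint_sum ?disj //; lia.
Qed.

Lemma central_gl1 : central_gl 1.
Proof. by split=> [|h]; [exact: grouplike1 | rewrite mul1r mulr1]. Qed.

Lemma central_glM g g' : central_gl g -> central_gl g' -> central_gl (g * g').
Proof.
move=> [gg gC] [gg' gC']; split=> [|h]; first exact: gl_mul.
by rewrite -mulrA gC' mulrA gC -mulrA.
Qed.

Lemma central_gl_list : exists2 s, mul_closed_seq s & forall g, g \in s <-> central_gl g.
Proof.
have [|s [us sP]] := @bounded_list H central_gl (\dim {:H}).
  by move=> s us sP; apply: gl_size => // x /sP[].
exists s => //; split=> //; first by apply/sP; exact: central_gl1.
  by move=> x /sP[/gl_unit].
by move=> x y /sP xC /sP yC; apply/sP; exact: central_glM.
Qed.

(** [Y] is the span of the powers of [z]; the last clause is its induction principle. *)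
Lemma central_pow_dsub z r : prime r -> central_gl z -> z != 1 -> z ^+ r = 1 ->
  exists Y, [/\ dsub Y, 1 \in Y, (Y * Y <= Y)%VS, \dim Y = r & z \in Y] /\
   forall (W : vectType k) (F : H -> W), linear F -> forall Z : {vspace W},
     (forall i, F (z ^+ i) \in Z) -> forall y, y \in Y -> F y \in Z.
Proof.
move=> pr zC z1 zr; have [zg zc] := zC; have zu := gl_unit zg.
have zX i : central_gl (z ^+ i).
  elim: i => [|i IH]; first exact: central_gl1.
  by rewrite exprS; exact: central_glM.
pose s := [seq z ^+ i | i <- iota 0 r].
have r0 := prime_gt0 pr.
have zmod i : z ^+ i \in s.
  apply/mapP; exists (i %% r)%N; first by rewrite mem_iota add0n ltn_mod.
  by rewrite {1}(divn_eq i r) exprD mulnC exprM zr expr1n mul1r.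
have us : uniq s.
  rewrite map_inj_in_uniq ?iota_uniq // => i j; rewrite !mem_iota !add0n /=.
  wlog ij : i j / (i <= j)%N => [hw|] ir jr E.
    by case: (leqP i j) => [/hw|/ltnW/hw/(_ jr ir)] => [|h]; [exact|rewrite h].
  move: ij; rewrite leq_eqVlt => /predU1P[//|ij]; case/negP: z1; apply/eqP.
  have zd : z ^+ (j - i) = 1.
    have ui : z ^+ i \is a GRing.unit by rewrite unitrX.
    by apply: (mulrI ui); rewrite mulr1 -exprD subnKC // ltnW.
  have d0 : (0 < j - i)%N by rewrite subn_gt0.
  (* [z] is killed by the coprime exponents [j - i < r] and [r], hence equal to 1. *)
  have : coprime (j - i) r.
    by rewrite coprime_sym prime_coprime // gtnNdvd //; lia.
  rewrite /coprime; case: (egcdnP r d0) => a b ab _ /eqP cop.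
  transitivity (z ^+ (a * (j - i))); last by rewrite mulnC exprM zd expr1n.
  by rewrite ab exprD mulnC exprM zr expr1n mul1r cop expr1.
have sC g : g \in s -> central_gl g by case/mapP => i _ ->.
have sS g : g \in s -> g \in <<s>>%VS := @memv_span _ _ s g.
have lf (W : vectType k) (F : H -> W) : linear F -> forall Z : {vspace W},
     (forall i, F (z ^+ i) \in Z) -> forall y, y \in <<s>>%VS -> F y \in Z.
  move=> lF Z FZ y ys; rewrite (coord_span (X := in_tuple s) ys) (lin_sum _ _ lF).
  apply: memv_suml => i _; rewrite (lin_scale _ _ lF) memvZ //.
  by have /mapP[j _ ->] : s`_i \in s by rewrite mem_nth.
exists <<s>>%VS; split=> //; split; first exact: dsub_span.
- by have := zmod 0%N; exact: sS.
- apply/prodvP => x y xs ys; apply: (lf _ (fun x => x * y)) xs; first by lin.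
  move=> i; apply: (lf _ (fun y => z ^+ i * y)) ys; first by lin.
  by move=> j; rewrite -exprD; exact/sS/zmod.
- have /eqP -> : free s by apply: gl_free => // x /sC[].
  by rewrite size_map size_iota.
by have := zmod 1%N; exact: sS.
Qed.

End SmallSubmodules.

Section QuotientStep.
Variables (k : closedFieldType) (H : hopfAlgType k).
Hypothesis char_k : [pchar k] =i pred0.
Variables (L : H) (intL : norm_integral L).
Local Notation "a *: v" := (@GRing.scale k _ a v) : ring_scope.
Implicit Types (X Y Z : {vspace H}) (g z : H).

(** The last clause covers the case in which the group does not shrink: the embedded copy of the
    quotient's group is then the whole group. *)
Lemma quotient_step Y (s : seq (dual H)) :
  dsub Y -> 1 \in Y -> (Y * Y <= Y)%VS -> gl_list s ->
  exists (Q : hopfAlgType k) (L' : Q) (t : seq (dual Q)) (c : H),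
    [/\ norm_integral L', gl_list t, \dim {:H} = (\dim Y * \dim {:Q})%N
      & (size t %| size s)%N] /\
    [/\ c \in Y, (forall h, c * h = h * c) /\ c * c = c, eps c = 1,
        \dim (limg (amull c)) = \dim {:Q}
      & size t = size s -> forall g : dual H, g \in s -> g c = 1].
Proof.
move=> dY Y1 YY sP.
have [c [[cY cC cc ec cE] apc Dc dimH]] := normal_subalg_idem char_k intL dY Y1 YY.
have [Q [p [[pL p1 pM] [pS pK dimQ pe pD]]]] := idem_quotient cC cc ec apc Dc.
have [t tP] := gl_list_exists (dual Q).
have pc : p c = 1.
  apply/eqP; rewrite -p1 -subr_eq0 -(lin_mapB _ _ pL); apply/eqP/pK.
  by rewrite mulrBr cc mulr1 subrr.
have [u [cu su us uc]] := quotient_gl pL p1 pM pS pc pe pD sP tP.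
exists Q, (p L), t, c; split; split=> //.
- split=> [b|]; last by rewrite pe intL.2.
  by have [x <-] := pS b; rewrite -pM intL.1 (lin_scale _ _ pL) pe.
- by rewrite dimQ.
- by rewrite -su; apply: list_lagrange (gl_list_closed sP) cu us.
move=> ts g gs; apply: uc; have [uu _ _ _] := cu.
by rewrite (uniq_min_size uu us _).2 // su ts.
Qed.

End QuotientStep.

(** * Characters at a central idempotent: the case of equal groups *)

Section CentralIdempotent.
Variables (k : closedFieldType) (H : hopfAlgType k).
Hypothesis char_k : [pchar k] =i pred0.
Variables (L : H) (intL : norm_integral L).
Local Notation "a *: v" := (@GRing.scale k _ a v) : ring_scope.
Variables (I : finType) (e : I -> H).
Hypothesis sys : idem_system e.
Implicit Types (f g : dual H).

Let ee i : e i * e i = e i. Proof. by have [/(_ i)[]] := sys. Qed.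

(** The norm is the sum of the squares of the natural coefficients. *)
Lemma natchar_norm1 f : natchar f -> (f * ap f) L = 1 -> exists l, f = chi e l.
Proof.
case/(natchar_coef sys) => n fE.
have pn j : (f * ap (chi e j) : dual H) L = (n j)%:R.
  rewrite fE mulr_suml sum_lfunE (bigD1 j) //= big1 ?addr0 => [|i ij].
    by rewrite -scalerAl scale_lfunE (chi_pairing char_k intL sys) eqxx; exact: mulr1.
  rewrite -scalerAl scale_lfunE (chi_pairing char_k intL sys) (negPf ij).
  exact: mulr0.
have -> : (f * ap f) L = (\sum_j n j ^ 2)%N%:R.
  rewrite {2}fE linear_sum mulr_sumr sum_lfunE natr_sum; apply: eq_bigr => j _.
  rewrite linearZ /= -scalerAr scale_lfunE pn natrX expr2; exact: erefl.
rewrite -[RHS](mulr1n 1) => /(natr_inj0 char_k) n1.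
have [l nl] : exists l, (0 < n l)%N.
  apply/existsP; apply: contraPT n1 => /existsPn n0; rewrite big1 // => j _.
  by have := n0 j; rewrite -eqn0Ngt => /eqP->.
move: n1; rewrite (bigD1 l) //= => n1; exists l; rewrite fE (bigD1 l) //= big1 ?addr0.
  rewrite (_ : n l = 1%N) ?scale1r //; have : (n l <= n l ^ 2)%N by rewrite -mulnn leq_pmulr.
  lia.
move=> j jl; move: n1; rewrite (bigD1 j) //= => n1.
rewrite (_ : n j = 0%N) ?scale0r //.
have : (n l <= n l ^ 2)%N by rewrite -mulnn leq_pmulr.
have : (n j <= n j ^ 2)%N by case: (n j) => // m; rewrite -mulnn leq_pmulr.
lia.
Qed.

Variables (c : H) (cC : forall h, c * h = h * c) (cc : c * c = c).

Lemma central_idemP i : c * e i = 0 /\ chi e i c = 0 \/ c * e i = e i /\ chi e i c = (deg e i)%:R.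
Proof.
have [a aE] := central_scalar sys i cC.
have ce : c * e i = a *: e i by have := aE 1; rewrite mulr1 mul1r.
have cX : chi e i c = a * (deg e i)%:R.
  by rewrite chiE -{1}[c]mulr1 (irr_central _ aE) (irr1 sys).
have : a *: e i - (a * a) *: e i == 0.
  rewrite subr_eq0 -scalerA -ce scalerAr -ce mulrA cc; exact: eqxx.
rewrite -scalerBl scaler_eq0; have [/(_ i)[/negPf -> _ _] _ _] := sys.
rewrite orbF -{1}[a]mulr1 -mulrBr mulf_eq0 => /orP[/eqP a0|].
  by left; rewrite ce cX a0 scale0r mul0r.
by rewrite subr_eq0 => /eqP a1; right; rewrite ce cX -a1 scale1r mul1r.
Qed.

Lemma central_idem_dim :
  \dim (limg (amull c)) = (\sum_(i | (chi e i c != 0)%R) deg e i ^ 2)%N.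
Proof.
apply: (natr_inj0 char_k); rewrite -(lam_idem char_k intL cc).
rewrite (lam_regular char_k intL) (regular_charE sys) natr_sum [RHS]big_mkcond.
apply: eq_bigr => i _; rewrite -chiE.
case: (central_idemP i) => [[_ ->]|[_ ->]]; first by rewrite eqxx mulr0.
by rewrite natr_eq0 // -lt0n (deg_gt0 sys) natrX expr2.
Qed.

Variable s : seq (dual H).
Hypotheses (sP : gl_list s) (sc : forall g, g \in s -> g c = 1).
Hypothesis sdim : \dim (limg (amull c)) = size s.

(** The characters of degree one are all nonzero at [c], and their number is already the dimension
    of [c * H], the sum of the squared degrees over the characters not vanishing at [c]. *)
Lemma central_idem_deg1 i : chi e i c != 0 -> deg e i = 1%N.
Proof.
move=> ci; apply/eqP/negPn/negP => di.
have := sdim; rewrite central_idem_dim (bigID (fun i => deg e i == 1%N)) /=.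
rewrite (gl_list_size char_k sys sP) -sum1_card.
rewrite (eq_big [pred i | deg e i == 1%N] (fun _ => 1%N)); last first.
- by move=> j /andP[_ /eqP ->].
- move=> j; rewrite inE /=; case: (deg e j =P 1%N) => dj; rewrite ?andbF // andbT.
  rewrite sc ?oner_eq0 //; have [_ ->] := sP; exact: gl_chi.
rewrite [X in (_ + X)%N](bigD1 i) ?ci //=.
have : (0 < deg e i ^ 2)%N by rewrite expn_gt0 (deg_gt0 sys).
move=> d0 /eqP; rewrite -[X in _ == X]addn0 eqn_add2l addn_eq0.
by rewrite gtn_eqF.
Qed.

Hypothesis sprime : prime (size s).
Hypothesis chic : forall i x,
  (chi e i * ap (chi e i) : dual H) (c * x) = (chi e i * ap (chi e i) : dual H) x.

Lemma stabilizer_dvd f : (size [seq g <- s | (g * f == f)%R] %| size s)%N.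
Proof.
apply: list_lagrange (gl_list_closed sP) _ _; last by move=> g; rewrite mem_filter => /andP[].
have [us s1 sU sM] := gl_list_closed sP; split; first exact: filter_uniq.
- by rewrite mem_filter mul1r eqxx.
- by move=> g; rewrite mem_filter => /andP[_ /sU].
move=> g h; rewrite !mem_filter => /andP[/eqP gf gs] /andP[/eqP hf hs].
by rewrite -mulrA hf gf eqxx sM.
Qed.

(** The multiplicity of [chi j] is the pairing of [ap (chi j) * chi i] with [chi i]. The former has
    norm 1, hence is irreducible, and the pairing tests equality. *)
Lemma chi_ap_coef i j : deg e j = 1%N ->
  (chi e i * ap (chi e i) : dual H) (e j) = (chi e j * chi e i == chi e i)%:R.
Proof.
move=> dj; set f := chi e i * _.
have gg : chi e j \in @grouplike k (dual H) by exact: gl_chi.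
have tf : tracial f.
  by apply: tracialM; [|apply: tracial_ap]; exact: tracial_chi.
rewrite (tracial_pairing char_k intL sys tf) sum_lfunE (bigD1 j) //= big1 ?addr0; last first.
  move=> l lj; rewrite scale_lfunE (chi_e sys) (negPf lj); exact: mulr0.
rewrite scale_lfunE (chi_e sys) eqxx [LHS]mulr1 /f mulrA.
set h := ap (chi e j) * chi e i.
have SS g : ap (ap g) = g :> dual H.
  by apply/lfunP => x; rewrite !dual_antipodeE (antipode2 char_k intL).
have [l hl] : exists l, h = chi e l.
  apply: natchar_norm1.
    apply: (natcharM sys); first by apply: natchar_ap; exact: natchar_chi.
    exact: natchar_chi.
  rewrite /h antipodeM SS mulrA (pairing_cocomm char_k intL) !mulrA.
  by rewrite gl_mulrV // mul1r (chi_pairing char_k intL sys) eqxx.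
rewrite hl (chi_pairing char_k intL sys); congr (nat_of_bool _)%:R.
apply/eqP/eqP => [li|E]; first by rewrite -{1}li -hl /h mulrA gl_mulrV // mul1r.
by apply: (chi_inj sys); rewrite -hl /h -{1}E mulrA gl_mulV // mul1r.
Qed.

(** By [chic] a constituent of [chi i * ap (chi i)] cannot be killed by [c]; so all constituents
    have degree one, and their number is the order of a stabilizer. *)
Lemma central_idem_neq0 i : chi e i c != 0.
Proof.
case: (central_idemP i) => [[ci ci0]|[_ ->]]; last by rewrite natr_eq0 // -lt0n (deg_gt0 sys).
pose f := chi e i * ap (chi e i) : dual H.
have tf : tracial f.
  by apply: tracialM; [|apply: tracial_ap]; exact: tracial_chi.
have fe j : f (e j) * (deg e j)%:R =
    (if deg e j == 1%N then (chi e j * chi e i == chi e i)%:R else 0).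
  case: eqP => [dj|/eqP dj]; first by rewrite dj mulr1 chi_ap_coef.
  case: (central_idemP j) => [[cj _]|[_ cj]]; first by rewrite /f -chic cj linear0 mul0r.
  case/eqP: dj; apply: central_idem_deg1.
  by rewrite cj natr_eq0 // -lt0n (deg_gt0 sys).
have fd : f 1 = ((deg e i) ^ 2)%N%:R.
  rewrite /f dmulE comul1 tlift_tens; last by lin.
  by rewrite dual_antipodeE antipode1 !chiE (irr1 sys) natrX expr2.
have : f 1 = (size [seq g <- s | (g * chi e i == chi e i)%R])%:R.
  rewrite (tracial_expand sys tf) sum_lfunE.
  transitivity (\sum_j f (e j) * (deg e j)%:R).
    by apply: eq_bigr => j _; rewrite scale_lfunE chiE (irr1 sys).
  rewrite (eq_bigr _ (fun j _ => fe j)) -big_mkcond /= -natr_sum; congr _%:R.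
  have /seq.permP pP := gl_list_chi char_k sys sP.
  rewrite size_filter pP count_map -sum1_count big_enum_cond /= [RHS]big_mkcondr.
  by apply: eq_big => [j|j _]; rewrite ?inE //=; case: eqP.
rewrite fd => /(natr_inj0 char_k) di; have := stabilizer_dvd (chi e i).
rewrite -di => dq; have dd : (deg e i %| size s)%N by apply: dvdn_trans dq; exact: dvdn_mulr.
(* The degree is 1 or [size s]; in the second case its square would divide [size s]. *)
have [_ /(_ _ dd)/orP[/eqP d1|/eqP dS]] := primeP sprime.
  have : chi e i \in s by have [_ ->] := sP; exact: gl_chi.
  by move=> /sc /eqP; rewrite ci0 eq_sym oner_eq0.
move: (dvdn_leq (prime_gt0 sprime) dq); rewrite dS.
have := prime_gt1 sprime; nia.
Qed.

Lemma central_idem_dim_eq : \dim {:H} = size s.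
Proof.
rewrite -sdim central_idem_dim (dim_sum_deg char_k sys).
by apply: eq_bigl => i; rewrite central_idem_neq0.
Qed.

End CentralIdempotent.

(** * The induction on the dimension *)

Section Claim.
Variable k : closedFieldType.
Hypothesis char_k : [pchar k] =i pred0.
Local Notation "a *: v" := (@GRing.scale k _ a v) : ring_scope.

(** A central group-like acts on a simple module by a scalar and on its dual by the inverse
    scalar. *)
Lemma chi_ap_mul (H : hopfAlgType k) (I : finType) (e : I -> H) (z : H) i x :
  idem_system e -> central_gl z ->
  (chi e i * ap (chi e i) : dual H) (z * x) = (chi e i * ap (chi e i) : dual H) x.
Proof.
move=> sys [zg zC]; have [a aE] := central_scalar sys i zC.
have cz y : chi e i (z * y) = a * chi e i y by rewrite !chiE (irr_central _ aE).
rewrite !dmulE -!/(sw _ _) sw_mul; last by lin.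
rewrite (gl_sw (f := fun u v => sw (fun c d =>
  chi e i (u * c) * (ap (chi e i) : dual H) (v * d) : k^o) x)) //; last by lin.
apply: eq_sw => u v; rewrite !dual_antipodeE antipodeM cz.
rewrite -[ap v in RHS]mulr1 -(gl_mulV zg) mulrA -zC cz.
by rewrite mulrA [chi e i u * _]mulrC.
Qed.

Variables (p q b : nat).
Hypotheses (pp : prime p) (qp : prime q) (ltpq : (p ^ 4 < q)%N).

Let p0 : (0 < p)%N. Proof. exact: prime_gt0. Qed.
Let p2q : (p ^ 2 < q)%N.
Proof. by apply: leq_ltn_trans ltpq; rewrite leq_exp2l // prime_gt1. Qed.
Let pq : (p < q)%N.
Proof. by apply: leq_ltn_trans p2q; rewrite -{1}[p]expn1 leq_exp2l // prime_gt1. Qed.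

Let dvd_p2 d : (d %| p ^ 2 * q ^ b)%N -> ~~ (q %| d)%N -> (d %| p ^ 2)%N.
Proof.
move=> dN qd; rewrite -(@Gauss_dvdl d (p ^ 2) (q ^ b)) //.
by apply: coprimeXr; rewrite coprime_sym prime_coprime.
Qed.

Let dvd_p2_lt d : (d %| p ^ 2 * q ^ b)%N -> (0 < d < q)%N -> (d %| p ^ 2)%N.
Proof. by move=> dN /andP[d0 dq]; apply: dvd_p2 => //; rewrite gtnNdvd. Qed.

Lemma simple_dim1 (H : hopfAlgType k) (X : {vspace H}) :
  dsub X -> \dim X = 1%N -> simple_dsub X.
Proof.
move=> dX X1; split=> //; first by rewrite -dimv_eq0 X1.
move=> Y dY YX; have [/eqP|Y0] := posnP (\dim Y).
  by rewrite dimv_eq0 => /eqP; left.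
by right; apply/eqP; rewrite eqEdim YX X1.
Qed.

Section SmallPart.
Variables (H : hopfAlgType k) (L : H) (intL : norm_integral L).
Implicit Types (X : {vspace H}) (g : H).
Hypothesis dimH : (\dim {:H} %| p ^ 2 * q ^ b)%N.
Variable Y : {vspace H}.
Hypothesis dY : dsub Y.
Hypothesis Ysm : forall X, simple_dsub X -> (X <= Y)%VS <-> (\dim X <= p ^ 2)%N.

Lemma simple_dvd X : simple_dsub X -> (\dim X %| p ^ 2 * q ^ b)%N.
Proof. by move=> sX; apply: dvdn_trans (simple_dim_dvd char_k intL sX) dimH. Qed.

Lemma simple_gt0 (X : {vspace H}) : simple_dsub X -> (0 < \dim X)%N.
Proof. by case=> _ X0 _; rewrite lt0n dimv_eq0. Qed.

Lemma small_dsub_dvd X : simple_dsub X -> (X <= Y)%VS -> (\dim X %| p ^ 2)%N.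
Proof.
move=> sX /(Ysm sX) Xp; apply: dvd_p2_lt; first exact: simple_dvd.
by rewrite simple_gt0 //= (leq_ltn_trans Xp).
Qed.

Lemma central_gl_small g : central_gl g -> (<[g]> <= Y)%VS.
Proof.
move=> gC; have dg : \dim <[g]> = 1%N.
  by rewrite dim_vline; case: eqP (gl_unit gC.1) => // ->; rewrite unitr0.
by apply/Ysm; [apply: simple_dim1 => //; exact: dsub_line | rewrite dg expn_gt0 p0].
Qed.

Lemma small1 : 1 \in Y.
Proof. by rewrite memvE; apply: central_gl_small; exact: central_gl1. Qed.

Lemma small_mul : (Y * Y <= Y)%VS.
Proof.
apply: (dsub_ind char_k intL (P := fun X => (X * Y <= Y)%VS)) dY _ => [|X X'|X sX XY].
- by rewrite prod0v sub0v.
- by rewrite prodvDl subv_add => -> ->.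
apply: (dsub_ind char_k intL (P := fun X' => (X * X' <= Y)%VS)) dY _ => [|X' X''|X' sX' XY'].
- by rewrite prodv0 sub0v.
- by rewrite prodvDr subv_add => -> ->.
have [[dX _ _] [dX' _ _]] := (sX, sX').
apply: (dsub_ind char_k intL (P := fun X => (X <= Y)%VS)) (dsub_mul dX dX') _.
- exact: sub0v.
- by move=> A B; rewrite subv_add => -> ->.
move=> A sA AXX; apply/Ysm => //; apply: dvdn_leq; first by rewrite expn_gt0 p0.
apply: dvd_p2_lt; first exact: simple_dvd.
rewrite simple_gt0 //=; apply: leq_ltn_trans ltpq.
apply: (leq_trans (dimvS AXX)); apply: (leq_trans (dim_prodv _ _)).
by rewrite (expnD p 2 2) leq_mul //; exact/Ysm.
Qed.

(** A simple submodule of a complement of [Y] is not small, so its dimension does not divide [p ^ 2]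
    and must be divisible by [q]. *)
Lemma small_dvd_q : (q %| \dim {:H})%N -> (q %| \dim Y)%N.
Proof.
move=> qN; have [Z [dZ YZ0 YZ]] := dsub_compl char_k intL dY.
suff qZ : (q %| \dim Z)%N by move: qN; rewrite -YZ dimv_disjoint_sum // dvdn_addl.
apply: (dsub_dvd char_k intL dZ) => X sX XZ; apply/negPn/negP => qX.
have : (X <= Y)%VS.
  apply/Ysm => //; apply: dvdn_leq; first by rewrite expn_gt0 p0.
  by apply: dvd_p2 => //; exact: simple_dvd.
move=> XY; have := simple_gt0 sX; rewrite lt0n dimv_eq0 -subv0 -YZ0 subv_cap XY XZ.
by [].
Qed.

Lemma small_full : ~~ (q %| \dim {:H})%N -> Y = {:H}%VS.
Proof.
move=> qN; apply/eqP; rewrite eqEsubv subvf /=.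
apply: (dsub_ind char_k intL (P := fun X => (X <= Y)%VS)) (@dsub_full _ H) _.
- exact: sub0v.
- by move=> A B; rewrite subv_add => -> ->.
move=> X sX _; apply/Ysm => //; apply: dvdn_leq; first by rewrite expn_gt0 p0.
by apply: dvdn_trans (simple_dim_dvd char_k intL sX) (dvd_p2 dimH qN).
Qed.

(* A simple submodule of [Y] that is not the line of a central group-like has
   dimension divisible by [p]. *)
Lemma central_gl_count s : mul_closed_seq s -> (forall g, g \in s <-> central_gl g) ->
  exists d, [/\ \dim Y = (size s + d)%N, (p %| d)%N &
    (0 < d)%N -> (p %| \dim {:H})%N].
Proof.
move=> [us _ _ _] sP; have sC g : g \in s -> central_gl g by move/sP.
have sY : (<<s>> <= Y)%VS.
  by apply/span_subvP => g /sC /central_gl_small; rewrite memvE.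
have [Z [dZ sZ0 sZ]] := dsub_compl_in char_k intL (dsub_span sC) dY sY.
have sd : \dim <<s>> = size s by apply/eqP/gl_free => // g /sC[].
have ZY : (Z <= Y)%VS by rewrite -sZ addvSr.
have pX X : simple_dsub X -> (X <= Z)%VS -> (p %| \dim X)%N.
  move=> sX XZ; have [dX X0 _] := sX.
  have := small_dsub_dvd sX (subv_trans XZ ZY).
  case/(dvdn_pfactor _ _ pp) => [[|m]] _ XE; last by rewrite XE expnS dvdn_mulr.
  have [g /sP gs gX] := dsub_dim1 dX XE.
  move: X0; rewrite -subv0 -sZ0 subv_cap XZ gX -memvE memv_span //.
exists (\dim Z); split; first by rewrite -sZ dimv_disjoint_sum ?sd.
  exact: (dsub_dvd char_k intL dZ).
rewrite lt0n dimv_eq0 => Z0; have [X sX XZ] := simple_sub dZ Z0.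
exact: dvdn_trans (pX X sX XZ) (simple_dim_dvd char_k intL sX).
Qed.

End SmallPart.

Lemma dim_eq_gl (H : hopfAlgType k) (L : H) (s : seq (dual H)) :
  norm_integral L -> (\dim {:H} %| p ^ 2 * q ^ b)%N -> gl_list s ->
  size s = 1%N \/ size s = q -> \dim {:H} = size s.
Proof.
have [n] := ubnP (\dim {:H}); elim: n H L s => // n IH H L s lt intL dimH sP s1q.
have [I [e sys]] := idem_system_exists (integral_vn_regular intL).
have N0 : (0 < \dim {:H})%N by rewrite lt0n -(natr_eq0 char_k) (dim_neq0 H char_k).
(* The group of the quotient has order [t] dividing that of [s], so [t] is 1 or [q], and the
   induction hypothesis makes [t] the dimension of the quotient. If [t = q], the two groups have the
   same order, whence the clauses on [c]. *)
have step (Y : {vspace H}) : dsub Y -> 1 \in Y -> (Y * Y <= Y)%VS -> (1 < \dim Y)%N ->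
    exists c t, [/\ c \in Y, (forall h, c * h = h * c) /\ c * c = c,
      eps c = 1, (\dim {:H} = \dim Y * t)%N &
      t = 1%N \/ [/\ t = q, size s = q, \dim (limg (amull c)) = size s &
        forall g : dual H, g \in s -> g c = 1]].
  move=> dY Y1 YY Yd.
  have [Q [L' [t [c [[intL' tP NE ts] [cY cC ec cd tsE]]]]]] :=
    quotient_step char_k intL dY Y1 YY sP.
  have Q0 : (0 < \dim {:Q})%N by rewrite lt0n -(natr_eq0 char_k) (dim_neq0 Q char_k).
  have t1q : size t = 1%N \/ size t = q.
    case: s1q ts => ->; first by rewrite dvdn1 => /eqP; left.
    by have [_ qd] := primeP qp => /qd/orP[/eqP|/eqP]; [left | right].
  have Qt : \dim {:Q} = size t.
    apply: (IH _ L') => //; first by rewrite NE in lt; nia.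
    by apply: dvdn_trans dimH; rewrite NE dvdn_mull.
  exists c, (size t); split=> //; first by rewrite NE Qt.
  case: t1q => tE; [by left | right].
  have sE : size s = q.
    case: s1q => // s1; move: ts; rewrite s1 tE dvdn1 => /eqP q1.
    by move: qp; rewrite q1.
  by rewrite cd Qt tE sE; split=> //; apply: tsE; rewrite tE sE.
have [Y dY Ysm] := @small_dsub k H (p ^ 2).
have Y1 := small1 Ysm.
have YY := small_mul intL dimH dY Ysm.
have Y0 : (0 < \dim Y)%N.
  rewrite lt0n dimv_eq0; apply: contraTneq Y1 => ->.
  by rewrite memv0 oner_eq0.
have s_comm : (forall x y : H, x * y = y * x) -> \dim {:H} = size s.
  by move=> xy; rewrite (comm_gl_list char_k sys sP xy).
(* If [Y] is a line, [q] does not divide [N], since it would divide [\dim Y]. Then every simple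
   submodule is small and [H = Y] is commutative. *)
have [Yd|] := ltnP 1 (\dim Y); last first.
  move=> Yle; have Yd : \dim Y = 1%N by apply/eqP; rewrite eqn_leq Yle.
  have YH : Y = {:H}%VS.
    apply: (small_full intL dimH Ysm); apply/negP => /(small_dvd_q intL dimH dY Ysm).
    by rewrite Yd dvdn1 => /eqP q1; move: qp; rewrite q1.
  apply: s_comm => x y; have /vlineP[a ->] : x \in <[1 : H]>%VS.
    rewrite (_ : <[1 : H]>%VS = {:H}%VS) ?memvf // -YH; apply/eqP.
    by rewrite eqEdim -memvE Y1 Yd dim_vline oner_eq0.
  by rewrite -scalerAl -scalerAr mul1r mulr1.
have [c [t [cY _ _ NE t1q]]] := step Y dY Y1 YY Yd.
have [sK cK KP] := @central_gl_list k H.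
have [d [Yd' pd dN]] := central_gl_count intL dimH dY Ysm cK KP.
(* [r = p] if [p] divides [\dim Y], because it divides [d]. Otherwise [d = 0], since a positive [d]
   would make [p] divide [\dim Y * t] with [t] equal to 1 or [q]; and [\dim Y], prime to [p], is a
   nontrivial power of [q]. *)
have [r [pr rK]] : exists r, prime r /\ (r %| size sK)%N.
  have [pY|pY] := boolP (p %| \dim Y)%N.
    by exists p; split=> //; move: pY; rewrite Yd' dvdn_addl.
  exists q; split=> //.
  have d0 : d = 0%N.
    apply/eqP; rewrite -leqn0 leqNgt; apply/negP => /dN.
    rewrite NE Euclid_dvdM // (negPf pY) /=.
    case: t1q => [->|[-> _ _ _]]; first by rewrite dvdn1 => /eqP p1; move: pp; rewrite p1.
    by rewrite dvdn_prime2 // => /eqP pqE; move: pq; rewrite pqE ltnn.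
  rewrite -[size sK]addn0 -d0 -Yd'.
  have YN : (\dim Y %| q ^ b)%N.
    rewrite -(@Gauss_dvdr (\dim Y) (p ^ 2)) //; last first.
      by rewrite coprimeXr // coprime_sym prime_coprime.
    by apply: dvdn_trans dimH; rewrite NE dvdn_mulr.
  case/(dvdn_pfactor _ _ qp): YN Yd => [[|m]] _ ->; first by rewrite expn0.
  by rewrite expnS dvdn_mulr.
have [z /KP zC [z1 zr]] := list_cauchy cK pr rK.
have [Yz [[dYz Yz1 YYz Yzr zY] Yzind]] := central_pow_dsub pr zC z1 zr.
have [|c' [t' [c'Y [c'C c'c'] ec' NE' t'1q]]] := step Yz dYz Yz1 YYz.
  by rewrite Yzr prime_gt1.
case: t'1q => [t'1|[_ sE c'd sc']].
  have YH : Yz = {:H}%VS by apply/eqP; rewrite eqEdim subvf /= NE' t'1 muln1.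
  apply: s_comm => x y; apply/eqP; rewrite -subr_eq0 -memv0.
  apply: (Yzind _ (fun u => x * u - u * x)); [by lin | | by rewrite YH memvf].
  move=> i; suff -> : x * z ^+ i = z ^+ i * x by rewrite subrr mem0v.
  by apply: commrX; exact/esym/zC.2.
apply: (central_idem_dim_eq char_k intL sys c'C c'c' sP sc' c'd); first by rewrite sE.
move=> i x; set f := (chi e i * _).
(* By linearity [f (y * x) = eps y * f x] for every [y] in the span of the powers of [z], in
   particular for [c']. *)
have fz j : f (z ^+ j * x) = f x.
  by elim: j => [|j IHj]; rewrite ?mul1r // exprS -mulrA chi_ap_mul.
have : f (c' * x) - eps c' * f x \in (0%VS : {vspace k^o}).
  apply: (Yzind k^o (fun u => f (u * x) - eps u * f x : k^o)) c'Y; first by lin.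
  move=> j; rewrite fz; have /andP[_ /eqP ->] : z ^+ j \in @grouplike k H by exact: gl_exp zC.1.
  by rewrite mul1r subrr mem0v.
by rewrite ec' mul1r memv0 subr_eq0 => /eqP.
Qed.

End Claim.

Local Close Scope ring_scope.

Theorem lemma3p3 (k : closedFieldType) (char_k : [pchar k]%R =i pred0)
    (p q : nat) (p_prime : prime p) (q_prime : prime q) (lt_p4_q : p ^ 4 < q)
    (H : hopfAlgType k) (ss_H : semisimple_alg H)
    (dim_H : \dim {:H} = p ^ 2 * q ^ 2) :
  ([set: grouplikes (dual H)] #!= `I_q)%card.
Proof.
apply/negP => cardq; have [L intL] := semisimple_integral ss_H.
have [s sP] := gl_list_exists (dual H).
have sq : size s = q := gl_list_card sP cardq.
(* A group of order [q] would force [p ^ 2 * q ^ 2 = q]. *)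
have := dim_eq_gl char_k p_prime q_prime lt_p4_q (b := 2) intL _ sP.
rewrite dim_H sq => /(_ (dvdnn _) (or_intror erefl)).
have := prime_gt1 q_prime; have := prime_gt0 p_prime; nia.
Qed.
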